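(* Let $M$ be the module of a minimal higher matrix factorization with respect to a regular sequence $f_1,\dots,f_c$ in a regular local ring $S$ with residue field $k$. Let $E=k\langle e_1,\dots,e_c\rangle$ act on $\operatorname{Tor}^S(M,k)$ via homotopies, let $T' := E\cdot \operatorname{Tor}^S_0(M,k)\subset \operatorname{Tor}^S(M,k)$ and $T'' := \operatorname{Tor}^S(M,k)/T'$. Then: (i) The submodule $T'$ has underlying vector space $$T'=\bigoplus_{p=1}^c E(p-1)\otimes_k\overline{B_0(p)},$$ and thus the quotient $T''$ has underlying vector space $$T''\cong\bigoplus_{p=1}^c E(p-1)\otimes_k\overline{B_1(p)},$$ where, for $s=0,1$, the action of $E(p-1)$ on the summand $E(p-1)\otimes_k\overline{B_s(p)}$ is by multiplication on the left tensor factor. (ii) The $E$-module $T'$ is generated by $\overline{A_0}$, in degree $0$, and $T''$ is generated by $\overline{A_1}$, in degree $1$. Both $T'$ and $T''$ have linear $E$-free resolutions. (iii) The minimal free resolution of $\operatorname{Tor}^S(M,k)$ as an $E$-module is the mapping cone of a map of complexes from the minimal $E$-free resolution of $T''$ (shifted by $-1$) to the minimal $E$-free resolution of $T'$. (iv) For all $1\le p\le r\le c$ and each basis element $a$ of $\overline{B_0(p)}$ or $\overline{B_1(p)}$, let $e_ra-b$ be a homogeneous relation on $\operatorname{Tor}^S(M,k)$ with $b\in (e_1,\dots,e_{r-1})(\overline{A_0\oplus A_1})$ (such relations exist). The relations with $a\in\overline{A_0}$ form a Gröbner basis of the relations on the $E$-module $T'$ (generated by $\overline{A_0}$), and those with $a\in\overline{A_1}$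 form (after passing to $T''$, i.e. modulo $E\otimes_k\overline{A_0}$) a Gröbner basis of the relations on the $E$-module $T''$ (generated by $\overline{A_1}$), with respect to any term order refining the lexicographic order on the monomials of $E$ with $e_c\succ\dots\succ e_1$.
   Context: Setting. $S$ is a regular local ring with maximal ideal $\mathfrak m$ and residue field $k$; all modules are finitely generated. $f_1,\dots,f_c\in\mathfrak m$ is a regular sequence, $I=(f_1,\dots,f_c)$, $R=S/I$. An overline denotes $k\otimes_S-$. A map of free modules is minimal if its image lies in $\mathfrak m$ times the target. Higher matrix factorizations (Eisenbud–Peeva). A higher matrix factorization $(d,h)$ with respect to $f_1,\dots,f_c$ consists of: finitely generated free $S$-modules $A_0,A_1$ with filtrations $0=A_s(0)\subseteq A_s(1)\subseteq\dots\subseteq A_s(c)=A_s$ ($s=0,1$) such that each $A_s(p-1)$ is a free direct summand of $A_s(p)$; and maps $\bigoplus_{q=1}^cA_0(q)\xrightarrow{h}A_1\xrightarrow{d}A_0$ preserving filtrations (the left module being filtered by $\bigoplus_{q\le p}A_0(q)$) such that the induced maps $A_0(p)\xrightarrow{h_p}A_1(p)\xrightarrow{d_p}A_0(p)$ satisfy, for all $p$: (a) $d_ph_p\equiv f_p\,\mathrm{Id}_{A_0(p)}$ mod $(f_1,\dots,f_{p-1})A_0(p)$; (b) $\pi_ph_pd_p\equiv f_p\pi_p$ mod $(f_1,\dots,f_{p-1})B_1(p)$, where $\pi_p:A_1(p)\to B_1(p):=A_1(p)/A_1(p-1)$ is the projection. It is minimal if $d$ and $h$ are minimal. Its module is $M=\operatorname{coker}(R\otimes_S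 d)$. Put $B_0(p)=A_0(p)/A_0(p-1)$ and fix splittings $A_s(p)=\bigoplus_{q\le p}B_s(q)$. Then $d_p$ restricted to $B_1(p)$ has components $b_p:B_1(p)\to B_0(p)$ and $\psi_p:B_1(p)\to A_0(p-1)$; $\mathbf B(p)$ is the two-term complex $b_p:B_1(p)\to B_0(p)$. Layered resolution. Put $\mathbf L(0)=0$ and let $\mathbf L(p)$ be the mapping cone of a map of complexes $\Psi_p:\mathbf K(f_1,\dots,f_{p-1})\otimes_S\mathbf B(p)[-1]\to\mathbf L(p-1)$ that extends $\psi_p:B_1(p)\to \mathbf L(p-1)_0=A_0(p-1)$ and is zero on $\mathbf K(f_1,\dots,f_{p-1})\otimes B_0(p)$, where $\mathbf K$ denotes the Koszul complex. Then $\mathbf L=\mathbf L(c)$ is an $S$-free resolution of $M$, minimal when the factorization is minimal, and $\mathbf L_0=A_0$, while $A_1$ is a direct summand of $\mathbf L_1$. Hence $\operatorname{Tor}^S(M,k)=\overline{\mathbf L}$, $\overline{A_0}=\operatorname{Tor}_0^S(M,k)$ and $\overline{A_1}\subset\operatorname{Tor}_1^S(M,k)$. Exterior algebra. $E=\bigwedge_k(I/\mathfrak mI)=k\langle e_1,\dots,e_c\rangle$ with $e_i$ the class of $f_i$, of degree 1, and $E(p)=k\langle e_1,\dots,e_p\rangle$. If $(\mathbf F,\partial)$ is a free resolution of $M$ and $\sigma_i$ is a homotopy for $f_i$ on $\mathbf F$ ($\partial\sigma_i+\sigma_i\partial=f_i$), then $e_i$ acts on $\operatorname{Tor}^S(M,k)=H(\mathbf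 F\otimes k)$ by the map induced by $\sigma_i\otimes 1$; this gives a well-defined graded $E$-module structure independent of choices. Relations and Gröbner bases. A relation on a module with respect to a generating space $V$ is an element of the kernel of the map from $E\otimes_kV$ to the module. Fix bases of the spaces $\overline{B_s(p)}$; a monomial of $E\otimes_kV$ is $m v$ with $m$ a monomial of $E$ and $v$ a basis element; a term order refines the lexicographic order if $mv\succ m'v'$ whenever $m\succ m'$ lexicographically. A linear resolution of a module generated in degree $s$ is a free resolution whose $i$-th term is generated in degree $i+s$. *)

(* Defs.v *)
From HB Require Import structures.
From mathcomp Require Import all_boot all_order all_algebra.
Set Implicit Arguments.
Unset Strict Implicit.
Unset Printing Implicit Defensive.
Import GRing.Theory.
Local Open Scope ring_scope.

Section Submodules.
Variables (R : nzRingType) (V : lmodType R).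
Implicit Types N C P : V -> Prop.

(* Finite sums of products a *: y with J a and N y. *)
Definition setmul (J : R -> Prop) N (x : V) : Prop :=
  exists n (a : 'I_n -> R) (y : 'I_n -> V),
    (forall i, J (a i) /\ N (y i)) /\ x = \sum_i a i *: y i.

Definition submod_gen N : V -> Prop := setmul (fun _ => True) N.

Definition is_submod N : Prop :=
  N 0 /\ forall a x y, N x -> N y -> N (a *: x + y).

Definition is_basis N n (b : 'I_n -> V) : Prop :=
  (forall x, N x <-> exists a : 'I_n -> R, x = \sum_i a i *: b i) /\
  (forall a : 'I_n -> R, \sum_i a i *: b i = 0 -> forall i, a i = 0).

Definition fg_free N : Prop := exists n (b : 'I_n -> V), is_basis N b.

Definition direct_sum N C P : Prop :=
  (forall x, P x <-> exists y z, [/\ N y, C z & x = y + z]) /\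
  (forall x, N x -> C x -> x = 0).

End Submodules.

Section LocalRings.
Variable S : comUnitRingType.

Definition is_ideal (J : S -> Prop) : Prop := @is_submod S S^o J.

Definition ideal_gen (J : S -> Prop) : S -> Prop := @submod_gen S S^o J.

Definition is_prime_ideal (P : S -> Prop) : Prop :=
  [/\ is_ideal P, ~ P 1 & forall x y, P (x * y) -> P x \/ P y].

Definition noetherian : Prop :=
  forall J, is_ideal J -> exists n (g : 'I_n -> S),
    forall x, J x <-> ideal_gen (fun s => exists i, s = g i) x.

Definition prime_chain (n : nat) : Prop :=
  exists P : nat -> S -> Prop,
    (forall i, (i <= n)%N -> is_prime_ideal (P i)) /\
    (forall i, (i < n)%N -> (forall x, P i x -> P i.+1 x) /\
                            exists x, P i.+1 x /\ ~ P i x).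

Definition krull_dim (n : nat) : Prop :=
  prime_chain n /\ forall m, prime_chain m -> (m <= n)%N.

Definition max_ideal (x : S) : Prop := x \isn't a GRing.unit.

Definition regular_local : Prop :=
  [/\ is_ideal max_ideal, noetherian
    & exists n, krull_dim n /\ exists g : 'I_n -> S,
        forall x, max_ideal x <-> ideal_gen (fun s => exists i, s = g i) x].

(* rho presents k as the residue field of the local ring S. *)
Definition is_residue_field (k : fieldType) (rho : {rmorphism S -> k}) : Prop :=
  (forall y, exists x, rho x = y) /\ (forall x, rho x = 0 <-> max_ideal x).

Definition first_elts c (f : 'I_c -> S) (p : nat) (s : S) : Prop :=
  exists j : 'I_c, (j < p)%N /\ s = f j.

Definition regular_seq c (f : 'I_c -> S) : Prop :=
  (forall (i : 'I_c) x,
     ideal_gen (first_elts f i) (f i * x) -> ideal_gen (first_elts f i) x) /\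
  ~ ideal_gen (first_elts f c) 1.

End LocalRings.

Section HigherMatrixFactorizations.
Variables (S : comUnitRingType) (c : nat).

(* A finitely generated free module A = A(c) with a filtration by free direct
   summands A(p) = fil p, 0 <= p <= c. *)
Record filtered_free := FilteredFree {
  ff_mod :> lmodType S;
  fil : nat -> ff_mod -> Prop;
  fil_0 : forall x, fil 0%N x <-> x = 0;
  fil_top : forall x, fil c x;
  fil_free : forall p, (p <= c)%N -> fg_free (fil p);
  fil_summand : forall p, (p < c)%N ->
    exists C, is_submod C /\ direct_sum (fil p) C (fil p.+1) }.

(* The index p : 'I_c stands for the p+1 of the usual numbering 1, ..., c:
   hmf_h p is the component h_(p+1), with domain A_0(p+1); its values outside
   A_0(p+1) are irrelevant. *)
Record hmf (f : 'I_c -> S) := Hmf {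
  hmf_A0 : filtered_free;
  hmf_A1 : filtered_free;
  hmf_d : {linear hmf_A1 -> hmf_A0};
  hmf_h : 'I_c -> hmf_A0 -> hmf_A1;
  hmf_h_linear : forall (p : 'I_c) a x y, fil p.+1 x -> fil p.+1 y ->
    hmf_h p (a *: x + y) = a *: hmf_h p x + hmf_h p y;
  hmf_d_fil : forall p x, (p <= c)%N -> fil p x -> fil p (hmf_d x);
  hmf_h_fil : forall (p : 'I_c) x, fil p.+1 x -> fil p.+1 (hmf_h p x);
  hmf_dh : forall (p : 'I_c) x, fil p.+1 x ->
    setmul (first_elts f p) (fil p.+1) (hmf_d (hmf_h p x) - f p *: x);
  (* modulo (f_1, ..., f_p) B_1(p+1), where B_1(p+1) = A_1(p+1) / A_1(p) *)
  hmf_hd : forall (p : 'I_c) x, fil p.+1 x ->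
    exists y z, [/\ fil p y, setmul (first_elts f p) (fil p.+1) z
                  & hmf_h p (hmf_d x) - f p *: x = y + z] }.

Arguments hmf_h [f] X p x : rename.

Definition hmf_minimal f (X : hmf f) : Prop :=
  (forall x : hmf_A1 X, setmul (@max_ideal S) (fun _ => True) (hmf_d X x)) /\
  (forall (p : 'I_c) (x : hmf_A0 X), fil p.+1 x ->
     setmul (@max_ideal S) (fun _ => True) (hmf_h X p x)).

(* mu : A_0 -> M presents M as the cokernel of R (x) d, where R = S / (f). *)
Definition is_hmf_module f (X : hmf f) (M : lmodType S)
    (mu : {linear hmf_A0 X -> M}) : Prop :=
  (forall m, exists x, mu x = m) /\
  (forall x, mu x = 0 <->
     exists y z, setmul (first_elts f c) (fun _ => True) z /\ x = hmf_d X y + z).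

(* Splittings A(p+1) = A(p) (+) B(p+1), with sb_B p in the role of B(p+1), and
   bases of the spaces k (x) B(p+1) = B(p+1) / m B(p+1).  All the bases are
   put in one list: sb_vec j is a lift to B(sb_w j + 1) of the j-th element. *)
Record split_basis (A : filtered_free) := SplitBasis {
  sb_B : 'I_c -> A -> Prop;
  sb_submod : forall p, is_submod (sb_B p);
  sb_split : forall p : 'I_c, direct_sum (fil p) (sb_B p) (fil p.+1);
  sb_n : nat;
  sb_w : 'I_sb_n -> 'I_c;
  sb_vec : 'I_sb_n -> A;
  sb_in : forall j, sb_B (sb_w j) (sb_vec j);
  sb_gen : forall p x, sb_B p x -> exists a : 'I_sb_n -> S,
    setmul (@max_ideal S) (sb_B p) (x - \sum_(j | sb_w j == p) a j *: sb_vec j);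
  sb_indep : forall p (a : 'I_sb_n -> S),
    setmul (@max_ideal S) (sb_B p) (\sum_(j | sb_w j == p) a j *: sb_vec j) ->
    forall j, sb_w j = p -> max_ideal (a j) }.

Record free_resolution (M : lmodType S) := FreeResolution {
  fr_mod :> nat -> lmodType S;
  fr_d : forall n, {linear fr_mod n.+1 -> fr_mod n};
  fr_aug : {linear fr_mod 0%N -> M};
  fr_free : forall n, fg_free (fun _ : fr_mod n => True);
  fr_surj : forall m, exists x, fr_aug x = m;
  fr_exact0 : forall x, fr_aug x = 0 <-> exists y, x = fr_d 0%N y;
  fr_exactS : forall n (x : fr_mod n.+1),
    fr_d n x = 0 <-> exists y, x = fr_d n.+1 y }.

End HigherMatrixFactorizations.

Arguments hmf_h [S c f] X p x : rename.
Arguments sb_w [S c A] s j : rename.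
Arguments sb_vec [S c A] s j : rename.

Section ExteriorAlgebra.
Variables (k : fieldType) (c : nat).
Implicit Types A B C U : {set 'I_c}.

(* The exterior algebra k<e_1, ..., e_c>; x : extalg is stored by its
   coordinates x A on the monomials e_A = e_i1 ... e_il, where
   A = {i1 < ... < il}.  The index i : 'I_c stands for e_(i+1). *)
Definition extalg : Type := {ffun {set 'I_c} -> k}.
HB.instance Definition _ := GRing.Zmodule.on extalg.
Implicit Types x y z : extalg.

Definition ext_scale (a : k) x : extalg := [ffun A => a * x A].

Fact ext_scaleA a b x : ext_scale a (ext_scale b x) = ext_scale (a * b) x.
Proof. by apply/ffunP => A; rewrite !ffunE mulrA. Qed.

Fact ext_scale1 : left_id 1 ext_scale.
Proof. by move=> x; apply/ffunP => A; rewrite ffunE mul1r. Qed.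

Fact ext_scaleDr : right_distributive ext_scale +%R.
Proof. by move=> a x y; apply/ffunP => A; rewrite !ffunE mulrDr. Qed.

Fact ext_scaleDl x : {morph ext_scale^~ x : a b / a + b}.
Proof. by move=> a b; apply/ffunP => A; rewrite !ffunE mulrDl. Qed.

HB.instance Definition _ := GRing.Zmodule_isLmodule.Build k extalg
  ext_scaleA ext_scale1 ext_scaleDr ext_scaleDl.

Definition ext_inv A B : nat := (\sum_(i in A) \sum_(j in B) (j < i))%N.

(* The sign in e_A e_B = +- e_(A :|: B); it is 0 when A and B meet. *)
Definition ext_sign A B : k :=
  if [disjoint A & B] then (-1) ^+ ext_inv A B else 0.

Definition ext_mul x y : extalg :=
  [ffun U => \sum_A \sum_(B | A :|: B == U) ext_sign A B * (x A * y B)].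

Definition emon A : extalg := [ffun B => (B == A)%:R].

Lemma ext_mulE x y U : ext_mul x y U =
  \sum_A \sum_B ext_sign A B * (x A * y B) * (A :|: B == U)%:R.
Proof.
rewrite ffunE; apply: eq_bigr => A _; rewrite big_mkcond; apply: eq_bigr => B _.
by case: eqP; rewrite ?mulr1 ?mulr0.
Qed.

Lemma ext_sign_cocycle A B C :
  ext_sign A B * ext_sign (A :|: B) C = ext_sign A (B :|: C) * ext_sign B C.
Proof.
have dUl : [disjoint A :|: B & C] = [disjoint A & C] && [disjoint B & C].
  by rewrite -!setI_eq0 setIUl setU_eq0.
have dUr : [disjoint A & B :|: C] = [disjoint A & B] && [disjoint A & C].
  by rewrite -!setI_eq0 setIUr setU_eq0.
rewrite /ext_sign dUl dUr.
case dAB: [disjoint A & B]; case dAC: [disjoint A & C];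
  case dBC: [disjoint B & C]; rewrite ?(mul0r, mulr0) //=.
rewrite -!exprD; congr (_ ^+ _).
have -> : ext_inv (A :|: B) C = (ext_inv A C + ext_inv B C)%N.
  by rewrite /ext_inv -bigU //=; apply: eq_bigl => i; rewrite !inE.
have -> : ext_inv A (B :|: C) = (ext_inv A B + ext_inv A C)%N.
  rewrite /ext_inv -big_split /=; apply: eq_bigr => i _.
  by rewrite -bigU //=; apply: eq_bigl => j; rewrite !inE.
by rewrite addnA.
Qed.

Lemma ext_mulA : associative ext_mul.
Proof.
move=> x y z; apply/ffunP => U.
transitivity (\sum_A \sum_B \sum_C
  ext_sign A (B :|: C) * ext_sign B C * (x A * y B * z C)
  * (A :|: B :|: C == U)%:R).
  rewrite ext_mulE; apply: eq_bigr => A _.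
  under eq_bigr => D _.
    rewrite ext_mulE mulr_sumr mulr_sumr mulr_suml.
    under eq_bigr => B _ do rewrite mulr_sumr mulr_sumr mulr_suml.
    over.
  rewrite exchange_big; apply: eq_bigr => B _.
  rewrite exchange_big; apply: eq_bigr => C _ /=.
  rewrite (bigD1 (B :|: C)) //= eqxx big1 => [|D /negPf neD].
    by rewrite addr0 setUA mulr1 !mulrA [_ * x A * _]mulrAC.
  by rewrite eq_sym neD !mulr0 mul0r.
rewrite ext_mulE [RHS](eq_bigr (fun D => \sum_A \sum_B \sum_C
  ext_sign D C * (ext_sign A B * (x A * y B) * (A :|: B == D)%:R * z C)
  * (D :|: C == U)%:R)).
  rewrite [RHS]exchange_big; apply: eq_bigr => A _ /=.
  rewrite [RHS]exchange_big; apply: eq_bigr => B _ /=.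
  rewrite [RHS]exchange_big; apply: eq_bigr => C _ /=.
  rewrite [RHS](bigD1 (A :|: B)) //= eqxx big1 => [|D /negPf neD].
    by rewrite addr0 mulr1 -ext_sign_cocycle !mulrA [ext_sign A B * _]mulrC.
  by rewrite eq_sym neD mulr0 mul0r mulr0 mul0r.
move=> D _; under eq_bigr => C _.
  rewrite ext_mulE mulr_suml mulr_sumr mulr_suml.
  under eq_bigr => A _ do rewrite mulr_suml mulr_sumr mulr_suml.
  over.
by rewrite exchange_big; apply: eq_bigr => A _; rewrite exchange_big.
Qed.

Lemma ext_mul1l : left_id (emon set0) ext_mul.
Proof.
move=> x; apply/ffunP => U; rewrite ext_mulE (bigD1 set0) //=.
rewrite [X in _ + X]big1 => [|A /negPf neA]; last first.
  by apply: big1 => B _; rewrite ffunE neA mul0r mulr0 mul0r.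
rewrite addr0 (bigD1 U) //= big1 => [|B /negPf neB]; last first.
  by rewrite set0U neB mulr0.
rewrite set0U eqxx ffunE eqxx /ext_sign -setI_eq0 set0I eqxx /ext_inv big_set0.
by rewrite !mul1r mulr1 addr0.
Qed.

Lemma ext_mul1r : right_id (emon set0) ext_mul.
Proof.
move=> x; apply/ffunP => U; rewrite ext_mulE (bigD1 U) //=.
rewrite [X in _ + X]big1 => [|A /negPf neA]; last first.
  apply: big1 => B _; rewrite ffunE; case: (B =P set0) => [->|_].
    by rewrite setU0 neA mulr0.
  by rewrite !mulr0 mul0r.
rewrite addr0 (bigD1 set0) //= big1 => [|B /negPf neB]; last first.
  by rewrite ffunE neB !mulr0 mul0r.
rewrite setU0 eqxx ffunE eqxx /ext_sign -setI_eq0 setI0 eqxx /ext_inv.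
under eq_bigr do rewrite big_set0.
by rewrite big1 // !mulr1 mul1r addr0.
Qed.

Lemma ext_mulDl : left_distributive ext_mul +%R.
Proof.
move=> x y z; apply/ffunP => U; rewrite [RHS]ffunE !ext_mulE -big_split.
apply: eq_bigr => A _; rewrite -big_split; apply: eq_bigr => B _ /=.
by rewrite ffunE mulrDl mulrDr mulrDl.
Qed.

Lemma ext_mulDr : right_distributive ext_mul +%R.
Proof.
move=> x y z; apply/ffunP => U; rewrite [RHS]ffunE !ext_mulE -big_split.
apply: eq_bigr => A _; rewrite -big_split; apply: eq_bigr => B _ /=.
by rewrite ffunE mulrDr mulrDr mulrDl.
Qed.

Lemma ext_oner_neq0 : emon set0 != 0.
Proof. by apply/eqP => /ffunP/(_ set0)/eqP; rewrite !ffunE eqxx oner_eq0. Qed.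

HB.instance Definition _ := GRing.Zmodule_isNzRing.Build extalg
  ext_mulA ext_mul1l ext_mul1r ext_mulDl ext_mulDr ext_oner_neq0.

Lemma ext_scalerAl (a : k) x y : a *: (x * y) = (a *: x) * y.
Proof.
apply/ffunP => U; rewrite ffunE !ext_mulE mulr_sumr; apply: eq_bigr => A _.
rewrite mulr_sumr; apply: eq_bigr => B _; rewrite ffunE.
by rewrite !mulrA [a * _]mulrC.
Qed.

Lemma ext_scalerAr (a : k) x y : a *: (x * y) = x * (a *: y).
Proof.
apply/ffunP => U; rewrite ffunE !ext_mulE mulr_sumr; apply: eq_bigr => A _.
rewrite mulr_sumr; apply: eq_bigr => B _; rewrite ffunE.
by rewrite mulrA mulrCA [a * (_ * _)]mulrCA.
Qed.

HB.instance Definition _ := GRing.Lmodule_isLalgebra.Build k extalg ext_scalerAl.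
HB.instance Definition _ := GRing.Lalgebra_isAlgebra.Build k extalg ext_scalerAr.

Definition egen (i : 'I_c) : extalg := emon [set i].

Lemma emonM A B : emon A * emon B = ext_sign A B *: emon (A :|: B).
Proof.
apply/ffunP => U; rewrite [LHS]ext_mulE !ffunE (bigD1 A) //= [X in _ + X]big1.
  rewrite addr0 (bigD1 B) //= big1.
    by rewrite !ffunE !eqxx !mulr1 addr0 eq_sym.
  by move=> D /negPf nD; rewrite !ffunE nD !mulr0 mul0r.
move=> D /negPf nD; apply: big1 => ? _.
by rewrite !ffunE nD mul0r mulr0 mul0r.
Qed.

Lemma egen_sqr i : egen i * egen i = 0.
Proof.
by rewrite emonM /ext_sign -setI_eq0 setIid -cards_eq0 cards1 scale0r.
Qed.

Lemma egen_anticomm i j : egen i * egen j = - (egen j * egen i).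
Proof.
case: (i =P j) => [->|/eqP neq_ij]; first by rewrite egen_sqr oppr0.
have neq_ji : j != i by rewrite eq_sym.
rewrite !emonM /ext_sign !disjoints1 !inE neq_ij neq_ji setUC -scaleNr.
congr (_ *: _); rewrite /ext_inv !big_set1.
by case: ltngtP neq_ij => [_ _|_ _|/val_inj->]; rewrite ?expr1 ?expr0 ?opprK ?eqxx.
Qed.

Lemma emon_prod A : emon A = \prod_(i in A) egen i.
Proof.
have srt : sorted (fun i j : 'I_c => i < j)%N (enum A).
  rewrite /enum_mem -enumT sorted_filter //; first by move=> ? ? ?; apply: ltn_trans.
  by have := iota_ltn_sorted 0 c; rewrite -val_enum_ord sorted_map.
have -> : \prod_(i in A) egen i = \prod_(i <- enum A) egen i.
  by rewrite -big_filter /index_enum; case: index_enum_key.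
rewrite -[A in LHS]set_enum; elim: (enum A) srt => [|i s IHs] srt.
  by rewrite big_nil; congr emon; apply/setP => i; rewrite !inE.
have /andP[/allP lt_is srt_s] : all (fun j : 'I_c => i < j)%N s && sorted (fun i j : 'I_c => i < j)%N s.
  by rewrite -path_sortedE // => ? ? ?; apply: ltn_trans.
rewrite big_cons -IHs // emonM /ext_sign disjoints1 inE.
case: ifPn => [_|/negPn/lt_is]; last by rewrite ltnn.
rewrite /ext_inv big_set1 big1 => [|j]; last first.
  by rewrite inE => /lt_is; case: ltngtP.
by rewrite expr0 scale1r; congr emon; apply/setP => j; rewrite !inE.
Qed.

Definition ecoef x A : k := x A.

(* E(p) = k<e_1, ..., e_p>. *)
Definition extsub (p : nat) x : Prop :=
  forall A, ecoef x A != 0 -> forall i, i \in A -> (i < p)%N.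

End ExteriorAlgebra.

Section Tor.
Variables (S : comUnitRingType) (k : fieldType) (rho : {rmorphism S -> k}).
Variables (c : nat) (f : 'I_c -> S) (M : lmodType S) (F : free_resolution M).

Definition are_homotopies (sigma : 'I_c -> forall n, {linear F n -> F n.+1}) :
    Prop :=
  forall i, (forall x : F 0%N, fr_d F 0%N (sigma i 0%N x) = f i *: x) /\
            (forall n (x : F n.+1),
               fr_d F n.+1 (sigma i n.+1 x) + sigma i n (fr_d F n x) = f i *: x).

(* F (x) k = F / m F: its cycles and boundaries are described by lifts to F. *)
Definition cycle n : F n -> Prop :=
  match n return F n -> Prop with
  | 0%N => fun _ => True
  | n'.+1 => fun z => setmul (@max_ideal S) (fun _ => True) (fr_d F n' z)
  end.

Definition boundary n (z : F n) : Prop :=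
  exists y, setmul (@max_ideal S) (fun _ => True) (z - fr_d F n y).

(* T is the E-module Tor^S(M,k) = H(F (x) k): the map cl n sends a cycle of
   degree n to its homology class, T is the direct sum over n of the images
   of the maps cl n, and e_i acts by the homotopy sigma i. *)
Record is_Tor (sigma : 'I_c -> forall n, {linear F n -> F n.+1})
    (T : lmodType (extalg k c)) (cl : forall n, F n -> T) : Prop := IsTor {
  tor_linear : forall n a (x y : F n), cycle x -> cycle y ->
    cl n (a *: x + y) = (rho a)%:A *: cl n x + cl n y;
  tor_ker : forall n (x : F n), cycle x -> (cl n x = 0 <-> boundary x);
  tor_sum : forall t, exists N (z : forall n, F n),
    (forall n, cycle (z n)) /\ t = \sum_(n < N) cl n (z n);
  tor_direct : forall N (z : forall n, F n), (forall n, cycle (z n)) ->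
    \sum_(n < N) cl n (z n) = 0 -> forall n, (n < N)%N -> cl n (z n) = 0;
  tor_act : forall i n (x : F n), cycle x ->
    egen k i *: cl n x = cl n.+1 (sigma i n x) }.

Definition tor_deg (T : lmodType (extalg k c)) (cl : forall n, F n -> T) n t :
    Prop :=
  exists2 z, cycle z & t = cl n z.

End Tor.

Section ExteriorModules.
Variables (k : fieldType) (c : nat).
Local Notation E := (extalg k c).

(* The map E (x) V -> N, V having a basis indexed by 'I_n whose elements are
   sent to the a j; the row u stands for the sum over j of u 0 j (x) v_j. *)
Definition eval (N : lmodType E) n (a : 'I_n -> N) (u : 'rV[E]_n) : N :=
  \sum_j u 0 j *: a j.

(* The elements of (+)_p E(p-1) (x) V_p, where V_p has the basis elements v_j
   with w j = p-1, i.e., those of the p-th block. *)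
Definition layered n (w : 'I_n -> 'I_c) (u : 'rV[E]_n) : Prop :=
  forall j, extsub (w j) (u 0 j).

(* The multiplication map is a bijection (+)_p E(p-1) (x) V_p -> P, under which
   E(p-1) acts on the p-th summand by multiplication on the left factor. *)
Definition layered_decomposition (N : lmodType E) (P : N -> Prop)
    n (w : 'I_n -> 'I_c) (a : 'I_n -> N) : Prop :=
  [/\ forall u, layered w u -> P (eval a u),
      forall x, P x -> exists u, layered w u /\ x = eval a u,
      forall u v, layered w u -> layered w v -> eval a u = eval a v -> u = v
    & forall (p : 'I_c) x u, extsub p x -> layered w u ->
        (forall j, w j != p -> u 0 j = 0) ->
        layered w (x *: u) /\ x *: eval a u = eval a (x *: u)].

(* u is homogeneous of degree d when the j-th basis element has degree dg j. *)
Definition homogeneous n (dg : 'I_n -> nat) (d : nat) (u : 'rV[E]_n) : Prop :=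
  forall j A, ecoef (u 0 j) A != 0 -> d = (#|A| + dg j)%N.

(* A complex of graded free left E-modules: the i-th term is E^(gc_rk i) with
   basis elements of degrees gc_dg i; maps act on rows by right
   multiplication. *)
Record gcomplex := GComplex {
  gc_rk : nat -> nat;
  gc_dg : forall i, 'I_(gc_rk i) -> nat;
  gc_d : forall i, 'M[E]_(gc_rk i.+1, gc_rk i) }.

(* G, with augmentation sending the basis of the 0-th term to g, is a graded
   free resolution of the graded submodule P of N; deg n is the set of
   elements of N of degree n. *)
Definition graded_resolution (N : lmodType E) (deg : nat -> N -> Prop)
    (P : N -> Prop) (G : gcomplex) (g : 'I_(gc_rk G 0%N) -> N) : Prop :=
  [/\ forall i r, homogeneous (@gc_dg G i) (gc_dg r) (row r (gc_d G i)),
      forall j, deg (gc_dg j) (g j),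
      forall x, P x <-> exists u, x = eval g u,
      forall u, eval g u = 0 <-> exists v, u = v *m gc_d G 0%N
    & forall i (u : 'rV_(gc_rk G i.+1)),
        u *m gc_d G i = 0 <-> exists v, u = v *m gc_d G i.+1].

(* The entries have no constant term, i.e., lie in (e_1, ..., e_c). *)
Definition minimal_complex (G : gcomplex) : Prop :=
  forall i r s, ecoef (gc_d G i r s) set0 = 0.

Definition linear_complex (s : nat) (G : gcomplex) : Prop :=
  forall i (j : 'I_(gc_rk G i)), gc_dg j = (i + s)%N.

(* tau is a map of complexes G''[-1] -> G', where the i-th term of G''[-1] is
   the (i+1)-st term of G'' and the differential of G''[-1] is minus that
   of G''. *)
Definition shifted_map (G' G'' : gcomplex)
    (tau : forall i, 'M[E]_(gc_rk G'' i.+1, gc_rk G' i)) : Prop :=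
  forall i, tau i.+1 *m gc_d G' i = - gc_d G'' i.+1 *m tau i.

Definition split_case (T : Type) m n (g : 'I_m -> T) (h : 'I_n -> T)
    (j : 'I_(m + n)) : T :=
  match split j with inl i => g i | inr i => h i end.

Definition mapping_cone (G' G'' : gcomplex)
    (tau : forall i, 'M[E]_(gc_rk G'' i.+1, gc_rk G' i)) : gcomplex :=
  {| gc_rk := fun i => (gc_rk G' i + gc_rk G'' i)%N;
     gc_dg := fun i => split_case (@gc_dg G' i) (@gc_dg G'' i);
     gc_d := fun i => block_mx (gc_d G' i) 0 (tau i) (gc_d G'' i) |}.

(* The monomial e_A v_j of E (x) V is represented by the pair (A, j). *)
Definition mono n (m : {set 'I_c} * 'I_n) : 'rV[E]_n :=
  emon k m.1 *: delta_mx 0 m.2.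

(* The strict lexicographic order e_A < e_B with e_c > ... > e_1. *)
Definition lex_lt (A B : {set 'I_c}) : Prop :=
  exists i, [/\ i \notin A, i \in B
              & forall j : 'I_c, (i < j)%N -> (j \in A) = (j \in B)].

(* lt is the strict order relation. *)
Definition term_order n (lt : {set 'I_c} * 'I_n -> {set 'I_c} * 'I_n -> Prop) :
    Prop :=
  [/\ forall m, ~ lt m m,
      forall m1 m2 m3, lt m1 m2 -> lt m2 m3 -> lt m1 m3,
      forall m1 m2, m1 <> m2 -> lt m1 m2 \/ lt m2 m1,
      forall (C A B : {set 'I_c}) i j, [disjoint C & A] -> [disjoint C & B] ->
        lt (A, i) (B, j) -> lt (C :|: A, i) (C :|: B, j)
    & forall (C A : {set 'I_c}) i, C != set0 -> [disjoint C & A] -> lt (A, i) (C :|: A, i)].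

Definition refines_lex n
    (lt : {set 'I_c} * 'I_n -> {set 'I_c} * 'I_n -> Prop) : Prop :=
  forall A B i j, lex_lt A B -> lt (A, i) (B, j).

Definition is_lead n (lt : {set 'I_c} * 'I_n -> {set 'I_c} * 'I_n -> Prop)
    (u : 'rV[E]_n) (m : {set 'I_c} * 'I_n) : Prop :=
  ecoef (u 0 m.2) m.1 != 0 /\
  forall m', ecoef (u 0 m'.2) m'.1 != 0 -> m' = m \/ lt m' m.

(* The submodule generated by the initial monomials of the elements of N. *)
Definition initial_submod n
    (lt : {set 'I_c} * 'I_n -> {set 'I_c} * 'I_n -> Prop)
    (N : 'rV[E]_n -> Prop) : 'rV[E]_n -> Prop :=
  submod_gen (fun y => exists u m, [/\ N u, is_lead lt u m & y = mono m]).

Definition groebner_basis n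
    (lt : {set 'I_c} * 'I_n -> {set 'I_c} * 'I_n -> Prop)
    (N G : 'rV[E]_n -> Prop) : Prop :=
  (forall u, G u -> N u) /\
  (forall y, initial_submod lt N y <-> initial_submod lt G y).

(* rel is a homogeneous relation e_r v_j - b with b in (e_1, ..., e_(r-1)) V
   (r being numbered from 0 here). *)
Definition leading_relation (N : lmodType E) n (dg : 'I_n -> nat)
    (a : 'I_n -> N) (r : 'I_c) (j : 'I_n) (rel : 'rV[E]_n) : Prop :=
  [/\ eval a rel = 0,
      exists d, homogeneous dg d rel
    & exists2 b, submod_gen (fun y => exists (i : 'I_c) l,
                         (i < r)%N /\ y = egen k i *: delta_mx 0 l) b
        & rel = egen k r *: delta_mx 0 j - b].

End ExteriorModules.

(* Main.v *)
Require Import Defs.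
From HB Require Import structures.
From mathcomp Require Import all_boot all_order all_algebra.
From mathcomp Require Import zify.
From Stdlib Require Import ClassicalEpsilon FunctionalExtensionality.
Set Implicit Arguments.
Unset Strict Implicit.
Unset Printing Implicit Defensive.
Import GRing.Theory.
Local Open Scope ring_scope.

(** Let the basis vectors [b_j] of the [B_s(p)] carry the weight [p]. The
    layered resolution [L] has the basis [e_A b_j], where all elements of [A]
    lie below the weight of [b_j]. It is built one layer at a time together
    with homotopies [sigma_i] for the [f_i], and these can be chosen so that
    [sigma_i (e_A b_j) = e_(i,A) b_j] whenever [i] exceeds all elements of [A]
    and stays below the weight. As [L] is minimal, the [e_A a_j] with [A] below
    the weight of [a_j] form a [k]-basis of Tor: the generators are layered
    free. When [r] is at least the weight of [a_j], [sigma_r] preserves the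
    [r]-th stage of the filtration, so [e_r a_j] is a combination of products
    [e_i a_l] with [i < r]: the generators are triangular.

    For a layered free triangular system the relations [e_r a_j - ...]
    generate all relations, by dividing by the largest index first, and they
    are again a layered free triangular system, one degree higher. Iterating
    this yields linear resolutions. Comparison of leading monomials in the same
    division yields the Groebner bases. Finally every minimal resolution is
    linear, so the comparison map of the two linear resolutions has entries of
    degree two and its mapping cone is minimal. *)

(** * Triangular systems over the exterior algebra *)


(** The two axioms of a higher matrix factorization serve different purposes. Axiom (b), with
    regularity of the sequence, makes the attaching map injective on zeroth homology when the Koszul
    complex of [B_1(p)] is added, so exactness survives. Axiom (a) makes [f_p] kill the zeroth
    homology once [B_1(p)] is in place, so a homotopy for [f_p] exists. Each layer is therefore
    attached by two cones, for [B_0(p)] and for [B_1(p)]; the part [b_p] of the differential needs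
    no separate treatment, as the homotopies on the first cone turn it into [K (x) b_p]. A homotopy
    constructed degree by degree might send [A_0] to unit multiples of vectors of [A_1], which would
    spoil triangularity of the generators of [T']. Minimality of [h] rules this out: [h_p] solves
    the homotopy equation on [A_0(p)] up to multiples of smaller [f_i], and its values vanish in
    Tor. For [A_1] the products [e_r a] may keep quadratic terms over [A_0]. These disappear only in
    [T''], so the two families are jointly free, but the second is triangular only modulo the
    first. *)

Section Eval.
Variables (k : fieldType) (c : nat).
Local Notation E := (extalg k c).
Implicit Types (A B C : {set 'I_c}) (s : nat).

Lemma eval_linear (N : lmodType E) n (a : 'I_n -> N) : linear (eval a).
Proof.
move=> x u v; rewrite /eval scaler_sumr -big_split; apply: eq_bigr => j _ /=.
by rewrite !mxE scalerDl scalerA.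
Qed.

HB.instance Definition _ (N : lmodType E) n (a : 'I_n -> N) :=
  GRing.isLinear.Build E 'rV[E]_n N *:%R (eval a) (eval_linear a).

Lemma eval_delta (N : lmodType E) n (a : 'I_n -> N) j : eval a (delta_mx 0 j) = a j.
Proof.
rewrite /eval (bigD1 j) //= big1 => [|i /negPf nij]; last first.
  by rewrite mxE nij andbF scale0r.
by rewrite mxE !eqxx scale1r addr0.
Qed.

Lemma eval_mulmx (N : lmodType E) m n (a : 'I_n -> N) (D : 'M[E]_(m, n)) u :
  eval a (u *m D) = eval (fun i => eval a (row i D)) u.
Proof.
rewrite /eval; under [LHS]eq_bigr do rewrite mxE scaler_suml.
rewrite exchange_big; apply: eq_bigr => i _ /=; rewrite scaler_sumr.
by apply: eq_bigr => j _; rewrite mxE scalerA.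
Qed.

Lemma eval_rows m n (D : 'M[E]_(m, n)) u : eval (fun i => row i D) u = u *m D.
Proof.
apply/rowP => j; rewrite /eval summxE mxE.
by apply: eq_bigr => i _; rewrite !mxE.
Qed.

Lemma eval_map (N N' : lmodType E) (h : {linear N -> N'}) n (a : 'I_n -> N) u :
  h (eval a u) = eval (h \o a) u.
Proof.
by rewrite /eval linear_sum; apply: eq_bigr => j _; rewrite linearZ.
Qed.

(** For [s] the weight of a basis vector, which is [p - 1] for the layer [p], the strict inequality
    selects the monomials of E(p-1). *)
Definition blw s A := [forall i in A, (i < s)%N].

Lemma blwP s A : reflect (forall i, i \in A -> (i < s)%N) (blw s A).
Proof. exact: forall_inP. Qed.

Lemma blwW s s' A : (s <= s')%N -> blw s A -> blw s' A.
Proof. by move=> le_s /blwP h; apply/blwP => i /h lt_i; apply: leq_trans le_s. Qed.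

Lemma blwU s A B : blw s A -> blw s B -> blw s (A :|: B).
Proof. by move=> /blwP hA /blwP hB; apply/blwP => i /setUP[/hA|/hB]. Qed.

Lemma blw_top A : blw c A.
Proof. by apply/blwP => i _. Qed.

(** Bounds on degrees, indices and weights are all conditions on the support, so this one predicate
    carries them through sums, scalings and products. *)
Definition onrow n (Q : {set 'I_c} -> 'I_n -> bool) (u : 'rV[E]_n) :=
  forall A l, ecoef (u 0 l) A != 0 -> Q A l.

Lemma ecoefD (x y : E) A : ecoef (x + y) A = ecoef x A + ecoef y A.
Proof. by rewrite /ecoef ffunE. Qed.

Lemma ecoefZ (a : k) (x : E) A : ecoef (a *: x) A = a * ecoef x A.
Proof. by rewrite /ecoef ffunE. Qed.

Lemma ecoefN (x : E) A : ecoef (- x) A = - ecoef x A.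
Proof. by rewrite /ecoef ffunE. Qed.

Lemma ecoef0 A : ecoef (0 : E) A = 0.
Proof. by rewrite /ecoef ffunE. Qed.

Lemma ecoef_sum I (r : seq I) (P : pred I) (F : I -> E) A :
  ecoef (\sum_(i <- r | P i) F i) A = \sum_(i <- r | P i) ecoef (F i) A.
Proof. exact: (big_morph (fun x : E => ecoef x A) (fun x y => ecoefD x y A) (ecoef0 A)). Qed.

Lemma ecoef_emon A B : ecoef (emon k A) B = (B == A)%:R.
Proof. by rewrite /ecoef ffunE. Qed.

Lemma onrow0 n (Q : {set 'I_c} -> 'I_n -> bool) : onrow Q 0.
Proof. by move=> A l; rewrite mxE ecoef0 eqxx. Qed.

Lemma onrowD n (Q : {set 'I_c} -> 'I_n -> bool) u v :
  onrow Q u -> onrow Q v -> onrow Q (u + v).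
Proof.
move=> hu hv A l; rewrite mxE ecoefD => nz.
have [u0|/hu//] := eqVneq (ecoef (u 0 l) A) 0.
by apply: hv; move: nz; rewrite u0 add0r.
Qed.

Lemma onrowZ n (Q : {set 'I_c} -> 'I_n -> bool) (a : k) u :
  onrow Q u -> onrow Q (a%:A *: u).
Proof.
move=> hu A l; rewrite mxE mulr_algl ecoefZ => nz; apply: hu.
by apply: contraNneq nz => ->; rewrite mulr0.
Qed.

Lemma onrowN n (Q : {set 'I_c} -> 'I_n -> bool) u : onrow Q u -> onrow Q (- u).
Proof. by move=> hu; rewrite -scaleN1r -[-1](scaleN1r (1 : E)); apply: onrowZ. Qed.

Lemma onrow_sum n (Q : {set 'I_c} -> 'I_n -> bool) I (r : seq I) (P : pred I) F :
  (forall i, P i -> onrow Q (F i)) -> onrow Q (\sum_(i <- r | P i) F i).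
Proof.
move=> h; elim/big_ind: _ => //; [exact: onrow0 | by move=> *; apply: onrowD].
Qed.

Lemma onrowW n (Q Q' : {set 'I_c} -> 'I_n -> bool) u :
  (forall A l, Q A l -> Q' A l) -> onrow Q u -> onrow Q' u.
Proof. by move=> h hu A l /hu /h. Qed.

Lemma ecoef_mono n (m : {set 'I_c} * 'I_n) A l :
  ecoef (mono k m 0 l) A = ((A == m.1) && (l == m.2))%:R.
Proof.
rewrite /mono !mxE eqxx /= mulr_natr.
case: (l == m.2); rewrite ?andbT ?andbF ?mulr1n ?mulr0n ?ecoef_emon ?ecoef0 //.
Qed.

Lemma onrow_mono n (Q : {set 'I_c} -> 'I_n -> bool) A l :
  Q A l -> onrow Q (mono k (A, l)).
Proof.
move=> QA B j; rewrite ecoef_mono; case: andP => [[/eqP-> /eqP->]//|].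
by rewrite eqxx.
Qed.

Lemma extalg_sum (x : E) : x = \sum_A (ecoef x A)%:A * emon k A.
Proof.
apply/ffunP => B; rewrite -[LHS]/(ecoef x B) -[RHS]/(ecoef _ B) ecoef_sum.
rewrite (bigD1 B) //= big1 => [|A /negPf nAB].
  by rewrite mulr_algl ecoefZ ecoef_emon eqxx mulr1 addr0.
by rewrite mulr_algl ecoefZ ecoef_emon eq_sym nAB mulr0.
Qed.

Lemma row_mono_sum n (u : 'rV[E]_n) :
  u = \sum_l \sum_A (ecoef (u 0 l) A)%:A *: mono k (A, l).
Proof.
rewrite {1}[u]row_sum_delta; apply: eq_bigr => l _.
rewrite {1}[u 0 l]extalg_sum scaler_suml; apply: eq_bigr => A _.
by rewrite /mono scalerA.
Qed.

Lemma onrow_ind n (Q : {set 'I_c} -> 'I_n -> bool) (P : 'rV[E]_n -> Prop) u :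
  P 0 -> (forall u v, P u -> P v -> P (u + v)) ->
  (forall (a : k) u, P u -> P (a%:A *: u)) ->
  (forall A l, Q A l -> P (mono k (A, l))) -> onrow Q u -> P u.
Proof.
move=> P0 PD PZ PQ hu; rewrite [u]row_mono_sum.
elim/big_ind: _ => // l _; elim/big_ind: _ => // A _.
have [->|/hu QA] := eqVneq (ecoef (u 0 l) A) 0; first by rewrite !scale0r.
by apply/PZ/PQ.
Qed.

Lemma ext_sign_neq0 A B : [disjoint A & B] -> ext_sign k A B != 0.
Proof. by rewrite /ext_sign => ->; rewrite signr_eq0. Qed.

Lemma emon0 : emon k (set0 : {set 'I_c}) = 1.
Proof. by []. Qed.

Lemma emon_mul A B : [disjoint A & B] ->
  emon k (A :|: B) = (ext_sign k A B)^-1%:A * (emon k A * emon k B).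
Proof.
move=> dAB; rewrite emonM mulr_algl scalerA mulVf ?scale1r //.
exact: ext_sign_neq0.
Qed.

Lemma mono_mul n A B (l : 'I_n) :
  emon k A *: mono k (B, l) = (ext_sign k A B)%:A *: mono k (A :|: B, l).
Proof. by rewrite /mono !scalerA emonM mulr_algl. Qed.

Lemma ext_sign_disj A B : ext_sign k A B != 0 -> [disjoint A & B].
Proof. by rewrite /ext_sign; case: ifP => // _; rewrite eqxx. Qed.

Lemma extalg_comm (a : k) (x : E) : x * a%:A = a%:A * x.
Proof. by rewrite mulr_algl mulr_algr. Qed.

Lemma onrow_mul n (Q Q' : {set 'I_c} -> 'I_n -> bool) A u :
  (forall B l, Q B l -> [disjoint A & B] -> Q' (A :|: B) l) ->
  onrow Q u -> onrow Q' (emon k A *: u).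
Proof.
move=> h; apply: (@onrow_ind n Q (fun u => onrow Q' (emon k A *: u))) => [|u1 u2 h1 h2|a u1 h1|B l QB].
- by rewrite scaler0; apply: onrow0.
- by rewrite scalerDr; apply: onrowD.
- by rewrite scalerA extalg_comm -scalerA; apply: onrowZ.
rewrite mono_mul; have [->|/ext_sign_disj dAB] := eqVneq (ext_sign k A B) 0.
  by rewrite !scale0r; apply: onrow0.
by apply/onrowZ/onrow_mono/h.
Qed.

Lemma layeredP n (w : 'I_n -> 'I_c) u : layered w u <-> onrow (fun A l => blw (w l) A) u.
Proof.
split=> [h A l nz|h l A nz]; first by apply/blwP/(h l A nz).
exact/blwP/h.
Qed.

End Eval.

(** * Division and syzygies for a triangular system *)

Section Syzygies.
Variables (k : fieldType) (c : nat).
Local Notation E := (extalg k c).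
Implicit Types (A B C : {set 'I_c}) (s : nat).

(* The relations have to respect the filtration by [w l <= r]: without this
   the syzygies would not satisfy the analogous condition again. *)
Definition triangular (N : lmodType E) n (w : 'I_n -> 'I_c) (a : 'I_n -> N) :=
  forall (r : 'I_c) j, (w j <= r)%N -> exists u,
    onrow (fun A l => [&& #|A| == 1%N, blw r A & (w l <= r)%N]) u /\
    egen k r *: a j = eval a u.

Definition layered_free (N : lmodType E) n (w : 'I_n -> 'I_c) (a : 'I_n -> N) :=
  forall u, layered w u -> eval a u = 0 -> u = 0.

Lemma max_element A s : ~~ blw s A ->
  exists r : 'I_c, [/\ r \in A, blw r (A :\ r) & (s <= r)%N].
Proof.
rewrite negb_forall => /existsP[i0]; rewrite negb_imply -leqNgt => /andP[Ai0 le_s].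
case: (@arg_maxnP _ i0 [in A] (fun i => val i) Ai0) => r Ar max_r.
exists r; split=> //; last by apply: leq_trans (max_r _ Ai0).
apply/blwP => i /setD1P[nir Ai]; have := max_r _ Ai; rewrite /= ltn_neqAle => ->; rewrite andbT.
by apply: contra_neq nir => /val_inj.
Qed.

Variables (n : nat) (w : 'I_n -> 'I_c).
Variable U : 'I_c -> 'I_n -> 'rV[E]_n.
Hypothesis onU : forall (r : 'I_c) j, (w j <= r)%N ->
  onrow (fun A l => [&& #|A| == 1%N, blw r A & (w l <= r)%N]) (U r j).

Variables (n' : nat) (R : 'I_n' -> 'I_c) (J : 'I_n' -> 'I_n).
Hypothesis RJ_ge : forall q, (w (J q) <= R q)%N.
Hypothesis RJ_surj : forall (r : 'I_c) j, (w j <= r)%N -> exists q, R q = r /\ J q = j.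
Hypothesis RJ_inj : forall q q', R q = R q' -> J q = J q' -> q = q'.

Definition syz (q : 'I_n') : 'rV[E]_n :=
  egen k (R q) *: delta_mx 0 (J q) - U (R q) (J q).

(** One rewriting step of the division: [e_r v_l] is replaced by the syzygy of the pair [(r, l)]
    plus its tail; [b] inverts the sign that moves [e_r] to the right end. *)
Lemma mono_syz A l (r : 'I_c) : (w l <= r)%N -> r \in A -> exists2 q, R q = r &
  exists b : k, mono k (A, l) = b%:A *: (emon k (A :\ r) *: (syz q + U r l)).
Proof.
move=> le_r Ar; have [q [Rq Jq]] := RJ_surj le_r; exists q => //.
have dA : [disjoint A :\ r & [set r]] by rewrite disjoint_sym disjoints1 !inE eqxx.
exists (ext_sign k (A :\ r) [set r])^-1.
rewrite /syz Rq Jq subrK !scalerA -emon_mul //.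
by rewrite setUC setD1K.
Qed.

(** Rewriting a non-layered monomial at its largest index [r] leaves a tail with all indices below
    [r] and all weights at most [r], so the induction continues with [r] in place of [s]. The degree
    condition [D] is carried along; it is shifted on the quotient [v] because syzygies have degree
    one. *)
Lemma division s (D : pred nat) u :
  onrow (fun A l => [&& D #|A|, blw s A & (w l <= s)%N]) u ->
  exists v u', [/\ u = eval syz v + u',
    onrow (fun A l => [&& D #|A|, blw s A, (w l <= s)%N & blw (w l) A]) u' &
    onrow (fun A q => [&& D #|A|.+1, blw s A & (R q <= s)%N]) v].
Proof.
elim/ltn_ind: s u => s IHs u.
pose P u := exists v u', [/\ u = eval syz v + u',
    onrow (fun A l => [&& D #|A|, blw s A, (w l <= s)%N & blw (w l) A]) u' &
    onrow (fun A q => [&& D #|A|.+1, blw s A & (R q <= s)%N]) v].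
have PD u1 u2 : P u1 -> P u2 -> P (u1 + u2).
  move=> [v1 [w1 [-> hw1 hv1]]] [v2 [w2 [-> hw2 hv2]]].
  exists (v1 + v2), (w1 + w2); split; try exact: onrowD.
  by rewrite raddfD addrACA.
have PZ (b : k) u1 : P u1 -> P (b%:A *: u1).
  move=> [v1 [w1 [-> hw1 hv1]]]; exists (b%:A *: v1), (b%:A *: w1).
  by split; try exact: onrowZ; rewrite linearZ scalerDr.
apply: (@onrow_ind k c n _ P) => //.
  by exists 0, 0; split; rewrite ?raddf0 ?addr0 //; apply: onrow0.
move=> A l /and3P[DA bA wl]; have [nA|/max_element[r [Ar bAr wr]]] := boolP (blw (w l) A).
  exists 0, (mono k (A, l)); split; rewrite ?raddf0 ?add0r //; last exact: onrow0.
  by apply: onrow_mono; rewrite DA bA wl nA.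
have lt_rs : (r < s)%N by move/blwP: bA; apply.
have cA : #|A| = #|A :\ r|.+1 by rewrite (cardsD1 r A) Ar.
have [q Rq [b ->]] := mono_syz wr Ar; apply: PZ; rewrite scalerDr; apply: PD.
  exists (emon k (A :\ r) *: delta_mx 0 q), 0; split; last 2 first.
  - exact: onrow0.
  - apply: (@onrow_mono k c n' _ (A :\ r) q).
    rewrite Rq -cA DA (ltnW lt_rs) andbT.
    by apply: blwW bAr; apply: ltnW.
  by rewrite addr0 linearZ /= eval_delta.
have [|v [u' [-> hu' hv]]] := IHs r lt_rs (emon k (A :\ r) *: U r l).
  apply: onrow_mul (onU wr) => B l' /and3P[/eqP cB bB wl'] dB.
  rewrite blwU // wl' andbT cardsU disjoint_setI0 // cards0 subn0 cB addn1 -cA.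
  by rewrite DA.
have le_rs := ltnW lt_rs.
exists v, u'; split=> //.
  apply: onrowW hu' => B l' /and4P[-> bB wl' ->].
  by rewrite (blwW le_rs bB) (leq_trans wl').
apply: onrowW hv => B q' /and3P[-> bB wl'].
by rewrite (blwW le_rs bB) (leq_trans wl').
Qed.

Lemma division_top u : exists v u', u = eval syz v + u' /\ layered w u'.
Proof.
have [|v [u' [-> hu' hv]]] := @division c predT u.
  by move=> A l _; rewrite blw_top ltnW.
by exists v, u'; split=> //; apply/layeredP; apply: onrowW hu' => A l /and4P[].
Qed.

Section System.
Variables (N : lmodType E) (a : 'I_n -> N).
Hypothesis aU : forall (r : 'I_c) j, (w j <= r)%N -> egen k r *: a j = eval a (U r j).

Lemma eval_syz q : eval a (syz q) = 0.
Proof. by rewrite linearB linearZ /= eval_delta aU ?subrr. Qed.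

Lemma eval_eval_syz v : eval a (eval syz v) = 0.
Proof.
rewrite eval_map /eval big1 // => q _.
by rewrite /= eval_syz scaler0.
Qed.

Lemma normal_form u : exists v, layered w v /\ eval a v = eval a u.
Proof.
have [v [u' [-> lu']]] := division_top u.
by exists u'; split=> //; rewrite raddfD /= eval_eval_syz add0r.
Qed.

(** Meant for comparing leading monomials: all indices of the normal form lie below the largest
    element [r] of [A], so its monomials are lexicographically smaller than [e_A]. *)
Lemma normal_form_mono A l : ~~ blw (w l) A -> exists u (r : 'I_c),
  [/\ r \in A, layered w u, onrow (fun B _ => blw r B) u, blw r (A :\ r) &
      eval a u = eval a (mono k (A, l))].
Proof.
move=> /max_element[r [Ar bAr wr]]; have [q Rq [b ->]] := mono_syz wr Ar.
have [|v [u' [def_u hu' hv]]] := @division r predT (emon k (A :\ r) *: U r l).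
  apply: onrow_mul (onU wr) => B l' /and3P[/eqP cB bB wl'] dB.
  by rewrite blwU.
exists (b%:A *: u'), r; split=> //.
- apply/layeredP/onrowZ; apply: onrowW hu' => B l'; by case/and4P.
- by apply/onrowZ; apply: onrowW hu' => B l'; case/and4P.
rewrite scalerDr def_u !linearZ !linearD linearZ /= eval_syz scaler0 add0r.
by rewrite ?eval_eval_syz ?add0r.
Qed.

Hypothesis aI : layered_free w a.

Lemma ker_syz u : eval a u = 0 <-> exists v, u = eval syz v.
Proof.
split=> [u0|[v ->]]; last exact: eval_eval_syz.
have [v [u' [def_u lu']]] := division_top u.
exists v; rewrite def_u (aI lu') ?addr0 //.
by rewrite -u0 def_u raddfD /= eval_eval_syz add0r.
Qed.

(** The remainder of a relation is a layered relation, hence zero; so bounds on a relation pass to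
    its expression through syzygies. *)
Lemma division_ker s (D : pred nat) u :
  onrow (fun A l => [&& D #|A|, blw s A & (w l <= s)%N]) u -> eval a u = 0 ->
  exists2 v, u = eval syz v &
    onrow (fun A q => [&& D #|A|.+1, blw s A & (R q <= s)%N]) v.
Proof.
move=> /division[v [u' [-> hu' hv]]]; rewrite raddfD /= eval_eval_syz add0r => u0.
exists v => //; rewrite (aI _ u0) ?addr0 //.
by apply/layeredP; apply: onrowW hu' => A l /and4P[].
Qed.
End System.

Lemma ecoef_mul (x y : E) C : ecoef (x * y) C =
  \sum_A \sum_B ext_sign k A B * (ecoef x A * ecoef y B) * (A :|: B == C)%:R.
Proof. exact: ext_mulE. Qed.

Lemma ecoef_mul0 (x y : E) C :
  (forall A B, ecoef x A != 0 -> ecoef y B != 0 -> A :|: B != C) ->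
  ecoef (x * y) C = 0.
Proof.
move=> h; rewrite ecoef_mul big1 // => A _; rewrite big1 // => B _.
have [->|xA] := eqVneq (ecoef x A) 0; first by rewrite mul0r mulr0 mul0r.
have [->|yB] := eqVneq (ecoef y B) 0; first by rewrite !mulr0 mul0r.
by rewrite (negPf (h A B xA yB)) mulr0.
Qed.

Lemma ecoef_mul_egen (x : E) (r : 'I_c) B : r \notin B ->
  (forall A, ecoef x A != 0 -> r \notin A) ->
  ecoef (x * egen k r) (r |: B) = ext_sign k B [set r] * ecoef x B.
Proof.
move=> nBr hx; rewrite ecoef_mul (bigD1 B) //= (bigD1 [set r]) //=.
rewrite !big1 => [|A nAB|C /negPf nC].
- by rewrite setUC eqxx ecoef_emon eqxx !mulr1 !addr0.
- rewrite big1 // => C _; have [->|/hx nAr] := eqVneq (ecoef x A) 0.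
    by rewrite mul0r mulr0 mul0r.
  rewrite ecoef_emon; have [->|_] := eqVneq C [set r]; last by rewrite !mulr0 mul0r.
  rewrite (_ : (_ == _) = false) ?mulr0 //; apply: contraNF nAB => /eqP eq_U.
  by rewrite -(setU1K nAr) -(setU1K nBr) -eq_U setUC.
- by rewrite ecoef_emon nC !mulr0 mul0r.
Qed.

Lemma onrow_syz q :
  onrow (fun A l => (A == [set R q]) && (l == J q) || blw (R q) A) (syz q).
Proof.
apply: onrowD; last first.
  by apply/onrowN; apply: onrowW (onU (RJ_ge q)) => A l /and3P[_ -> _]; rewrite orbT.
by apply: (@onrow_mono k c n _ [set R q] (J q)); rewrite !eqxx.
Qed.

(** Among the nonzero coefficients take one with the largest index [R q], and let [e_B] occur in it.
    The monomial on [R q |: B] over [v_(J q)] can only come from the leading term of [syz q]: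
    layered coefficients and tails stay below their own index, and the pair [(R q, J q)] determines
    [q]. *)
Lemma syz_free : layered_free R syz.
Proof.
move=> v lv v0; apply/rowP => q0; rewrite mxE; apply/eqP/negPn/negP => nz0.
case: (@arg_maxnP _ q0 [pred q | v 0 q != 0] (fun q => val (R q)) nz0) => q nz max_q.
suff: exists B, ecoef (v 0 q) B != 0 /\ ecoef (eval syz v 0 (J q)) (R q |: B) = ext_sign k B [set R q] * ecoef (v 0 q) B.
  case=> B [nzB]; rewrite v0 mxE ecoef0 => /esym/eqP; rewrite mulf_eq0 (negPf nzB) orbF.
  apply/negP/ext_sign_neq0; rewrite disjoint_sym disjoints1.
  by apply/negP => /(lv q B nzB); rewrite ltnn.
have [B nzB]: exists B, ecoef (v 0 q) B != 0.
  apply/existsP; apply: contraR nz; rewrite negb_exists => /forallP h.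
  by apply/eqP/ffunP => B; rewrite [RHS]ffunE; apply/eqP/negPn/h.
exists B; split=> //.
have not_in q' A : (R q' <= R q)%N -> ecoef (v 0 q') A != 0 -> R q \notin A.
  by move=> le_q nzA; apply/negP => /(lv q' A nzA); rewrite ltnNge le_q.
rewrite /eval summxE ecoef_sum (bigD1 q) //= big1 => [|q' nq'].
  rewrite addr0 !mxE !eqxx /= mulr1 mulrBr ecoefD ecoefN.
  rewrite ecoef_mul_egen ?(not_in q) // => [|A]; last exact: not_in.
  rewrite [X in _ - X]ecoef_mul0 ?subr0 // => A C nzA nzC.
  apply/eqP => /setP/(_ (R q)); rewrite !inE eqxx (negPf (not_in q _ _ nzA)) //=.
  have /and3P[_ /blwP bC _] := onU (RJ_ge q) nzC.
  by move/bC; rewrite ltnn.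
rewrite mxE; apply: ecoef_mul0 => A C nzA nzC; apply/eqP => /setP/(_ (R q)).
have nz' : v 0 q' != 0 by apply: contraNneq nzA => ->; rewrite ecoef0.
have le_q : (R q' <= R q)%N := max_q _ nz'.
rewrite !inE eqxx (negPf (not_in q' _ le_q nzA)) //= => Cr.
case/orP: (onrow_syz nzC) => [/andP[/eqP defC /eqP eJ]|/blwP/(_ _ Cr)].
  move: Cr; rewrite defC inE => /eqP eR.
  by case/eqP: nq'; apply: RJ_inj.
by rewrite ltnNge le_q.
Qed.

(** By anticommutation [e_s e_i v_l = - e_i (e_s v_l)], and [e_s v_l] is a syzygy plus its tail. The
    leftover [x] is quadratic with all indices below [s]. *)
Lemma egen_syz (s : 'I_c) u :
  onrow (fun A l => [&& #|A| == 1%N, blw s A & (w l <= s)%N]) u ->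
  exists v x, [/\ egen k s *: u = eval syz v + x,
     onrow (fun A q => [&& #|A| == 1%N, blw s A & (R q <= s)%N]) v &
     onrow (fun A l => [&& #|A| == 2%N, blw s A & (w l <= s)%N]) x].
Proof.
pose P u := exists v x, [/\ egen k s *: u = eval syz v + x,
     onrow (fun A q => [&& #|A| == 1%N, blw s A & (R q <= s)%N]) v &
     onrow (fun A l => [&& #|A| == 2%N, blw s A & (w l <= s)%N]) x].
apply: (@onrow_ind k c n _ P) => [|u1 u2|b u1|A l].
- by exists 0, 0; split; rewrite ?scaler0 ?linear0 ?addr0 //; apply: onrow0.
- move=> [v1 [x1 [e1 hv1 hx1]]] [v2 [x2 [e2 hv2 hx2]]].
  exists (v1 + v2), (x1 + x2); split; try exact: onrowD.
  by rewrite scalerDr e1 e2 linearD addrACA.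
- move=> [v1 [x1 [e1 hv1 hx1]]]; exists (b%:A *: v1), (b%:A *: x1).
  split; try exact: onrowZ.
  by rewrite scalerA extalg_comm -scalerA e1 linearZ scalerDr.
case/and3P=> /cards1P[i ->] bi wl; have [q [Rq Jq]] := RJ_surj wl.
have lt_is : (i < s)%N by move/blwP: bi; apply; rewrite inE.
exists (- (egen k i *: delta_mx 0 q)), (- (egen k i *: U s l)); split.
- rewrite linearN linearZ /= eval_delta /syz Rq Jq -opprD -scalerDr subrK.
  by rewrite /mono !scalerA /= egen_anticomm scaleNr.
- apply/onrowN; apply: (@onrow_mono k c n' _ [set i] q).
  by rewrite cards1 bi Rq leqnn.
apply/onrowN; apply: onrow_mul (onU wl) => B l' /and3P[/eqP cB bB ->] dB.
by rewrite blwU // cardsU disjoint_setI0 // cards0 cards1 cB.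
Qed.

(** [egen_syz] reduces [e_s (syz q)] to a linear combination of syzygies plus a quadratic remainder.
    That remainder is itself a relation, so dividing it leaves nothing and gives linear
    coefficients. If [R q = s], the leading term drops out first, as [e_s] squares to zero. *)
Lemma syz_triangular (N : lmodType E) (a : 'I_n -> N) :
  (forall (r : 'I_c) j, (w j <= r)%N -> egen k r *: a j = eval a (U r j)) ->
  layered_free w a -> triangular R syz.
Proof.
move=> aU aI s q le_s.
have [v [x [def_x hv hx]]] : exists v x, [/\ egen k s *: syz q = eval syz v + x,
     onrow (fun A q => [&& #|A| == 1%N, blw s A & (R q <= s)%N]) v &
     onrow (fun A l => [&& #|A| == 2%N, blw s A & (w l <= s)%N]) x].
  have [eq_s|lt_s] := eqVneq (R q) s.
    have wJ : (w (J q) <= s)%N by rewrite -eq_s RJ_ge.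
    have [v [x [e hv hx]]] := egen_syz (onrowN (onU wJ)).
    by exists v, x; split=> //; rewrite /syz eq_s scalerBr scalerA egen_sqr scale0r sub0r -scalerN.
  have {}lt_s : (R q < s)%N by rewrite ltn_neqAle le_s andbT; apply: contra_neq lt_s => /val_inj.
  apply: egen_syz; apply: onrowD.
    apply: (@onrow_mono k c n _ [set R q] (J q)); rewrite cards1 eqxx (leq_trans (RJ_ge q)) // andbT.
    by apply/blwP => i; rewrite inE => /eqP->.
  apply/onrowN; apply: onrowW (onU (RJ_ge q)) => A l /and3P[-> bA wl].
  by rewrite (blwW le_s bA) (leq_trans wl).
have /(division_ker aU aI)[|v' def_v' hv'] := (hx : onrow (fun A l => [&& pred1 2%N #|A|, blw s A & (w l <= s)%N]) x).
  move/(congr1 (eval a)): def_x; rewrite linearZ /= (eval_syz aU) scaler0 linearD /=.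
  by rewrite (eval_eval_syz aU) add0r => <-.
exists (v + v'); split; last by rewrite def_x def_v' linearD.
by apply: onrowD => //; apply: onrowW hv' => A l; rewrite /= eqSS.
Qed.

End Syzygies.

(** * Linear and minimal resolutions *)

Section GradedSystems.
Variables (k : fieldType) (c : nat).
Local Notation E := (extalg k c).
Implicit Types (A B C : {set 'I_c}) (s : nat).

Lemma triangular_choice (N : lmodType E) n (w : 'I_n -> 'I_c) (a : 'I_n -> N) :
  triangular w a -> exists2 U : 'I_c -> 'I_n -> 'rV[E]_n,
    forall (r : 'I_c) j, (w j <= r)%N ->
      onrow (fun A l => [&& #|A| == 1%N, blw r A & (w l <= r)%N]) (U r j) &
    forall (r : 'I_c) j, (w j <= r)%N -> egen k r *: a j = eval a (U r j).
Proof.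
move=> Ta; pose X (p : 'I_c * 'I_n) u := (w p.2 <= p.1)%N ->
    onrow (fun A l => [&& #|A| == 1%N, blw p.1 A & (w l <= p.1)%N]) u /\
    egen k p.1 *: a p.2 = eval a u.
have [U HU] : exists U : 'I_c * 'I_n -> 'rV[E]_n, forall p, X p (U p).
  apply: (@fin_all_exists _ _ X) => -[r j]; rewrite /X /=.
  by have [/Ta[u hu]|_] := leqP (w j) r; [exists u|exists 0].
by exists (fun r j => U (r, j)) => r j le_r; have [] := HU (r, j) le_r.
Qed.

Lemma syz_index n (w : 'I_n -> 'I_c) : exists n' (R : 'I_n' -> 'I_c) (J : 'I_n' -> 'I_n),
  [/\ forall q, (w (J q) <= R q)%N,
      forall (r : 'I_c) j, (w j <= r)%N -> exists q, R q = r /\ J q = j &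
      forall q q', R q = R q' -> J q = J q' -> q = q'].
Proof.
pose X := [set p : 'I_c * 'I_n | (w p.2 <= p.1)%N].
exists #|X|, (fun q => (enum_val q).1), (fun q => (enum_val q).2); split.
- by move=> q; have := enum_valP q; rewrite inE.
- move=> r j le_r; have Xp : (r, j) \in X by rewrite inE.
  by exists (enum_rank_in Xp (r, j)); rewrite enum_rankK_in.
by move=> q q' eR eJ; apply: enum_val_inj; rewrite [LHS]surjective_pairing eR eJ -surjective_pairing.
Qed.

Lemma syz_system (N : lmodType E) n (w : 'I_n -> 'I_c) (a : 'I_n -> N) :
  triangular w a -> layered_free w a -> exists n' (w' : 'I_n' -> 'I_c) (g : 'I_n' -> 'rV[E]_n),
  [/\ triangular w' g, layered_free w' g,
      forall u, eval a u = 0 <-> exists v, u = eval g v &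
      forall q, onrow (fun A _ => #|A| == 1%N) (g q)].
Proof.
move=> Ta Fa.
have [U onU aU] := triangular_choice Ta.
have [n' [R [J [RJ_ge RJ_surj RJ_inj]]]] := syz_index w.
exists n', R, (syz U R J); split.
- exact: (syz_triangular onU RJ_ge RJ_surj aU Fa).
- exact: (syz_free onU RJ_ge RJ_inj).
- exact: (ker_syz onU RJ_ge RJ_surj aU Fa).
move=> q; apply: onrowD; last first.
  by apply/onrowN; apply: onrowW (onU _ _ (RJ_ge q)) => A l /and3P[].
by apply: (@onrow_mono k c n _ [set R q] (J q)); rewrite cards1.
Qed.

(** The last clause is independence of the graded pieces, the property that turns homogeneous
    components of relations into relations. *)
Definition is_graded (N : lmodType E) (deg : nat -> N -> Prop) : Prop :=
  [/\ forall n, deg n 0,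
      forall n (b : k) x y, deg n x -> deg n y -> deg n (b%:A *: x + y),
      forall n A x, deg n x -> deg (#|A| + n)%N (emon k A *: x) &
      forall m (x : nat -> N), (forall n, deg n (x n)) ->
        \sum_(n < m) x n = 0 -> forall n, (n < m)%N -> x n = 0].

Definition hcomp n (dg : 'I_n -> nat) m (u : 'rV[E]_n) : 'rV[E]_n :=
  \row_j [ffun A => ecoef (u 0 j) A * (m == #|A| + dg j)%N%:R].

Lemma ecoef_hcomp n (dg : 'I_n -> nat) m u j A :
  ecoef (hcomp dg m u 0 j) A = ecoef (u 0 j) A * (m == #|A| + dg j)%N%:R.
Proof. by rewrite mxE /ecoef ffunE. Qed.

Lemma row_ext n (u v : 'rV[E]_n) :
  (forall j A, ecoef (u 0 j) A = ecoef (v 0 j) A) -> u = v.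
Proof. by move=> h; apply/rowP => j; apply/ffunP => A; apply: h. Qed.

Lemma hcomp_homogeneous n (dg : 'I_n -> nat) m u : homogeneous dg m (hcomp dg m u).
Proof.
move=> j A; rewrite ecoef_hcomp; have [//|_] := m =P _.
by rewrite mulr0 eqxx.
Qed.

Lemma hcomp_id n (dg : 'I_n -> nat) m u : homogeneous dg m u -> hcomp dg m u = u.
Proof.
move=> hu; apply: row_ext => j A; rewrite ecoef_hcomp.
have [->|nz] := eqVneq (ecoef (u 0 j) A) 0; first by rewrite mul0r.
by rewrite (hu j A nz) eqxx mulr1.
Qed.

Lemma homogeneousP n (dg : 'I_n -> nat) m (u : 'rV[E]_n) :
  homogeneous dg m u <-> onrow (fun A j => m == #|A| + dg j)%N u.
Proof. by split=> [h A j /h->//|h j A /h/eqP]. Qed.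

Lemma hcomp_neq n (dg : 'I_n -> nat) m m' u :
  homogeneous dg m u -> m' != m -> hcomp dg m' u = 0.
Proof.
move=> hu nm; apply: row_ext => j A; rewrite ecoef_hcomp mxE ecoef0.
have [->|nz] := eqVneq (ecoef (u 0 j) A) 0; first by rewrite mul0r.
by rewrite -(hu j A nz) (negPf nm) mulr0.
Qed.

Lemma hcompD n (dg : 'I_n -> nat) m u v :
  hcomp dg m (u + v) = hcomp dg m u + hcomp dg m v.
Proof.
apply: row_ext => j A; rewrite ecoef_hcomp [in LHS]mxE [in RHS]mxE !ecoefD.
by rewrite !ecoef_hcomp mulrDl.
Qed.

Lemma hcomp0 n (dg : 'I_n -> nat) m : hcomp dg m 0 = 0.
Proof. by apply: row_ext => j A; rewrite ecoef_hcomp mxE ecoef0 mul0r. Qed.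

(** The bound is kept open upwards so that several sums can be cut off at a common place. *)
Lemma hcomp_sum n (dg : 'I_n -> nat) u : exists M, forall M', (M <= M')%N ->
  u = \sum_(m < M') hcomp dg m u.
Proof.
exists (c + \max_j dg j).+1 => M le_M; apply: row_ext => j A.
have lt_M : (#|A| + dg j < M)%N.
  apply: leq_trans le_M; rewrite ltnS leq_add ?leq_bigmax //.
  by rewrite -[leqRHS]card_ord max_card.
rewrite summxE ecoef_sum (bigD1 (Ordinal lt_M)) //= ecoef_hcomp eqxx mulr1.
rewrite big1 ?addr0 // => m nm; rewrite ecoef_hcomp (_ : (_ == _) = false) ?mulr0 //.
by apply: contraNF nm => /eqP eq_m; apply/eqP/val_inj.
Qed.

Lemma homogeneous_graded n (dg : 'I_n -> nat) : is_graded (@homogeneous k c n dg).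
Proof.
split=> [m|m b u v /homogeneousP hu /homogeneousP hv|m A u /homogeneousP hu|M x hx sum0 m lt_m].
- by apply/homogeneousP; apply: onrow0.
- by apply/homogeneousP; apply: onrowD => //; apply: onrowZ.
- apply/homogeneousP; apply: onrow_mul hu => B l /eqP-> dAB.
  by rewrite cardsU disjoint_setI0 // cards0 subn0 addnA.
have := congr1 (hcomp dg m) sum0.
rewrite hcomp0 (big_morph _ (hcompD dg m) (hcomp0 dg m)) (bigD1 (Ordinal lt_m)) //=.
rewrite hcomp_id // big1 ?addr0 // => i ni; apply: (@hcomp_neq _ _ i) => //.
by rewrite eq_sym; apply: contra_neq ni => ?; apply: val_inj.
Qed.

Section Graded.
Variables (N : lmodType E) (deg : nat -> N -> Prop).
Hypothesis degP : is_graded deg.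

Lemma deg_sum m I (r : seq I) (P : pred I) F :
  (forall i, P i -> deg m (F i)) -> deg m (\sum_(i <- r | P i) F i).
Proof.
have [d0 dL _ _] := degP; move=> h; elim/big_ind: _ => // x y hx hy.
by rewrite -[x]scale1r -[1](scale1r (1 : E)); apply: dL.
Qed.

Lemma eval_deg n (dg : 'I_n -> nat) (g : 'I_n -> N) m u :
  (forall j, deg (dg j) (g j)) -> homogeneous dg m u -> deg m (eval g u).
Proof.
have [d0 dL dM _] := degP; move=> hg hu; apply: deg_sum => j _.
rewrite [u 0 j]extalg_sum scaler_suml; apply: deg_sum => A _.
have [->|nz] := eqVneq (ecoef (u 0 j) A) 0; first by rewrite scale0r mul0r scale0r.
by rewrite -scalerA -[_ *: _]addr0; apply: dL => //; rewrite (hu j A nz); apply: dM.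
Qed.

(** Subtract [eval g u], which sits in degree [m], from the image of the [m]-th component. The
    images of all components then sum to zero with one term in each degree, so independence kills
    the [m]-th one. *)
Lemma hcomp_eval n (dg : 'I_n -> nat) (g : 'I_n -> N) m u :
  (forall j, deg (dg j) (g j)) -> deg m (eval g u) -> eval g (hcomp dg m u) = eval g u.
Proof.
have [d0 dL dM dI] := degP; move=> hg hu; have [M hM] := hcomp_sum dg u.
have le_M := leq_maxl M m.+1; have lt_m := leq_maxr M m.+1.
have def_u := hM _ le_M; set M' := maxn _ _ in def_u lt_m.
pose x i := eval g (hcomp dg i u) - (i == m)%:R *: eval g u.
have hx i : deg i (x i).
  rewrite /x addrC; have [->|_] := eqVneq i m.
    rewrite -scaleNr -[-1](scaleN1r (1 : E)); apply: dL => //.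
    exact/eval_deg/hcomp_homogeneous.
  rewrite scale0r oppr0 add0r; exact/eval_deg/hcomp_homogeneous.
have := dI M' x hx _ m lt_m; rewrite /x eqxx scale1r => h; apply/eqP; rewrite -subr_eq0 h //.
rewrite sumrB -linear_sum -def_u (bigD1 (Ordinal lt_m)) //= eqxx scale1r big1 ?addr0 ?subrr //.
by move=> i ni; rewrite (_ : (_ == _) = false) ?scale0r //; apply: contraNF ni => /eqP ?; apply/eqP/val_inj.
Qed.

(** The property that passes from a module to its first syzygies, with [d] raised by one; iterating
    it produces linear resolutions. *)
Definition linear_system (P : N -> Prop) d : Prop :=
  exists n (w : 'I_n -> 'I_c) (a : 'I_n -> N),
  [/\ triangular w a, layered_free w a, forall j, deg d (a j) &
      forall x, P x <-> exists u, x = eval a u].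

End Graded.

Lemma triangular_map (N N' : lmodType E) (h : {linear N -> N'}) n (w : 'I_n -> 'I_c) (a : 'I_n -> N) :
  triangular w a -> triangular w (h \o a).
Proof.
move=> Ta r j /Ta[u [hu e]]; exists u; split=> //.
by rewrite -eval_map -e linearZ.
Qed.

Lemma layered_free_map (N N' : lmodType E) (h : {linear N -> N'}) n (w : 'I_n -> 'I_c) (a : 'I_n -> N) :
  injective h -> layered_free w a -> layered_free w (h \o a).
Proof.
move=> inj_h Fa u lu; rewrite -eval_map => e; apply: Fa => //.
by apply: inj_h; rewrite e linear0.
Qed.

Lemma ecoef_mul_set0 (x y : E) : ecoef (x * y) set0 = ecoef x set0 * ecoef y set0.
Proof.
rewrite ecoef_mul (bigD1 set0) //= (bigD1 set0) //= !big1 ?addr0.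
- rewrite set0U eqxx mulr1 /ext_sign -setI_eq0 set0I eqxx /ext_inv big_set0.
  by rewrite expr0 mul1r.
- by move=> A /negPf nA; rewrite big1 // => B _; rewrite setU_eq0 nA mulr0.
- by move=> B /negPf nB; rewrite setU_eq0 nB andbF mulr0.
Qed.

Lemma ecoef_mulmx_set0 m n (v : 'rV[E]_m) (D : 'M[E]_(m, n)) j :
  ecoef ((v *m D) 0 j) set0 = \sum_i ecoef (v 0 i) set0 * ecoef (D i j) set0.
Proof. by rewrite mxE ecoef_sum; apply: eq_bigr => i _; rewrite ecoef_mul_set0. Qed.

End GradedSystems.

(** * Minimal resolutions of modules with a linear system *)

Section MinimalResolutions.
Variables (k : fieldType) (c : nat).
Local Notation E := (extalg k c).

Lemma homogeneous_mulmx m n (dg : 'I_m -> nat) (dg' : 'I_n -> nat) d (u : 'rV[E]_m) (D : 'M[E]_(m, n)) :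
  homogeneous dg d u -> (forall i, homogeneous dg' (dg i) (row i D)) ->
  homogeneous dg' d (u *m D).
Proof.
move=> hu hD; rewrite -eval_rows; apply: eval_deg hD hu.
exact: homogeneous_graded.
Qed.

Lemma homogeneous_delta n (dg : 'I_n -> nat) j :
  homogeneous dg (dg j) (delta_mx 0 j : 'rV[E]_n).
Proof.
move=> i A; rewrite mxE eqxx /=; have [->|_] := eqVneq i j.
  rewrite -[1%:R]/(emon k set0) ecoef_emon; have [->|_] := eqVneq A set0.
    by rewrite cards0.
  by rewrite eqxx.
by rewrite ecoef0 eqxx.
Qed.

Lemma homogeneousB n (dg : 'I_n -> nat) d (u v : 'rV[E]_n) :
  homogeneous dg d u -> homogeneous dg d v -> homogeneous dg d (u - v).
Proof.
by rewrite !homogeneousP => hu hv; apply: onrowD => //; apply: onrowN.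
Qed.

Lemma homogeneousN n (dg : 'I_n -> nat) d (u : 'rV[E]_n) :
  homogeneous dg d u -> homogeneous dg d (- u).
Proof. by rewrite !homogeneousP; apply: onrowN. Qed.

(** The generators [g] and the triangular system [a] span the same module, so matrices [U] and [V]
    translate between them. Minimality forces equal degrees and makes the matrices inverse to each
    other, and [V] carries the syzygies of [a] to those of [g]. No uniqueness of minimal resolutions
    is invoked. *)
Lemma minimal_step (N : lmodType E) (deg : nat -> N -> Prop) (P : N -> Prop) d
    n (dg : 'I_n -> nat) (g : 'I_n -> N) :
  is_graded deg -> linear_system deg P d -> (forall j, deg (dg j) (g j)) ->
  (forall x, P x <-> exists u, x = eval g u) ->
  (forall u, eval g u = 0 -> forall j, ecoef (u 0 j) set0 = 0) ->
  (forall j, dg j = d) /\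
  linear_system (homogeneous dg) (fun u => eval g u = 0) d.+1.
Proof.
move=> degP [m [w [a [Ta Fa da Pa]]]] hg Pg min_g.
have [u0 Hu0] : exists u : 'I_n -> 'rV[E]_m, forall r, homogeneous (fun=> d) (dg r) (u r) /\ g r = eval a (u r).
  apply: (@fin_all_exists _ _ (fun r u => homogeneous (fun=> d) (dg r) u /\ g r = eval a u)) => r.
  have [u def_u] : exists u, g r = eval a u by apply/Pa/Pg; exists (delta_mx 0 r); rewrite eval_delta.
  exists (hcomp (fun=> d) (dg r) u); split; first exact: hcomp_homogeneous.
  by rewrite (hcomp_eval degP) // -def_u.
have [v0 Hv0] : exists v : 'I_m -> 'rV[E]_n, forall j, homogeneous dg d (v j) /\ a j = eval g (v j).
  apply: (@fin_all_exists _ _ (fun j v => homogeneous dg d v /\ a j = eval g v)) => j.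
  have [v def_v] : exists v, a j = eval g v by apply/Pg/Pa; exists (delta_mx 0 j); rewrite eval_delta.
  exists (hcomp dg d v); split; first exact: hcomp_homogeneous.
  by rewrite (hcomp_eval degP) // -def_v.
pose U : 'M[E]_(n, m) := \matrix_i u0 i; pose V : 'M[E]_(m, n) := \matrix_j v0 j.
have rU r : row r U = u0 r by rewrite rowK.
have rV j : row j V = v0 j by rewrite rowK.
have evU u : eval a (u *m U) = eval g u.
  by rewrite eval_mulmx; apply: eq_bigr => i _; rewrite rU -(Hu0 i).2.
have evV u : eval g (u *m V) = eval a u.
  by rewrite eval_mulmx; apply: eq_bigr => i _; rewrite rV -(Hv0 i).2.
(* The row [x] is a relation on [g]. If [dg r] were not [d], no entry of [u0 r] could have a
   constant term, so [x] would have constant term 1 at [r], against minimality. *)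
have dg_d r : dg r = d.
  pose x := delta_mx 0 r - u0 r *m V.
  have x0 : eval g x = 0 by rewrite linearB /= evV eval_delta (Hu0 r).2 subrr.
  have /eqP := min_g x x0 r; rewrite !mxE !eqxx ecoefD ecoefN.
  rewrite -[1%:R]/(emon k set0) ecoef_emon eqxx ecoef_sum.
  have [//|nd] := eqVneq (dg r) d; rewrite big1 ?subr0 ?oner_eq0 // => i _.
  rewrite ecoef_mul_set0; have [->|nz] := eqVneq (ecoef (u0 r 0 i) set0) 0.
    by rewrite mul0r.
  by move: nd; rewrite ((Hu0 r).1 i _ nz) cards0 eqxx.
(* As [dg] is constant, [U] and [V] are matrices over [k]. *)
have dgE : dg =1 (fun=> d) by [].
have scal p (h : 'I_p -> nat) (x : 'rV[E]_p) : h =1 (fun=> d) -> homogeneous h d x ->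
    forall j A, A != set0 -> ecoef (x 0 j) A = 0.
  move=> hd hx j A nA; apply/eqP/negPn/negP => /hx; rewrite hd => /eqP.
  by rewrite -{1}[d]add0n eqn_add2r eq_sym cards_eq0 (negPf nA).
have hU i : homogeneous (fun=> d) (dg i) (row i U) by rewrite rU; case: (Hu0 i).
have hV i : homogeneous dg d (row i V) by rewrite rV; case: (Hv0 i).
(* The rows of the difference have constant entries, hence are layered, and freeness of [a]
   applies. *)
have VU : V *m U = 1%:M.
  apply/row_matrixP => j; rewrite row_mul row1; apply/eqP; rewrite -subr_eq0; apply/eqP/Fa.
    move=> i A nz; have := scal _ _ (row j V *m U - delta_mx 0 j) (fun=> erefl _).
    have [-> _ ? |nA] := eqVneq A set0; first by rewrite inE.
    move=> /(_ (homogeneousB (homogeneous_mulmx (hV j) hU) (@homogeneous_delta _ (fun=> d) j)) i A nA) e.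
    by rewrite e eqxx in nz.
  by rewrite linearB /= evU eval_delta rV -(Hv0 j).2 subrr.
(* On this side minimality of [g] replaces freeness: it kills the constant terms, and homogeneity
   leaves no others. *)
have UV : U *m V = 1%:M.
  apply/row_matrixP => r; rewrite row_mul row1; apply/eqP; rewrite -subr_eq0; apply/eqP.
  apply: row_ext => i A; rewrite [in RHS]mxE ecoef0.
  have hd : homogeneous (fun=> d) d (row r U) by have := hU r; rewrite dg_d.
  have [->|nA] := eqVneq A set0.
    by apply: min_g; rewrite linearB /= evV eval_delta rU -(Hu0 r).2 subrr.
  apply: (scal _ dg) => //; apply: homogeneousB.
    by apply: homogeneous_mulmx hd _ => j; apply: hV.
  by have := @homogeneous_delta _ dg r; rewrite dg_d.
split=> //; have [p [w' [s [Ts Fs ks hs]]]] := syz_system Ta Fa.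
pose h := eval (fun i => row i V); have hE u : h u = u *m V by exact: eval_rows.
have inj_h : injective h.
  by move=> x y; rewrite !hE => /(congr1 (mulmx^~ U)); rewrite -!mulmxA VU !mulmx1.
have hsE v : eval (h \o s) v = eval s v *m V.
  by rewrite -hE; symmetry; apply: eval_map.
exists p, w', (h \o s); split.
- exact: triangular_map.
- exact: layered_free_map.
- move=> q; rewrite (hE (s q) : (h \o s) q = _); apply: (@homogeneous_mulmx _ _ (fun=> d)) => //.
  by move=> j A /hs/eqP->.
- move=> u; rewrite -evU ks; split=> -[v e]; exists v.
    by rewrite hsE -e -mulmxA UV mulmx1.
  by rewrite e hsE -mulmxA VU mulmx1.
Qed.

Lemma minimal_resolution_linear (N : lmodType E) (deg : nat -> N -> Prop) (P : N -> Prop) d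
    (G : gcomplex k c) (g : 'I_(gc_rk G 0%N) -> N) :
  is_graded deg -> linear_system deg P d -> graded_resolution deg P g ->
  minimal_complex G -> linear_complex d G.
Proof.
move=> degP linP [hG dG Pg kg kG] minG.
have no_const i n (u : 'rV[E]_n) v (D : 'M[E]_(gc_rk G i.+1, n)) :
    (forall r s, ecoef (D r s) set0 = 0) -> u = v *m D -> forall j, ecoef (u 0 j) set0 = 0.
  by move=> D0 -> j; rewrite ecoef_mulmx_set0 big1 // => r _; rewrite D0 mulr0.
have [dg0 lin1] := minimal_step degP linP dG Pg (fun u e =>
  let: ex_intro v ev := (kg u).1 e in @no_const 0%N _ u v _ (minG 0%N) ev).
(* By exactness the image of each differential is the kernel of the previous map, which is where
   [minimal_step] supplies the next linear system. *)
suff H i : (forall j : 'I_(gc_rk G i), gc_dg j = (i + d)%N) /\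
    linear_system (@homogeneous k c _ (@gc_dg _ _ G i))
      (fun u => exists v, u = v *m gc_d G i) (i + d).+1.
  by move=> i; case: (H i).
elim: i => [|i [dg_i lin_i]].
  split=> //; case: lin1 => p [w [a [? ? ? ka]]]; exists p, w, a; split=> // u.
  by rewrite -kg ka.
have degi := @homogeneous_graded k c _ (@gc_dg _ _ G i).
have [|u e|dg_S lin_S] := minimal_step degi lin_i (hG i).
- move=> u; split=> -[v ->]; exists v; by rewrite eval_rows.
- by move: e; rewrite eval_rows kG => -[v /(no_const i.+1)]; apply; apply: minG.
split=> //; case: lin_S => p [w [a [? ? ? ka]]]; exists p, w, a; split=> // u.
by rewrite -ka eval_rows kG.
Qed.

End MinimalResolutions.

Lemma split_case_l (T : Type) m n (g : 'I_m -> T) (h : 'I_n -> T) i :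
  split_case g h (lshift n i) = g i.
Proof. by rewrite /split_case -[lshift n i]/(unsplit (inl i)) unsplitK. Qed.

Lemma split_case_r (T : Type) m n (g : 'I_m -> T) (h : 'I_n -> T) i :
  split_case g h (rshift m i) = h i.
Proof. by rewrite /split_case -[rshift m i]/(unsplit (inr i)) unsplitK. Qed.

(** * Products of ideals with subsets of modules *)

Section Setmul.
Variables (R : nzRingType) (V : lmodType R).
Implicit Types (J : R -> Prop) (X Y : V -> Prop).

Lemma setmul0 J X : setmul J X 0.
Proof. by exists 0%N, (fun=> 0), (fun=> 0); split=> [[]//|]; rewrite big_ord0. Qed.

Lemma setmul1 J X a x : J a -> X x -> setmul J X (a *: x).
Proof. by exists 1%N, (fun=> a), (fun=> x); rewrite big_ord1. Qed.

Lemma setmulD J X x y : setmul J X x -> setmul J X y -> setmul J X (x + y).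
Proof.
move=> [m [a [u [h ->]]]] [n [b [v [h' ->]]]].
exists (m + n)%N, (split_case a b), (split_case u v); split=> [i|].
  by rewrite /split_case; case: (split i).
by rewrite big_split_ord; congr (_ + _); apply: eq_bigr => i _;
  rewrite ?split_case_l ?split_case_r.
Qed.

Lemma setmul_sum J X I (r : seq I) (P : pred I) F :
  (forall i, P i -> setmul J X (F i)) -> setmul J X (\sum_(i <- r | P i) F i).
Proof.
by move=> h; elim/big_ind: _ => //; [exact: setmul0 | exact: setmulD].
Qed.

Lemma setmul_ind J X (P : V -> Prop) x :
  P 0 -> (forall x y, P x -> P y -> P (x + y)) ->
  (forall a x, J a -> X x -> P (a *: x)) -> setmul J X x -> P x.
Proof.
move=> P0 PD PZ [n [a [y [h ->]]]]; elim/big_ind: _ => // i _.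
by have [? ?] := h i; apply: PZ.
Qed.

Lemma setmulZ J X b x : (forall a, J a -> J (b * a)) -> setmul J X x -> setmul J X (b *: x).
Proof.
move=> hJ; apply: (@setmul_ind J X (fun x => setmul J X (b *: x))) => [|u v hu hv|a u Ja Xu].
- by rewrite scaler0; apply: setmul0.
- by rewrite scalerDr; apply: setmulD.
by rewrite scalerA; apply: setmul1 => //; apply: hJ.
Qed.

Lemma setmulW J J' X Y x : (forall a, J a -> J' a) -> (forall x, X x -> Y x) ->
  setmul J X x -> setmul J' Y x.
Proof.
move=> hJ hX; apply: (@setmul_ind J X (setmul J' Y)); [exact: setmul0 | exact: setmulD |].
by move=> a u Ja Xu; apply: setmul1; auto.
Qed.

Lemma submod_gen1 X x : X x -> submod_gen X x.
Proof. by move=> Xx; rewrite -[x]scale1r; apply: setmul1. Qed.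

Lemma submod_genZ X b x : submod_gen X x -> submod_gen X (b *: x).
Proof. exact: setmulZ. Qed.

Lemma submod_gen_sub X Y x : (forall x, X x -> submod_gen Y x) ->
  submod_gen X x -> submod_gen Y x.
Proof.
move=> h; apply: (@setmul_ind _ X (submod_gen Y)); [exact: setmul0 | exact: setmulD |].
by move=> a u _ /h; apply: submod_genZ.
Qed.

End Setmul.

Lemma setmul_map (R : nzRingType) (V W : lmodType R) (h : {linear V -> W})
    (J : R -> Prop) (X : V -> Prop) (Y : W -> Prop) x :
  (forall x, X x -> Y (h x)) -> setmul J X x -> setmul J Y (h x).
Proof.
move=> hX; apply: (@setmul_ind R V J X (fun x => setmul J Y (h x))) => [|u v hu hv|a u Ja Xu].
- by rewrite linear0; apply: setmul0.
- by rewrite linearD; apply: setmulD.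
by rewrite linearZ; apply: setmul1 => //; apply: hX.
Qed.

(** * Groebner bases *)

Section Groebner.
Variables (k : fieldType) (c : nat).
Local Notation E := (extalg k c).

(** Every monomial of [b] contains some [e_i] with [i < r], so [b] cannot cancel [e_r v_j]. This
    monomial survives and fixes the degree of the relation, and homogeneity then fixes the degree of
    each monomial of [b]. *)
Lemma leading_relation_shape (N : lmodType E) n (dg : 'I_n -> nat) (a : 'I_n -> N) r j rel :
  leading_relation dg a r j rel -> exists2 b, rel = egen k r *: delta_mx 0 j - b &
    onrow (fun A l => [exists i in A, (i < r)%N] && ((dg j).+1 == #|A| + dg l)%N) b.
Proof.
case=> _ [d hd] [b sb def_rel]; exists b => // A l nz.
have onb : onrow (fun A _ => [exists i in A, (i < r)%N]) b.
  have: forall b, submod_gen (fun y => exists (i : 'I_c) l, (i < r)%N /\ y = egen k i *: delta_mx 0 l) b ->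
      onrow (fun A (l : 'I_n) => [exists i in A, (i < r)%N]) b.
    move=> {A l nz sb} b'; apply: (@setmul_ind _ _ _ _ (onrow _)); [exact: onrow0 | exact: onrowD|].
    move=> x _ _ [i [l [lt_i ->]]].
    rewrite [x]extalg_sum scaler_suml; apply: onrow_sum => A _; rewrite -scalerA; apply: onrowZ.
    apply: (@onrow_mul k c n (fun A _ => A == [set i])) => [B l' /eqP-> _|].
      by apply/existsP; exists i; rewrite !inE eqxx orbT.
    exact: (@onrow_mono k c n _ [set i] l).
  exact.
have nb l' : ecoef (b 0 l') [set r] = 0.
  apply/eqP/negPn/negP => /onb/existsP[i]; rewrite inE => /andP[/eqP->].
  by rewrite ltnn.
have defd : d = (dg j).+1.
  rewrite (hd j [set r]) ?cards1 // def_rel !mxE !eqxx mulr1 ecoefD ecoefN nb.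
  by rewrite ecoef_emon eqxx subr0 oner_eq0.
rewrite (onb _ _ nz) /= -defd; apply/eqP/(hd l A); rewrite def_rel !mxE ecoefD ecoefN.
suff ->: ecoef (egen k r * ((0 == 0 :> 'I_1) && (l == j))%:R) A = 0.
  by rewrite sub0r oppr_eq0.
rewrite mulr_natr; case: (_ && _); rewrite ?mulr0n ?ecoef0 //= mulr1n ecoef_emon.
have [defA|//] := eqVneq A [set r].
by rewrite defA nb eqxx in nz.
Qed.

(** The leading monomial of [G r j] is [e_r v_j], and the multiples of these are precisely the
    non-layered monomials. What has to be excluded is a relation with layered leading monomial. *)
Lemma groebner_layered (N : lmodType E) n (w : 'I_n -> 'I_c) (a : 'I_n -> N)
    (G : 'I_c -> 'I_n -> 'rV[E]_n) lt :
  triangular w a -> layered_free w a ->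
  (forall (r : 'I_c) j, (w j <= r)%N -> eval a (G r j) = 0) ->
  (forall (r : 'I_c) j, (w j <= r)%N -> exists2 b, G r j = egen k r *: delta_mx 0 j - b &
     onrow (fun A _ => [exists i : 'I_c, (A == [set i]) && (i < r)%N]) b) ->
  term_order lt -> refines_lex lt ->
  groebner_basis lt (fun u => eval a u = 0) (fun u => exists (r : 'I_c) j, (w j <= r)%N /\ u = G r j).
Proof.
move=> Ta Fa kG defG [lt_irr lt_tr _ _ _] lex; split.
  by move=> _ [r [j [le_r ->]]]; apply: kG.
move=> y; split; last first.
  by apply: setmulW => // _ [u [m [[r [j [le_r ->]]] ld ->]]]; exists (G r j), m; rewrite kG.
apply: submod_gen_sub => {}y [u [[A j] [u0 [nz ld] ->]]].
have [bA|] := boolP (blw (w j) A); last first.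
  case/max_element=> r [Ar bAr le_r].
  have -> : mono k (A, j) = (ext_sign k (A :\ r) [set r])^-1%:A *: (emon k (A :\ r) *: mono k ([set r], j)).
    have nz0 : ext_sign k (A :\ r) [set r] != 0.
      by apply: ext_sign_neq0; rewrite disjoint_sym disjoints1 !inE eqxx.
    rewrite mono_mul setUC setD1K // -[LHS]scale1r [RHS]scalerA; congr (_ *: _).
    by rewrite mulr_algl scalerA mulVf // scale1r.
  do 2!apply: submod_genZ; apply: submod_gen1; exists (G r j), ([set r], j).
  split=> //; first by exists r, j.
  have [b defr onb] := defG r j le_r.
  have b0 l : ecoef (b 0 l) [set r] = 0.
    apply/eqP/negPn/negP => /onb/existsP[i] /andP[/eqP/set1_inj->].
    by rewrite ltnn.
  rewrite /is_lead defr /=; split.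
    rewrite !mxE !eqxx mulr1 ecoefD ecoefN b0 ecoef_emon eqxx subr0; exact: oner_neq0.
  move=> [C l] /=; rewrite !mxE ecoefD ecoefN eqxx mulr_natr.
  have [eC|nC] := eqVneq (ecoef (b 0 l) C) 0.
    rewrite eC subr0; have [->|_] := eqVneq l j; last by rewrite mulr0n ecoef0 eqxx.
    rewrite mulr1n ecoef_emon; have [-> _|] := eqVneq C [set r]; first by left.
    by rewrite eqxx.
  move=> _; right; have /existsP[i /andP[/eqP-> lt_i]] := onb _ _ nC.
  apply: lex; exists r; rewrite !inE eqxx; split=> // [|i' lt_i'].
    by apply: contraTneq lt_i => ->; rewrite ltnn.
  rewrite !inE; have [e|_] := eqVneq i' i; first by rewrite e ltnNge ltnW in lt_i'.
  by have [e|] := eqVneq i' r; first by rewrite e ltnn in lt_i'.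
(* Otherwise the leading monomial is its own normal form, and no smaller
   monomial can cancel it. *)
exfalso.
have [U onU aU] := triangular_choice Ta.
have [n' [R [J [RJ_ge RJ_surj RJ_inj]]]] := syz_index w.
pose nfp (p : {set 'I_c} * 'I_n) v := [/\ layered w v, eval a v = eval a (mono k p),
  blw (w p.2) p.1 -> v = mono k p &
  ~~ blw (w p.2) p.1 -> forall C l, ecoef (v 0 l) C != 0 -> lex_lt C p.1].
have [nf Hnf] : exists nf : {set 'I_c} * 'I_n -> 'rV[E]_n, forall p, nfp p (nf p).
  apply: (@fin_all_exists _ _ nfp) => -[C l].
  have [bC|nC] := boolP (blw (w l) C).
    exists (mono k (C, l)); split=> //; last by rewrite bC.
    by apply/layeredP; apply: onrow_mono.
  have [v [r [Cr lv bv br ev]]] := normal_form_mono onU RJ_ge RJ_surj aU nC.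
  exists v; split=> //; first by rewrite (negPf nC).
  move=> _ D l' /bv /blwP bD; exists r; split=> // [|i lt_i].
    by apply/negP => /bD; rewrite ltnn.
  transitivity false; first by apply/negP => /bD; rewrite ltnNge ltnW.
  apply/esym/negP => Ci; move/blwP/(_ i): br.
  rewrite !inE Ci andbT ltnNge ltnW // => /(_ _)/negP; apply=> //.
  by apply: contraTneq lt_i => ->; rewrite ltnn.
pose v := \sum_l \sum_C (ecoef (u 0 l) C)%:A *: nf (C, l).
have v0 : v = 0.
  apply: Fa.
    apply/layeredP; apply: onrow_sum => l _; apply: onrow_sum => C _; apply: onrowZ.
    by apply/layeredP; case: (Hnf (C, l)).
  rewrite -u0 [u in RHS]row_mono_sum !linear_sum; apply: eq_bigr => l _.
  rewrite !linear_sum; apply: eq_bigr => C _; have [_ e _ _] := Hnf (C, l).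
  by rewrite [LHS]linearZ [RHS]linearZ; congr (_ *: _).
have: ecoef (v 0 j) A = ecoef (u 0 j) A.
  rewrite summxE ecoef_sum (bigD1 j) //= summxE ecoef_sum (bigD1 A) //=.
  have [_ _ /(_ bA)-> _] := Hnf (A, j).
  rewrite mxE mulr_algl ecoefZ ecoef_mono !eqxx mulr1 -[RHS]addr0 -addrA; congr (_ + _).
  have zero l' C : (C, l') <> (A, j) ->
      ecoef (((ecoef (u 0 l') C)%:A *: nf (C, l')) 0 j) A = 0.
    move=> ne; rewrite mxE mulr_algl ecoefZ.
    have [->|nzC] := eqVneq (ecoef (u 0 l') C) 0; first by rewrite mul0r.
    have [//|ltC] := ld (C, l') nzC; have [_ _ hb hn] := Hnf (C, l').
    have [bC|nC] := boolP (blw (w l') C).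
      rewrite hb // ecoef_mono; case: andP => [[/eqP eA /eqP ej]|_]; last by rewrite mulr0.
      by case: ne; rewrite eA ej.
    (* If [e_A] occurred in the normal form of [(C, l')], then [A] would be lexicographically
       smaller than [C]. The order refines the lexicographic one, so [(A, j)] would precede
       [(C, l')], although it is the leading monomial. *)
    apply/eqP; rewrite mulf_eq0; apply/orP; right; apply/negPn/negP => /(hn nC) lexA.
    exact: lt_irr (lt_tr _ _ _ ltC (lex _ _ j l' lexA)).
  rewrite big1 ?add0r => [|C /eqP nC]; last by apply: zero => -[].
  rewrite big1 // => l /eqP nl; rewrite summxE ecoef_sum big1 // => C _.
  by apply: zero => -[].
by rewrite v0 mxE ecoef0 => e; rewrite -e eqxx in nz.
Qed.

End Groebner.

(** The type [X n] varies with [n], as for matrices or maps between consecutive terms of complexes.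
    [I] is the condition under which the next term can be found, [R] the equation linking
    neighbours. *)
Lemma dependent_choice_nat (X : nat -> Type) (I : forall n, X n -> Prop)
    (R : forall n, X n -> X n.+1 -> Prop) x0 :
  I 0%N x0 ->
  (forall n x, I n x -> exists y, I n.+1 y /\ R n x y) ->
  exists s : forall n, X n,
    [/\ s 0%N = x0, forall n, I n (s n) & forall n, R n (s n) (s n.+1)].
Proof.
move=> Ix0 step.
pose next n (x : {x | I n x}) : {y : X n.+1 | I n.+1 y} :=
  let y := constructive_indefinite_description _ (step n (sval x) (svalP x)) in
  exist _ (sval y) (svalP y).1.
pose s := fix s n : {x | I n x} :=
  if n is m.+1 then next m (s m) else exist _ x0 Ix0.
exists (fun n => sval (s n)); split=> // n; first exact: svalP.
exact: (svalP (constructive_indefinite_description _ (step n (sval (s n)) (svalP (s n))))).2.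
Qed.

(** * Existence of linear resolutions and the mapping cone *)

Section Resolutions.
Variables (k : fieldType) (c : nat).
Local Notation E := (extalg k c).

(** The ambient module belongs to the state because it changes from the given module to a free
    module, then to the next one; bundled like this, taking syzygies can be iterated. *)
Record system_state := SystemState {
  st_mod : lmodType E;
  st_rk : nat;
  st_w : 'I_st_rk -> 'I_c;
  st_gen : 'I_st_rk -> st_mod;
  st_triangular : triangular st_w st_gen;
  st_free : layered_free st_w st_gen }.

Record syzygy_data (s : system_state) := SyzygyData {
  sd_rk : nat;
  sd_w : 'I_sd_rk -> 'I_c;
  sd_gen : 'I_sd_rk -> 'rV[E]_(st_rk s);
  sd_triangular : triangular sd_w sd_gen;
  sd_free : layered_free sd_w sd_gen;
  sd_ker : forall u, eval (@st_gen s) u = 0 <-> exists v, u = eval sd_gen v;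
  sd_linear : forall q, onrow (fun A _ => #|A| == 1%N) (sd_gen q) }.

Lemma syzygy_data_inhabited s : inhabited (syzygy_data s).
Proof.
have [n [w [g [Tg Fg kg lg]]]] := syz_system (@st_triangular s) (@st_free s).
exact: (inhabits (SyzygyData Tg Fg kg lg)).
Qed.

Definition syzygies (s : system_state) : syzygy_data s :=
  epsilon (syzygy_data_inhabited s) (fun=> True).

Definition next_state s : system_state :=
  SystemState (@sd_triangular _ (syzygies s)) (@sd_free _ (syzygies s)).

Lemma linear_resolution_exists (N : lmodType E) (deg : nat -> N -> Prop) (P : N -> Prop) d :
  linear_system deg P d -> exists (G : gcomplex k c) (g : 'I_(gc_rk G 0%N) -> N),
    graded_resolution deg P g /\ linear_complex d G.
Proof.
case=> n [w [a [Ta Fa da Pa]]]; pose st i := iter i next_state (SystemState Ta Fa).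
pose D s : 'M[E]_(st_rk (next_state s), st_rk s) := \matrix_q @sd_gen _ (syzygies s) q.
have DE s v : v *m D s = eval (@sd_gen _ (syzygies s)) v.
  by rewrite -eval_rows; apply: eq_bigr => q _; rewrite rowK.
pose G := @GComplex k c (fun i => st_rk (st i)) (fun i _ => (i + d)%N) (fun i => D (st i)).
exists G, a; split=> //; split=> //.
- move=> i r; have := @sd_linear _ (syzygies (st i)) r.
  rewrite /= rowK => h j A /h/eqP->; by rewrite addSn.
- move=> u; rewrite -[eval a]/(eval (@st_gen (st 0%N))) (sd_ker (syzygies (st 0%N))).
  by split=> -[v ->]; exists v; rewrite DE.
move=> i u; rewrite -[X in _ <-> X]/(exists v, u = v *m D (st i.+1)) DE.
rewrite -[eval _ u]/(eval (@st_gen (st i.+1)) u) (sd_ker (syzygies (st i.+1))).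
by split=> -[v ->]; exists v; rewrite DE.
Qed.

Lemma eval_split_case (N : lmodType E) m n (g : 'I_m -> N) (h : 'I_n -> N) u :
  eval (split_case g h) u = eval g (lsubmx u) + eval h (rsubmx u).
Proof.
rewrite /eval big_split_ord; congr (_ + _); apply: eq_bigr => i _.
  by rewrite split_case_l mxE.
by rewrite split_case_r mxE.
Qed.

Lemma homogeneous_row_mx m n (dg : 'I_m -> nat) (dg' : 'I_n -> nat) d (u : 'rV[E]_m) (v : 'rV[E]_n) :
  homogeneous dg d u -> homogeneous dg' d v ->
  homogeneous (split_case dg dg') d (row_mx u v).
Proof.
move=> hu hv j A; rewrite mxE /split_case; case: (split j) => i; [exact: hu | exact: hv].
Qed.

Lemma lift_homogeneous (N : lmodType E) (deg : nat -> N -> Prop) n (dg : 'I_n -> nat) (g : 'I_n -> N) m x :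
  is_graded deg -> (forall j, deg (dg j) (g j)) -> deg m x -> (exists u, x = eval g u) ->
  exists2 u, homogeneous dg m u & x = eval g u.
Proof.
move=> degP hg dx [u def_x]; exists (hcomp dg m u); first exact: hcomp_homogeneous.
by rewrite (hcomp_eval degP) // -def_x.
Qed.

(** The graded horseshoe construction. Choosing every lift homogeneous is what ties the entries of
    [tau] to the degrees of the two linear complexes, and so yields minimality. *)
Lemma horseshoe (N N'' : lmodType E) (quo : {linear N -> N''}) (deg : nat -> N -> Prop)
    (P : N -> Prop) d (G' G'' : gcomplex k c) (g' : 'I_(gc_rk G' 0%N) -> N)
    (g'' : 'I_(gc_rk G'' 0%N) -> N'') :
  is_graded deg -> (forall x, quo x = 0 <-> P x) ->
  graded_resolution deg P g' -> minimal_complex G' -> linear_complex d G' ->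
  graded_resolution (fun n y => exists2 x, deg n x & y = quo x) (fun=> True) g'' ->
  minimal_complex G'' -> linear_complex d.+1 G'' ->
  exists tau (g : 'I_(gc_rk G'' 0%N) -> N),
    [/\ shifted_map tau, forall j, quo (g j) = g'' j,
        @graded_resolution _ _ N deg (fun _ => True) (mapping_cone tau) (split_case g' g)
      & minimal_complex (mapping_cone tau)].
Proof.
move=> degP quo0 [hG' dG' Pg' kg' kG'] minG' linG' [hG'' dG'' Pg'' kg'' kG''] minG'' linG''.
have [g Hg] : exists g : 'I_(gc_rk G'' 0%N) -> N, forall j, deg (gc_dg j) (g j) /\ g'' j = quo (g j).
  have h j : {x | deg (gc_dg j) x /\ g'' j = quo x}.
    by apply: constructive_indefinite_description; have [x] := dG'' j; exists x.
  by exists (fun j => sval (h j)) => j; apply: (svalP (h j)).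
have quog u : quo (eval g u) = eval g'' u.
  by rewrite eval_map; apply: eq_bigr => j _; rewrite /= -(Hg j).2.
pose X i := 'M[E]_(gc_rk G'' i.+1, gc_rk G' i).
(* The invariant [I] says that the next equation [R] is solvable row by row; the sign in [R] is that
   of the shifted differential. *)
pose I i (t : X i) := (forall r, homogeneous (@gc_dg _ _ G' i) (gc_dg r) (row r t)) /\
  exists V, gc_d G'' i.+1 *m t = V *m gc_d G' i.
pose R i (t : X i) (t' : X i.+1) := t' *m gc_d G' i = - gc_d G'' i.+1 *m t.
have row_ex i m (Z : 'M[E]_(m, gc_rk G' i)) : (forall r, exists v, row r Z = v *m gc_d G' i) ->
    exists V, Z = V *m gc_d G' i.
  move=> h; have [v Hv] : exists v : 'I_m -> 'rV[E]_(gc_rk G' i.+1), forall r, row r Z = v r *m gc_d G' i.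
    exact: (@fin_all_exists _ _ (fun r v => row r Z = v *m gc_d G' i)).
  by exists (\matrix_r v r); apply/row_matrixP => r; rewrite row_mul rowK.
(* The lifts [g] send a relation on [g''] into [P] rather than to zero; [t0] writes minus that value
   in the generators [g']. *)
have [t0 [It0 ht0]] : exists t0 : X 0%N, I 0%N t0 /\ forall u, eval g' (u *m t0) = - eval g (u *m gc_d G'' 0%N).
  have [v Hv] : exists v : 'I_(gc_rk G'' 1%N) -> 'rV[E]_(gc_rk G' 0%N), forall r,
     homogeneous (@gc_dg _ _ G' 0%N) (gc_dg r) (v r) /\ - eval g (row r (gc_d G'' 0%N)) = eval g' (v r).
    apply: (@fin_all_exists _ _ (fun r v => homogeneous (@gc_dg _ _ G' 0%N) (gc_dg r) v /\
       - eval g (row r (gc_d G'' 0%N)) = eval g' v)) => r.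
    have [||v hv e] := @lift_homogeneous _ _ _ _ g' (gc_dg r) (- eval g (row r (gc_d G'' 0%N))) degP dG'.
      rewrite -linearN; apply: (eval_deg degP (fun j => (Hg j).1)).
      by apply: homogeneousN; apply: hG''.
    - apply/Pg'/quo0; rewrite linearN /= quog; apply/eqP; rewrite oppr_eq0; apply/eqP/kg''.
      by exists (delta_mx 0 r); rewrite -rowE.
    by exists v.
  pose t0 : X 0%N := \matrix_r v r.
  have et0 u : eval g' (u *m t0) = - eval g (u *m gc_d G'' 0%N).
    rewrite !eval_mulmx [in RHS]/eval -sumrN; apply: eq_bigr => r _.
    by rewrite rowK -scalerN; congr (_ *: _); rewrite -(Hv r).2.
  exists t0; split=> //; split=> [r|]; first by rewrite rowK; case: (Hv r).
  apply: row_ex => r; apply/kg'; rewrite row_mul et0 -row_mul.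
  have -> : gc_d G'' 1 *m gc_d G'' 0%N = 0.
    apply/row_matrixP => i; rewrite row_mul row0; apply/kG''.
    by exists (delta_mx 0 i); rewrite -rowE.
  by rewrite row0 linear0 oppr0.
have [|tau [tau0 Itau Rtau]] := @dependent_choice_nat X I R t0 It0.
  move=> i t [ht [V eV]].
  have [v Hv] : exists v : 'I_(gc_rk G'' i.+2) -> 'rV[E]_(gc_rk G' i.+1), forall r,
     homogeneous (@gc_dg _ _ G' i.+1) (gc_dg r) (v r) /\ - row r (gc_d G'' i.+1 *m t) = v r *m gc_d G' i.
    apply: (@fin_all_exists _ _ (fun r v => homogeneous (@gc_dg _ _ G' i.+1) (gc_dg r) v /\
      - row r (gc_d G'' i.+1 *m t) = v *m gc_d G' i)) => r.
    have [||v hv e] := @lift_homogeneous _ _ _ _ _ (gc_dg r) (- row r (gc_d G'' i.+1 *m t))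
        (@homogeneous_graded k c _ (@gc_dg _ _ G' i)) (hG' i).
      apply: homogeneousN; rewrite row_mul.
      by apply: homogeneous_mulmx (hG'' _ r) _.
    - exists (- row r V); by rewrite eval_rows eV row_mul mulNmx.
    by exists v; rewrite -eval_rows.
  have e : (\matrix_r v r) *m gc_d G' i = - gc_d G'' i.+1 *m t.
    apply/row_matrixP => r; rewrite row_mul rowK -(Hv r).2 mulNmx.
    by rewrite [RHS]linearN.
  exists (\matrix_r v r); split=> //; split=> [r|]; first by rewrite rowK; case: (Hv r).
  apply: row_ex => r; apply/kG'; rewrite row_mul -mulmxA e mulNmx mulmxN mulmxA.
  have -> : row r (gc_d G'' i.+2) *m gc_d G'' i.+1 = 0.
    by apply/kG''; exists (delta_mx 0 r); rewrite -rowE.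
  by rewrite mul0mx oppr0.
have hom_tau i r : homogeneous (@gc_dg _ _ G' i) (gc_dg r) (row r (tau i)) by case: (Itau i).
have tauD i u : u *m tau i.+1 *m gc_d G' i = - (u *m gc_d G'' i.+1 *m tau i).
  by rewrite -mulmxA Rtau mulNmx mulmxN mulmxA.
have mapE i (u : 'rV_(gc_rk G' i.+1 + gc_rk G'' i.+1)) :
    u *m block_mx (gc_d G' i) 0 (tau i) (gc_d G'' i) =
    row_mx (lsubmx u *m gc_d G' i + rsubmx u *m tau i) (rsubmx u *m gc_d G'' i).
  by rewrite -[u in LHS]hsubmxK mul_row_block mulmx0 add0r.
exists tau, g; split.
- exact: Rtau.
- by move=> j; rewrite -(Hg j).2.
- split.
  + move=> i r; rewrite /= {2}/split_case -[r in row r _]splitK.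
    case: (split r) => j /=.
      rewrite rowKu row_row_mx; apply: homogeneous_row_mx; first exact: hG'.
      by rewrite row0; apply/homogeneousP; apply: onrow0.
    by rewrite rowKd row_row_mx; apply: homogeneous_row_mx.
  + move=> j; rewrite /= /split_case; case: (split j) => i; [exact: dG' | exact: (Hg i).1].
  + move=> x; split=> // _; have [u2 e2] := (Pg'' (quo x)).1 Logic.I.
    have /quo0/Pg'[u1 e1] : quo (x - eval g u2) = 0 by rewrite linearB /= quog e2 subrr.
    by exists (row_mx u1 u2); rewrite eval_split_case row_mxKl row_mxKr -e1 subrK.
  + move=> u; rewrite eval_split_case; split=> [u0|[v ->]]; last first.
      rewrite mapE row_mxKl row_mxKr linearD /= tau0 ht0 subrK.
      by apply/kg'; exists (lsubmx v).
    have /kg''[v2 e2] : eval g'' (rsubmx u) = 0.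
      have /quo0 e : P (eval g' (lsubmx u)) by apply/Pg'; exists (lsubmx u).
      by move/(congr1 quo): u0; rewrite linearD linear0 /= e add0r quog.
    have /kg'[v1 e1] : eval g' (lsubmx u - v2 *m tau 0%N) = 0.
      by rewrite linearB /= tau0 ht0 opprK -e2.
    exists (row_mx v1 v2); rewrite mapE row_mxKl row_mxKr -e1 subrK -e2.
    by rewrite hsubmxK.
  + move=> i u; rewrite mapE; split=> [u0|[v ->]]; last first.
      rewrite mapE row_mxKl row_mxKr mulmxDl tauD subrK.
      have -> : lsubmx v *m gc_d G' i.+1 *m gc_d G' i = 0 by apply/kG'; exists (lsubmx v).
      have -> : rsubmx v *m gc_d G'' i.+1 *m gc_d G'' i = 0 by apply/kG''; exists (rsubmx v).
      by rewrite row_mx0.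
    have /kG''[v2 e2] : rsubmx u *m gc_d G'' i = 0.
      by move/(congr1 rsubmx): u0; rewrite row_mxKr linear0.
    have /kG'[v1 e1] : (lsubmx u - v2 *m tau i.+1) *m gc_d G' i = 0.
      rewrite mulmxBl tauD opprK -e2.
      by move/(congr1 lsubmx): u0; rewrite row_mxKl linear0.
    exists (row_mx v1 v2); rewrite mapE row_mxKl row_mxKr -e1 subrK -e2.
    by rewrite hsubmxK.
move=> i r s; rewrite /= -[r]splitK -[s]splitK.
case: (split r) => r'; case: (split s) => s' /=.
- by rewrite block_mxEul.
- by rewrite block_mxEur mxE ecoef0.
(* The entries of [tau i] have degree 2, by linearity of both resolutions. *)
- rewrite block_mxEdl; apply/eqP/negPn/negP => nz.
  have := hom_tau i r' s' set0; rewrite mxE nz linG' linG'' cards0.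
  by move=> /(_ isT); lia.
- by rewrite block_mxEdr.
Qed.

End Resolutions.

(** * The Koszul complex *)

Section FreeModules.
Variables (S : comUnitRingType) (Idx : finType).
Local Notation L := {ffun Idx -> S^o}.
Implicit Types (x y : L) (Q : pred Idx).

Definition fdelta (m : Idx) : L := [ffun m' => (m' == m)%:R].

Definition lin (V : lmodType S) (v : Idx -> V) (x : L) : V := \sum_m x m *: v m.

Lemma lin_linear (V : lmodType S) (v : Idx -> V) : linear (lin v).
Proof.
move=> a x y; rewrite /lin scaler_sumr -big_split; apply: eq_bigr => m _ /=.
by rewrite !ffunE scalerDl scalerA.
Qed.

HB.instance Definition _ (V : lmodType S) (v : Idx -> V) :=
  GRing.isLinear.Build S L V *:%R (lin v) (lin_linear v).

Lemma linZ (V : lmodType S) (v : Idx -> V) a x : lin v (a *: x) = a *: lin v x.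
Proof. exact: linearZ. Qed.

Lemma linD (V : lmodType S) (v : Idx -> V) x y : lin v (x + y) = lin v x + lin v y.
Proof. exact: linearD. Qed.

Lemma linN (V : lmodType S) (v : Idx -> V) x : lin v (- x) = - lin v x.
Proof. exact: linearN. Qed.

Lemma linB (V : lmodType S) (v : Idx -> V) x y : lin v (x - y) = lin v x - lin v y.
Proof. exact: linearB. Qed.

Lemma lin_sum (V : lmodType S) (v : Idx -> V) I (r : seq I) (P : pred I) F :
  lin v (\sum_(i <- r | P i) F i) = \sum_(i <- r | P i) lin v (F i).
Proof. exact: linear_sum. Qed.

Lemma lin0 (V : lmodType S) (v : Idx -> V) : lin v 0 = 0.
Proof. exact: linear0. Qed.

Lemma lin_fdelta (V : lmodType S) (v : Idx -> V) m : lin v (fdelta m) = v m.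
Proof.
rewrite /lin (bigD1 m) //= big1 => [|i /negPf ni]; last by rewrite ffunE ni scale0r.
by rewrite ffunE eqxx scale1r addr0.
Qed.

Lemma lin_id x : lin fdelta x = x.
Proof.
apply/ffunP => m; rewrite /lin sum_ffunE (bigD1 m) //= big1 => [|i /negPf ni].
  by rewrite !ffunE eqxx addr0 -[_ *: _]/(x m * 1) mulr1.
by rewrite !ffunE eq_sym ni -[_ *: _]/(x i * 0) mulr0.
Qed.

Lemma fdelta_sum x : x = \sum_m x m *: fdelta m.
Proof. by rewrite -[LHS]lin_id. Qed.

Lemma linear_lin (V W : lmodType S) (v : Idx -> V) (h : {linear V -> W}) x :
  h (lin v x) = lin (fun m => h (v m)) x.
Proof. by rewrite linear_sum; apply: eq_bigr => m _; rewrite linearZ. Qed.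

Definition onf Q x := forall m, x m != 0 -> Q m.

Lemma onfP Q x : onf Q x <-> forall m, ~~ Q m -> x m = 0.
Proof.
split=> h m; first by move=> nQ; apply/eqP; apply: contraR nQ; apply: h.
by move=> nz; apply: contraNT nz => /h->.
Qed.

Lemma onf0 Q : onf Q 0. Proof. by move=> m; rewrite ffunE eqxx. Qed.

Lemma onfD Q x y : onf Q x -> onf Q y -> onf Q (x + y).
Proof. by rewrite !onfP => hx hy m nQ; rewrite ffunE hx // hy // addr0. Qed.

Lemma onfZ Q a x : onf Q x -> onf Q (a *: x).
Proof. by rewrite !onfP => hx m nQ; rewrite ffunE hx // scaler0. Qed.

Lemma onfN Q x : onf Q x -> onf Q (- x).
Proof. by rewrite -scaleN1r; apply: onfZ. Qed.

Lemma onf_sum Q I (r : seq I) (P : pred I) F :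
  (forall i, P i -> onf Q (F i)) -> onf Q (\sum_(i <- r | P i) F i).
Proof. by move=> h; elim/big_ind: _ => //; [exact: onf0 | exact: onfD]. Qed.

Lemma onfW Q Q' x : (forall m, Q m -> Q' m) -> onf Q x -> onf Q' x.
Proof. by move=> h hx m /hx/h. Qed.

Lemma onfI Q Q' x : onf Q x -> onf Q' x -> onf (predI Q Q') x.
Proof. by move=> h h' m nz /=; rewrite h ?h'. Qed.

Lemma onf_fdelta (Q : pred Idx) m : Q m -> onf Q (fdelta m).
Proof. by move=> Qm m'; rewrite ffunE; case: (m' =P m) => [->//|_]; rewrite eqxx. Qed.

Lemma eq_lin (V : lmodType S) (v v' : Idx -> V) Q x :
  (forall m, Q m -> v m = v' m) -> onf Q x -> lin v x = lin v' x.
Proof.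
move=> h hx; apply: eq_bigr => m _.
by have [->|/hx/h->//] := eqVneq (x m) 0; rewrite !scale0r.
Qed.

Lemma lin0_on (V : lmodType S) (v : Idx -> V) Q x :
  (forall m, Q m -> v m = 0) -> onf Q x -> lin v x = 0.
Proof.
by move=> h /(eq_lin h)->; apply: big1 => m _; rewrite scaler0.
Qed.

Lemma lin_ind (V : lmodType S) (v : Idx -> V) Q (P : V -> Prop) x :
  P 0 -> (forall u w, P u -> P w -> P (u + w)) -> (forall a u, P u -> P (a *: u)) ->
  (forall m, Q m -> P (v m)) -> onf Q x -> P (lin v x).
Proof.
move=> P0 PD PZ PQ hx; rewrite /lin; elim/big_ind: _ => // m _.
by have [->|/hx/PQ/PZ//] := eqVneq (x m) 0; rewrite scale0r.
Qed.

Lemma onf_lin (v : Idx -> L) Q Q' x :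
  (forall m, Q m -> onf Q' (v m)) -> onf Q x -> onf Q' (lin v x).
Proof.
move=> h; apply: lin_ind => //; [exact: onf0 | exact: onfD | by move=> *; exact: onfZ].
Qed.

Lemma onf_ind Q (P : L -> Prop) x :
  P 0 -> (forall u w, P u -> P w -> P (u + w)) -> (forall a u, P u -> P (a *: u)) ->
  (forall m, Q m -> P (fdelta m)) -> onf Q x -> P x.
Proof. by move=> P0 PD PZ PQ hx; rewrite -[x]lin_id; apply: lin_ind hx. Qed.

Definition res Q x : L := [ffun m => if Q m then x m else 0].

Lemma res_linear Q : linear (res Q).
Proof.
by move=> a x y; apply/ffunP => m; rewrite !ffunE; case: ifP => // _; rewrite scaler0 addr0.
Qed.

HB.instance Definition _ Q := GRing.isLinear.Build S L L *:%R (res Q) (res_linear Q).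

Lemma onf_res Q x : onf Q (res Q x).
Proof. by apply/onfP => m /negPf nQ; rewrite ffunE nQ. Qed.

Lemma onf_res2 Q Q' x : onf Q' x -> onf Q' (res Q x).
Proof. by rewrite !onfP => h m nQ; rewrite ffunE h // if_same. Qed.

Lemma res_id Q x : onf Q x -> res Q x = x.
Proof. by rewrite onfP => h; apply/ffunP => m; rewrite ffunE; case: ifPn => // /h. Qed.

Lemma res_out Q Q' x : (forall m, Q' m -> ~~ Q m) -> onf Q' x -> res Q x = 0.
Proof.
rewrite onfP => h hx; apply/ffunP => m; rewrite !ffunE; case: ifPn => // Qm.
by apply: hx; apply: contraL Qm => /h.
Qed.

Lemma res_split Q x : x = res Q x + res (predC Q) x.
Proof. by apply/ffunP => m; rewrite !ffunE /=; case: (Q m); rewrite ?addr0 ?add0r. Qed.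

Lemma res_lin Q (v : Idx -> L) x : res Q (lin v x) = lin (fun m => res Q (v m)) x.
Proof. exact: linear_lin. Qed.

End FreeModules.

(** * The Koszul complex of a regular sequence with coefficients in a free module *)

Section Koszul.
Variables (S : comUnitRingType) (c : nat) (f : 'I_c -> S) (J : finType).
Local Notation Idx := ({set 'I_c} * J)%type.
Local Notation L := {ffun Idx -> S^o}.
Implicit Types (A I : {set 'I_c}).

(** Adding a new largest element is the one insertion that costs no Koszul sign, so the identities
    below are proved along this induction. *)
Lemma set_ind_max (P : {set 'I_c} -> Prop) A : P set0 ->
  (forall (i : 'I_c) I, blw i I -> i \notin I -> P I -> P (i |: I)) -> P A.
Proof.
move=> P0 PS; elim: {A}#|A| {-2}A (leqnn #|A|) => [|n IHn] A.
  by rewrite leqn0 cards_eq0 => /eqP->.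
move=> le_n; have [/blwP b0|/max_element[r [Ar bAr _]]] := boolP (blw 0%N A).
  suff -> : A = set0 by []; apply/setP => i; rewrite inE; apply/negP => /b0.
  by rewrite ltn0.
rewrite -(setD1K Ar); apply: PS; rewrite ?inE ?eqxx //.
by apply: IHn; move: le_n; rewrite (cardsD1 r) Ar.
Qed.

Lemma blw_notin (i : 'I_c) A : blw i A -> i \notin A.
Proof. by move/blwP => bA; apply/negP => /bA; rewrite ltnn. Qed.

(** Counting the elements above [i] amounts to writing the Koszul basis with decreasing indices,
    opposite to [emon]; a new largest index then enters on the left without a sign. *)
Definition ksign (i : 'I_c) A : S := (-1) ^+ #|[set i' in A | (i < i')%N]|.

Definition kapv (m : Idx) : L :=
  \sum_(i in m.1) (ksign i m.1 * f i) *: fdelta S (m.1 :\ i, m.2).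

Notation kap := (lin kapv).

(* Inserting [i] is only used on sets whose elements are all smaller. *)
Definition insv (i : 'I_c) (m : Idx) : L := fdelta S (i |: m.1, m.2).

Lemma kapv0 j : kapv (set0, j) = 0.
Proof. by rewrite /kapv big_set0. Qed.

(** Left multiplication by [e_i] is a homotopy for [f_i] on the Koszul complex, the model for the
    homotopies on each layer. *)
Lemma kapv_ins (i : 'I_c) A j : blw i A ->
  kapv (i |: A, j) = f i *: fdelta S (A, j) - lin (insv i) (kapv (A, j)).
Proof.
have kE B : kapv (B, j) = \sum_(i in B) (ksign i B * f i) *: fdelta S (B :\ i, j) by [].
move=> bA; have nA := blw_notin bA; rewrite !kE [LHS](big_setU1 _ nA) /=.
have -> : ksign i (i |: A) = 1.
  rewrite /ksign (_ : [set _ in _ | _] = set0) ?cards0 //.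
  apply/setP => i'; rewrite !inE; apply/andP => -[/predU1P[->|]]; first by rewrite ltnn.
  by move/(blwP _ _ bA) => lt1 lt2; move: (ltn_trans lt1 lt2); rewrite ltnn.
rewrite setU1K // mul1r [lin _ _]linear_sum -sumrN.
apply: (f_equal (fun z => _ + z)); apply: eq_bigr => i' Ai'.
have -> : ksign i' (i |: A) = - ksign i' A.
  rewrite /ksign (_ : [set x in i |: A | (i' < x)%N] = i |: [set x in A | (i' < x)%N]).
    by rewrite cardsU1 !inE (negPf nA) /= exprS mulN1r.
  apply/setP => x; rewrite !inE; case: eqP => //= ->.
  exact: (blwP _ _ bA).
have -> : (i |: A) :\ i' = i |: A :\ i'.
  apply/setP => x; rewrite !inE; case: (x =P i') => [->|] //=.
  by have [e|] := eqVneq i' i; first by rewrite -e Ai' in nA.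
by rewrite linearZ /= lin_fdelta mulNr scaleNr.
Qed.

Lemma kapv_supp (m : Idx) :
  onf (fun m' : Idx => [&& m'.1 \subset m.1, #|m'.1|.+1 == #|m.1| & m'.2 == m.2]) (kapv m).
Proof.
apply: onf_sum => i Ai; apply/onfZ/onf_fdelta; by rewrite /= subD1set (cardsD1 i m.1) Ai add1n !eqxx.
Qed.

Lemma kap_ins (i : 'I_c) x : onf (fun m => blw i m.1) x ->
  kap (lin (insv i) x) = f i *: x - lin (insv i) (kap x).
Proof.
move=> hx; pattern x; apply: onf_ind hx => [|u w eu ew|a u eu|[I j] /= bI].
- by rewrite !lin0 scaler0 subr0.
- by rewrite !linD eu ew scalerDr opprD addrACA.
- by rewrite !linZ eu scalerBr !scalerA [a * _]mulrC.
by rewrite !lin_fdelta kapv_ins.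
Qed.

Lemma kap_kapv m : kap (kapv m) = 0.
Proof.
case: m => A j; apply: (@set_ind_max (fun A => kap (kapv (A, j)) = 0)) => [|i I bI nI IH].
  by rewrite kapv0 lin0.
rewrite kapv_ins // linB linZ lin_fdelta kap_ins ?IH.
  by rewrite lin0 subr0 subrr.
apply: (onfW _ (@kapv_supp (I, j))) => m /and3P[sub_m _ _].
by apply/blwP => i' mi'; apply: (blwP _ _ bI); apply: (subsetP sub_m).
Qed.

Lemma kap_kap x : kap (kap x) = 0.
Proof.
have hx : onf predT x by [].
pattern x; apply: onf_ind hx => [|u w eu ew|a u eu|m _].
- by rewrite !lin0.
- by rewrite !linD eu ew addr0.
- by rewrite !linZ eu scaler0.
by rewrite lin_fdelta kap_kapv.
Qed.

Lemma ideal_first0 s : ideal_gen (first_elts f 0) s -> s = 0.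
Proof.
move=> h; apply: (@setmul_ind _ S^o _ _ (fun s => s = 0) s _ _ _ h) => //.
  by move=> u v -> ->; rewrite addr0.
by move=> a u _ [j []].
Qed.

Lemma ideal_firstS (i : 'I_c) s : ideal_gen (first_elts f i.+1) s ->
  exists b, ideal_gen (first_elts f i) (s + f i * b).
Proof.
move=> h; apply: (@setmul_ind _ S^o _ _ (fun s => exists b, ideal_gen (first_elts f i) (s + f i * b)) s _ _ _ h).
- by exists 0; rewrite mulr0 addr0; apply: (@setmul0 _ S^o).
- move=> u v [b hb] [d hd]; exists (b + d); rewrite mulrDr addrACA.
  exact: (@setmulD _ S^o).
move=> a _ _ [j [le_j ->]]; have [e|ne] := eqVneq j i.
  exists (- a); rewrite e -[a *: _]/(a * f i) mulrN mulrC subrr; apply: (@setmul0 _ S^o).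
exists 0; rewrite mulr0 addr0; apply: (@setmul1 _ S^o) => //; exists j; split=> //.
by rewrite ltn_neqAle -ltnS le_j andbT; apply: contra_neq ne => /val_inj.
Qed.

Lemma kap_ideal p x m : onf (fun m => blw p m.1) x ->
  ideal_gen (first_elts f p) ((kap x) m).
Proof.
move=> hx; pattern (kap x); apply: lin_ind hx.
- by rewrite ffunE; apply: (@setmul0 _ S^o).
- by move=> u w hu hw; rewrite ffunE; apply: (@setmulD _ S^o).
- by move=> a u hu; rewrite ffunE; apply: (@submod_genZ _ S^o).
move=> m' /blwP bm'; rewrite /kapv sum_ffunE; apply: (@setmul_sum _ S^o) => i mi.
rewrite !ffunE -[_ *: _]/(_ * _) mulrC mulrA; apply: (@setmul1 _ S^o) => //.
by exists i; split=> //; apply: bm'.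
Qed.

Definition delv (i : 'I_c) (m : Idx) : L := fdelta S (m.1 :\ i, m.2).

Lemma ins_del (i : 'I_c) x : onf (fun m => blw i m.1) x ->
  lin (delv i) (lin (insv i) x) = x.
Proof.
move=> hx; pattern x; apply: onf_ind hx => [|u w eu ew|a u eu|[I j] /= bI].
- by rewrite !lin0.
- by rewrite !linD eu ew.
- by rewrite !linZ eu.
by rewrite !lin_fdelta /delv /= setU1K ?blw_notin.
Qed.

Lemma onf_ins (i : 'I_c) (Z : pred J) x : onf (fun m => (m.2 \in Z) && blw i m.1) x ->
  onf (fun m => [&& m.2 \in Z, blw i.+1 m.1 & i \in m.1]) (lin (insv i) x).
Proof.
apply: onf_lin => -[I j] /= /andP[Zj bI]; apply: onf_fdelta; rewrite /= Zj setU11 andbT.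
by apply: blwU; [apply/blwP => i'; rewrite inE => /eqP-> | apply: blwW bI].
Qed.

Lemma ins_split (i : 'I_c) (Z : pred J) x :
  onf (fun m => (m.2 \in Z) && blw i.+1 m.1) x -> exists x0 x1,
  [/\ onf (fun m => (m.2 \in Z) && blw i m.1) x0,
      onf (fun m => (m.2 \in Z) && blw i m.1) x1 & x = x0 + lin (insv i) x1].
Proof.
move=> hx; pattern x; apply: onf_ind hx.
- by exists 0, 0; split; rewrite ?lin0 ?addr0 //; apply: onf0.
- move=> u w [u0 [u1 [h0 h1 ->]]] [w0 [w1 [k0 k1 ->]]].
  by exists (u0 + w0), (u1 + w1); split; rewrite ?linD 1?addrACA //; apply: onfD.
- move=> a u [u0 [u1 [h0 h1 ->]]]; exists (a *: u0), (a *: u1).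
  by split; rewrite ?linZ ?scalerDr //; apply: onfZ.
move=> [I j] /= /andP[Zj bI]; have bD : blw i (I :\ i).
  apply/blwP => i' /setD1P[ni /(blwP _ _ bI)]; rewrite ltnS leq_eqVlt => /predU1P[e|//].
  by case/eqP: ni; apply: val_inj.
have [Ii|nI] := boolP (i \in I).
  exists 0, (fdelta S (I :\ i, j)); split; first exact: onf0.
    by apply: onf_fdelta; rewrite /= Zj.
  by rewrite lin_fdelta add0r /insv /= setD1K.
exists (fdelta S (I, j)), 0; split; last by rewrite lin0 addr0.
  apply: onf_fdelta; rewrite /= Zj; apply/blwP => i' Ii'; apply: (blwP _ _ bD).
  by rewrite !inE Ii' andbT; apply: contraNneq nI => <-.
exact: onf0.
Qed.

Lemma onf_kap p (Z : pred J) x : onf (fun m => (m.2 \in Z) && blw p m.1) x ->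
  onf (fun m => (m.2 \in Z) && blw p m.1) (kap x).
Proof.
apply: onf_lin => m /andP[Zm bm]; apply: (onfW _ (@kapv_supp m)) => m' /and3P[sub _ /eqP->].
by rewrite Zm; apply/blwP => i mi; apply: (blwP _ _ bm); apply: (subsetP sub).
Qed.

Hypothesis f_regular : regular_seq f.

(** Writing [x = x0 + e_i x1] splits the cycle condition into [kap x1 = 0] and
    [kap x0 + f_i x1 = 0]. Regularity moves the coordinates of [x1] at [set0] into the smaller
    ideal, so [x1] is a boundary by induction and can be removed from [x]. The hypothesis at [set0]
    describes the boundaries in Koszul degree zero, so all degrees are treated together. *)
Lemma koszul_exact p (Z : pred J) x : (p <= c)%N ->
  onf (fun m => (m.2 \in Z) && blw p m.1) x -> kap x = 0 ->
  (forall j, ideal_gen (first_elts f p) (x (set0, j))) ->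
  exists2 y, onf (fun m => (m.2 \in Z) && blw p m.1) y & x = kap y.
Proof.
elim: p x => [|p IHp] x le_pc hx kx0 x_id.
  exists 0; first exact: onf0.
  rewrite lin0; apply/ffunP => -[A j]; rewrite [RHS]ffunE.
  have [->|nA] := eqVneq A set0; first exact: ideal_first0.
  apply: ((onfP _ _).1 hx); apply/negP => /andP[_ /blwP b0].
  by case/set0Pn: nA => i /b0.
pose i := Ordinal le_pc; have le_pc' := ltnW le_pc.
have [x0 [x1 [hx0 hx1 def_x]]] := @ins_split i Z x hx.
have [hx0' hx1'] : onf (fun m => blw i m.1) x0 /\ onf (fun m => blw i m.1) x1.
  by split; [apply: (onfW _ hx0) | apply: (onfW _ hx1)] => m /andP[].
have hk1 := onf_kap hx1.
have e : kap x0 + f i *: x1 = lin (insv i) (kap x1).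
  by move: kx0; rewrite def_x linD kap_ins // addrA => /eqP; rewrite subr_eq0 => /eqP.
have r0 : res (fun m : Idx => i \notin m.1) (lin (insv i) (kap x1)) = 0.
  by apply: res_out (onf_ins hk1) => m /and3P[_ _ ->].
have e0 : kap x0 + f i *: x1 = 0.
  rewrite -r0 -e res_id //; apply: onfD.
    by apply: (onfW _ (onf_kap hx0)) => m /andP[_ /blw_notin].
  by apply/onfZ; apply: (onfW _ hx1) => m /andP[_ /blw_notin].
have k1 : kap x1 = 0.
  rewrite -[LHS](@ins_del i); first by rewrite -e e0 lin0.
  by apply: (onfW _ hk1) => m /andP[].
have x1_id j : ideal_gen (first_elts f p) (x1 (set0, j)).
  apply: (f_regular.1 i); move/ffunP/(_ (set0, j)): e0; rewrite !ffunE => /eqP.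
  rewrite addrC addr_eq0 => /eqP e1; rewrite [_ * _]e1 -mulN1r.
  apply: (@submod_genZ _ S^o); exact: (@kap_ideal p).
have [y0 hy0 def_y0] := IHp x1 le_pc' hx1 k1 x1_id.
(* A preimage of [x1] may be changed freely at [set0], where [kap] vanishes. The value [b j] is
   chosen there so that the cycle left after removing [x1] again has its coordinate in the smaller
   ideal. *)
have [b Hb] : exists b : J -> S, forall j, (j \notin Z -> b j = 0) /\
    ideal_gen (first_elts f p) (x (set0, j) + f i * b j).
  apply: (@fin_all_exists _ _ (fun j b => (j \notin Z -> b = 0) /\
    ideal_gen (first_elts f p) (x (set0, j) + f i * b))) => j.
  have [Zj|nZj] := boolP (j \in Z).
    by have [b hb] := @ideal_firstS i _ (x_id j); exists b.
  exists 0; split=> //; rewrite ((onfP _ _).1 hx) ?negb_and ?nZj // mulr0 addr0.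
  exact: (@setmul0 _ S^o).
pose y1 : L := res (fun m : Idx => m.1 != set0) y0 + [ffun m : Idx => if m.1 == set0 then b m.2 else 0].
have hy1 : onf (fun m => (m.2 \in Z) && blw p m.1) y1.
  apply: onfD; first exact: onf_res2.
  move=> [A j]; rewrite ffunE /=; case: (A =P set0) => [-> nz|_]; last by rewrite eqxx.
  rewrite (_ : j \in Z); first by apply/blwP => i'; rewrite inE.
  by apply: contraNT nz => nZ; rewrite (Hb j).1.
have ky1 : kap y1 = x1.
  have kz w : onf (fun m : Idx => m.1 == set0) w -> kap w = 0.
    by apply: lin0_on => -[A j] /= /eqP->; apply: kapv0.
  rewrite def_y0 [in RHS](res_split (fun m : Idx => m.1 != set0) y0) !linD.
  rewrite [X in _ + X]kz ?[X in _ = _ + X]kz //.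
    by apply: (onfW _ (@onf_res _ _ _ _)) => m /negPn.
  by move=> [A j]; rewrite ffunE /=; case: (A =P set0); rewrite ?eqxx.
have hy1' : onf (fun m => blw i m.1) y1 by apply: (onfW _ hy1) => m /andP[].
have def_x1 : x + kap (lin (insv i) y1) = x0 + f i *: y1.
  by rewrite kap_ins // ky1 def_x -addrA [lin _ _ + _]addrC subrK.
have [||j|y2 hy2 def_y2] := IHp (x0 + f i *: y1) le_pc'.
- by apply: onfD => //; apply: onfZ.
- by rewrite -def_x1 linD kap_kap kx0 addr0.
- have -> : (x0 + f i *: y1) (set0, j) = x (set0, j) + f i * b j; last by case: (Hb j).
  have y1j : y1 (set0, j) = b j by rewrite !ffunE /= !eqxx add0r.
  have x0j : x (set0, j) = x0 (set0, j).
    rewrite def_x ffunE ((onfP _ _).1 (onf_ins hx1)) ?addr0 //.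
    by rewrite /= inE !andbF.
  by rewrite [LHS]ffunE [(f i *: y1) _]ffunE y1j x0j.
exists (y2 - lin (insv i) y1).
  apply: onfD; last first.
    by apply/onfN; apply: (onfW _ (@onf_ins i Z y1 hy1)) => m /and3P[-> ->].
  by apply: (onfW _ hy2) => m /andP[-> bm]; apply: blwW bm.
by rewrite linB -def_y2 -def_x1 addrK.
Qed.

End Koszul.

(** * Extending homotopies over an acyclic complex of free modules *)

Section ExtendHomotopy.
Variables (S : comUnitRingType) (Idx : finType) (dg : Idx -> nat) (Om : pred Idx).
Local Notation L := {ffun Idx -> S^o}.
Variable Dv : Idx -> L.
Local Notation D := (lin Dv).

Definition is_complex := forall m, Om m ->
  onf (fun m' => Om m' && ((dg m').+1 == dg m)) (Dv m) /\ D (Dv m) = 0.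

(** Exactness in positive degrees only, stated for inhomogeneous elements: the condition in degree 0
    sets the zeroth homology aside. *)
Definition acyclic := forall x, onf Om x -> D x = 0 ->
  (forall m, dg m = 0%N -> x m = 0) -> exists2 y, onf Om y & x = D y.

Definition homotopy_on (Q : pred Idx) (g : S) (s : Idx -> L) := forall m, Om m -> Q m ->
  onf (fun m' => Om m' && (dg m' == (dg m).+1)) (s m) /\
  D (s m) + lin s (Dv m) = g *: fdelta S m.

Hypothesis cD : is_complex.

Lemma D_res n x : onf Om x ->
  D (res (fun m => dg m == n.+1) x) = res (fun m => dg m == n) (D x).
Proof.
move=> hx; pattern x; apply: onf_ind hx => [|u w eu ew|a u eu|m Om_m].
- by rewrite linear0 lin0 linear0.
- by rewrite linearD /= !linD linearD /= eu ew.
- by rewrite linearZ /= !linZ linearZ /= eu.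
have [hD _] := cD Om_m; rewrite lin_fdelta; have [e|ne] := eqVneq (dg m) n.+1.
  rewrite res_id ?lin_fdelta ?res_id //; last by apply: onf_fdelta; apply/eqP.
  by apply: (onfW _ hD) => m' /andP[_]; rewrite e eqSS.
rewrite (@res_out _ _ _ (pred1 m)) ?lin0; last 2 first.
- by move=> m' /eqP->.
- by apply: onf_fdelta; rewrite /= eqxx.
rewrite (res_out _ hD) // => m' /andP[_ /eqP e]; apply: contra_neq ne => <-.
by rewrite -e.
Qed.

Lemma onf_D Q x : onf Om x -> onf Q x -> onf (fun m => Om m && [exists m', Q m' && ((dg m).+1 == dg m')]) (D x).
Proof.
move=> hx hQ; apply: onf_lin (onfI hx hQ) => m /andP[Om_m Qm].
apply: (onfW _ (cD Om_m).1) => m' /andP[-> e]; apply/existsP; exists m.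
by rewrite Qm.
Qed.

Lemma onf_D_Om x : onf Om x -> onf Om (D x).
Proof. by move=> hx; apply: (onfW _ (onf_D hx hx)) => m /andP[]. Qed.

Lemma DD x : onf Om x -> D (D x) = 0.
Proof.
move=> hx; pattern x; apply: onf_ind hx => [|u w eu ew|a u eu|m Om_m].
- by rewrite !lin0.
- by rewrite !linD eu ew addr0.
- by rewrite !linZ eu scaler0.
by rewrite lin_fdelta; case: (cD Om_m).
Qed.

Lemma homotopy_lin Q g s x : homotopy_on Q g s -> onf Om x -> onf Q x ->
  D (lin s x) + lin s (D x) = g *: x.
Proof.
move=> hs h1 h2; pattern x; apply: onf_ind (onfI h1 h2) => [|u w eu ew|a u eu|m /andP[Om_m Qm]].
- by rewrite !lin0 scaler0 addr0.
- by rewrite !linD scalerDr -eu -ew addrACA.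
- by rewrite !linZ -scalerDr eu !scalerA [a * _]mulrC.
by rewrite !lin_fdelta; case: (hs m Om_m Qm).
Qed.

Hypothesis acD : acyclic.

(** For a new basis vector [m] of positive degree, [g *: fdelta S m - lin s (Dv m)] is a cycle,
    hence a boundary; in degree 0 this is the last hypothesis. Keeping the values on the subcomplex
    [Q] allows insertion to be prescribed on Koszul vectors. *)
Lemma extend_homotopy (g : S) (Q : pred Idx) (s0 : Idx -> L) :
  homotopy_on Q g s0 ->
  (forall m, Om m -> Q m -> onf Q (Dv m)) ->
  (forall m, Om m -> ~~ Q m -> dg m = 0%N -> exists2 y, onf Om y & g *: fdelta S m = D y) ->
  exists s, (forall m, Q m -> s m = s0 m) /\ homotopy_on predT g s.
Proof.
move=> hs0 stQ h0; suff H n : exists s, (forall m, Q m -> s m = s0 m) /\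
    homotopy_on (fun m => Q m || (dg m < n)%N) g s.
  have [s [e hs]] := H (\max_m dg m).+1; exists s; split=> // m Om_m _.
  by apply: hs => //; rewrite ltnS leq_bigmax orbT.
elim: n => [|n [s [es hs]]].
  by exists s0; split=> // m Om_m; rewrite orbF; apply: hs0.
pose new m := [&& Om m, ~~ Q m & dg m == n].
pose good m y := new m -> onf (fun m' => Om m' && (dg m' == (dg m).+1)) y /\
   D y + lin s (Dv m) = g *: fdelta S m.
have [y Hy] : exists y : Idx -> L, forall m, good m (y m).
  apply: (@fin_all_exists _ _ good) => m; rewrite /good.
  have [/and3P[Om_m nQ /eqP dm]|_] := boolP (new m); last by exists 0.
  have [hD DDm] := cD Om_m.
  have lt_n : onf (fun m => Q m || (dg m < n)%N) (Dv m).
    by apply: (onfW _ hD) => m' /andP[_ /eqP]; rewrite dm => <-; rewrite ltnSn orbT.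
  have Om_D : onf Om (Dv m) by apply: (onfW _ hD) => m' /andP[].
  pose z := g *: fdelta S m - lin s (Dv m).
  have hz : onf (fun m => Om m && (dg m == n)) z.
    apply: onfD; first by apply/onfZ/onf_fdelta; rewrite Om_m dm eqxx.
    apply/onfN; apply: onf_lin (onfI hD lt_n) => m' /andP[/andP[Om' /eqP e'] lt'].
    apply: (onfW _ (hs m' Om' lt').1) => m'' /andP[-> /eqP->].
    by rewrite e' dm eqxx.
  have Dz : D z = 0.
    rewrite linB linZ lin_fdelta -(homotopy_lin hs Om_D lt_n) DDm lin0 addr0.
    by rewrite subrr.
  have [w hw def_z] : exists2 w, onf Om w & z = D w.
    have [n0|n0] := posnP n; last first.
      apply: acD => //; first by apply: (onfW _ hz) => m' /andP[].
      move=> m' dm'; apply: ((onfP _ _).1 hz); rewrite dm'.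
      by rewrite andbC; case: eqP n0 => [<-|].
    have [w hw e] := h0 m Om_m nQ (etrans dm n0); exists w => //.
    rewrite -e /z (_ : Dv m = 0) ?lin0 ?subr0 //.
    apply/ffunP => m'; rewrite [RHS]ffunE; apply: ((onfP _ _).1 hD).
    by rewrite dm n0 andbF.
  exists (res (fun m => dg m == n.+1) w) => _; split.
    rewrite dm; apply: onfI; first exact: onf_res2.
    exact: onf_res.
  rewrite D_res // -def_z res_id ?subrK //.
  by apply: (onfW _ hz) => m' /andP[].
pose s' m := if new m then y m else s m.
have s'E m : Q m || (dg m < n)%N -> s' m = s m.
  rewrite /s' /new => h; case: and3P => // -[_ nQ /eqP dm].
  by move: h; rewrite (negPf nQ) dm ltnn.
exists s'; split=> [m Qm|m Om_m h]; first by rewrite s'E ?Qm // es.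
have [hD DDm] := cD Om_m.
(* Boundaries of vectors of this stage lie in the previous one, so the new values do not disturb
   them. *)
have linE : lin s' (Dv m) = lin s (Dv m).
  have hQn : onf (fun m => Q m || (dg m < n)%N) (Dv m).
    case/orP: h => [Qm|lt_m].
      by apply: (onfW _ (stQ m Om_m Qm)) => m' ->.
    apply: (onfW _ hD) => m' /andP[_ /eqP e]; apply/orP; right.
    by rewrite -ltnS -e in lt_m *.
  exact: eq_lin hQn.
rewrite linE /s'; case: ifPn => [/Hy //|nnew]; apply: hs => //.
case: (boolP (Q m)) h nnew => //= nQ; rewrite /new Om_m nQ /= ltnS leq_eqVlt.
by case: eqP.
Qed.

End ExtendHomotopy.

(** * The layered resolution *)

Section LayeredComplex.
Variables (S : comUnitRingType) (c : nat) (f : 'I_c -> S) (J : finType).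
Variables (wt : J -> 'I_c) (sd : J -> nat).
Local Notation Idx := ({set 'I_c} * J)%type.
Local Notation L := {ffun Idx -> S^o}.
Variable xv : J -> L.

Definition layer_ok (Y : pred J) (m : Idx) := (m.2 \in Y) && blw (wt m.2) m.1.
Definition ldeg (m : Idx) := (#|m.1| + sd m.2)%N.

(* The index [(A, j)] stands for the basis vector [e_A b_j], with [sd j] the
   homological degree of [b_j] and [xv j] its image under [d]. Indices in ['I_c]
   start at 0, so an element of [B_s(p)] has weight [p - 1], and [A] may
   contain the indices below its weight. *)
Record lcomplex (q : nat) (Y : pred J) (Dv : Idx -> L) (sv : 'I_c -> Idx -> L) : Prop := LComplex {
  lc_complex : is_complex ldeg (layer_ok Y) Dv;
  lc_acyclic : acyclic ldeg (layer_ok Y) Dv;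
  lc_homotopy : forall i : 'I_c, (i < q)%N ->
    homotopy_on ldeg (layer_ok Y) Dv predT (f i) (sv i);
  lc_ins : forall (i : 'I_c) m, (i < q)%N -> layer_ok Y m -> (i < wt m.2)%N ->
    blw i m.1 -> sv i m = insv S i m;
  lc_fil : forall (i : 'I_c) m, (i < q)%N -> layer_ok Y m -> (wt m.2 <= i)%N ->
    onf (fun m' : Idx => (wt m'.2 <= i)%N) (sv i m);
  lc_min : forall m m', layer_ok Y m -> @max_ideal S (Dv m m');
  lc_val : forall j, j \in Y -> Dv (set0, j) = xv j }.

Hypotheses (f_regular : regular_seq f) (f_max : forall i, max_ideal (f i)).
Hypothesis max_ideal_ideal : is_ideal (@max_ideal S).

Lemma max_ideal0 : max_ideal (0 : S).
Proof. by case: max_ideal_ideal. Qed.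

Lemma max_idealD (x y : S) : max_ideal x -> max_ideal y -> max_ideal (x + y).
Proof. by case: max_ideal_ideal => _ h hx hy; rewrite -[x]mul1r; apply: h. Qed.

Lemma max_idealM (x y : S) : max_ideal y -> max_ideal (x * y).
Proof. by case: max_ideal_ideal => h0 h hy; rewrite -[x * y]addr0; apply: h. Qed.

Lemma max_ideal_lin (v : Idx -> L) (x : L) m :
  (forall m, @max_ideal S (x m)) -> @max_ideal S (lin v x m).
Proof.
move=> hx; rewrite /lin sum_ffunE; elim/big_ind: _ => [||i _].
- exact: max_ideal0.
- exact: max_idealD.
by rewrite ffunE [_ *: _]mulrC; apply: max_idealM.
Qed.

Lemma enum_setU1_max (i : 'I_c) A : blw i A -> enum (i |: A) = rcons (enum A) i.
Proof.
move=> bA; have srt (B : {set 'I_c}) : sorted (fun i j : 'I_c => i < j)%N (enum B).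
  rewrite /enum_mem -enumT sorted_filter //; first by move=> ? ? ?; apply: ltn_trans.
  by have := iota_ltn_sorted 0 c; rewrite -val_enum_ord sorted_map.
apply: (@irr_sorted_eq _ (fun i j : 'I_c => i < j)%N); rewrite ?srt //.
- by move=> ? ? ?; apply: ltn_trans.
- by move=> x; apply: ltnn.
- have: all (fun j : 'I_c => j < i)%N (enum A).
    by apply/allP => j; rewrite mem_enum; apply: (blwP _ _ bA).
  have := srt A; case: (enum A) => [//|a s] /= pth /andP[lt_a al].
  rewrite rcons_path pth /=; have := mem_last a s; rewrite inE => /predU1P[->//|].
  exact: (allP al).
by move=> x; rewrite mem_rcons !inE !mem_enum !inE.
Qed.

(** * Attaching one Koszul block to a layered complex *)

Section AddLayer.
Variables (q : nat) (Y Z : pred J) (Dv : Idx -> L) (sv : 'I_c -> Idx -> L) (d0 : nat).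
Hypothesis LC : lcomplex q Y Dv sv.
Hypotheses (le_qc : (q <= c)%N) (wtZ : forall j, j \in Z -> wt j = q :> nat).
Hypothesis disj : forall j, j \in Y -> j \notin Z.
Hypotheses (sdZ : forall j, j \in Z -> sd j = d0) (d0_le1 : (d0 <= 1)%N).
Hypothesis xv_on : forall j, j \in Z ->
  onf (fun m => layer_ok Y m && ((ldeg m).+1 == sd j)) (xv j).
Hypothesis xv_min : forall j m, j \in Z -> @max_ideal S (xv j m).
(** On zeroth homology the attaching map sends the class of [s] to that of the sum of the
    [s j *: xv j]. Injectivity modulo the first [q] elements of the sequence prevents new homology
    in degree one. *)
Hypothesis xv_inj : d0 = 1%N -> forall s : J -> S, (forall j, j \notin Z -> s j = 0) ->
  forall y, onf (layer_ok Y) y -> \sum_j s j *: xv j = lin Dv y ->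
  forall j, j \in Z -> ideal_gen (first_elts f q) (s j).

(** [enum A] is increasing, so the homotopy of the largest index is outermost, in agreement with
    insertion of a largest index. *)
Definition sigI (A : {set 'I_c}) (x : L) := foldl (fun y i => lin (sv i) y) x (enum A).

Lemma sigI0 x : sigI set0 x = x. Proof. by rewrite /sigI enum_set0. Qed.

Lemma sigI_max (i : 'I_c) A x : blw i A -> sigI (i |: A) x = lin (sv i) (sigI A x).
Proof. by move=> bA; rewrite /sigI enum_setU1_max // foldl_rcons. Qed.

(* [e_A b_j] is [sigma_A b_j] up to sign: applying the homotopies successively
   extends [psi_p] from [B_1(p)] to the Koszul complex. *)
Definition Dv' (m : Idx) : L :=
  if m.2 \in Z then kapv f m + (-1) ^+ #|m.1| *: sigI m.1 (xv m.2) else Dv m.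

Definition pre (i : 'I_c) (m : Idx) : L := if m.2 \in Z then insv S i m else sv i m.

Definition YZ : pred J := [pred j | (j \in Y) || (j \in Z)].

(** The subcomplex on which [pre i] is already a homotopy for [f i]: the old vectors, and the new
    ones to which [i] can be added as largest index. *)
Definition preQ (i : 'I_c) (m : Idx) := (m.2 \notin Z) || blw i m.1.

Lemma okY m : layer_ok Y m -> m.2 \notin Z.
Proof. by case/andP => /disj. Qed.

Lemma okYZ m : layer_ok Y m -> layer_ok YZ m.
Proof. by rewrite /layer_ok inE => /andP[-> ->]. Qed.

Lemma okZ A j : j \in Z -> layer_ok YZ (A, j) = blw q A.
Proof. by move=> Zj; rewrite /layer_ok inE /= Zj orbT wtZ. Qed.

Lemma okYZ_case m : layer_ok YZ m -> if m.2 \in Z then blw q m.1 else layer_ok Y m.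
Proof.
by rewrite /layer_ok inE; case: ifP => [Zj|_]; rewrite ?orbT ?orbF //= wtZ.
Qed.

Lemma sigI_on A j : j \in Z -> blw q A ->
  onf (fun m => layer_ok Y m && ((ldeg m).+1 == #|A| + sd j)%N) (sigI A (xv j)).
Proof.
move=> Zj; apply: (@set_ind_max _ (fun A => blw q A -> onf _ (sigI A (xv j)))) => [_|i I bI nI IH bq].
  rewrite sigI0; apply: (onfW _ (xv_on Zj)) => m; by rewrite cards0.
have lt_i : (i < q)%N by apply: (blwP _ _ bq); rewrite setU11.
have bqI : blw q I by apply/blwP => i' Ii'; apply: (blwP _ _ bq); rewrite inE Ii' orbT.
rewrite sigI_max //; apply: onf_lin (IH bqI) => m /andP[Ym /eqP dm].
apply: (onfW _ (lc_homotopy LC lt_i Ym isT).1) => m' /andP[-> /eqP->].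
by rewrite cardsU1 nI /= add1n addSn -dm.
Qed.

Lemma sigI_onY A j : j \in Z -> blw q A -> onf (layer_ok Y) (sigI A (xv j)).
Proof. by move=> Zj bq; apply: (onfW _ (sigI_on Zj bq)) => m /andP[]. Qed.

Lemma kapv_on A j : blw q A -> j \in Z ->
  onf (fun m => [&& m.2 \in Z, blw q m.1, m.1 \subset A & (ldeg m).+1 == #|A| + sd j]%N) (kapv f (A, j)).
Proof.
move=> bA Zj; apply: (onfW _ (@kapv_supp _ _ f _ (A, j))) => -[B l] /= /and3P[sub /eqP dm /eqP->].
rewrite Zj sub -dm addSn /ldeg /= eqxx andbT.
by apply/blwP => i mi; apply: (blwP _ _ bA); apply: (subsetP sub).
Qed.

Lemma Dv'Y x : onf (layer_ok Y) x -> lin Dv' x = lin Dv x.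
Proof. by apply: eq_lin => m /okY/negPf nZ; rewrite /Dv' nZ. Qed.

Lemma preY i x : onf (layer_ok Y) x -> lin (pre i) x = lin (sv i) x.
Proof. by apply: eq_lin => m /okY/negPf nZ; rewrite /pre nZ. Qed.

Lemma Dv'_on m : layer_ok YZ m ->
  onf (fun m' => layer_ok YZ m' && ((ldeg m').+1 == ldeg m)) (Dv' m).
Proof.
case: m => A j ok; have := okYZ_case ok; rewrite /Dv' /=; case: ifP => [Zj bA|_ Ym].
  apply: onfD.
    apply: (onfW _ (kapv_on bA Zj)) => -[B l] /and4P[Zl bB _ /eqP->] /=.
    by rewrite okZ // bB /ldeg eqxx.
  by apply/onfZ; apply: (onfW _ (sigI_on Zj bA)) => m' /andP[/okYZ-> ->].
by apply: (onfW _ (lc_complex LC Ym).1) => m' /andP[/okYZ-> ->].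
Qed.

(** The sign [(-1) ^+ #|A|] in [Dv'] is chosen for this recursion, which is nothing but the homotopy
    identity for [pre i] at [(A, j)]. *)
Lemma Dv'_max (i : 'I_c) A j : j \in Z -> (i < q)%N -> blw i A ->
  Dv' (i |: A, j) = f i *: fdelta S (A, j) - lin (pre i) (Dv' (A, j)).
Proof.
move=> Zj lt_i bA; rewrite /Dv' /= Zj kapv_ins // sigI_max // cardsU1 blw_notin //=.
have bq : blw q A by apply: blwW bA; apply: ltnW.
rewrite linD linZ (preY _ (sigI_onY Zj bq)).
rewrite (@eq_lin _ _ _ (pre i) (insv S i) (fun m => m.2 \in Z)); last first.
- by apply: (onfW _ (kapv_on bq Zj)) => m /and4P[].
- by move=> m Zm; rewrite /pre Zm.
by rewrite exprS mulN1r scaleNr opprD addrA.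
Qed.

Lemma preQ_stable i m : layer_ok YZ m -> preQ i m -> onf (preQ i) (Dv' m).
Proof.
case: m => A j ok Qm; have := okYZ_case ok; move: Qm; rewrite /preQ /Dv' /=; case: ifP => [Zj bA bq|_ _ Ym].
  apply: onfD.
    apply: (onfW _ (kapv_on bq Zj)) => m /and4P[_ _ sub _].
    by apply/orP; right; apply/blwP => i' mi'; apply: (blwP _ _ bA); apply: (subsetP sub).
  by apply/onfZ; apply: (onfW _ (sigI_onY Zj bq)) => m /okY->.
by apply: (onfW _ (lc_complex LC Ym).1) => m /andP[/okY->].
Qed.

Lemma pre_homotopy (i : 'I_c) : (i < q)%N -> homotopy_on ldeg (layer_ok YZ) Dv' (preQ i) (f i) (pre i).
Proof.
move=> lt_i [A j] ok Qm; have := okYZ_case ok; move: Qm; rewrite /preQ /=; have [Zj|nZj] := boolP (j \in Z).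
  move=> /= bA bq; rewrite {1 2}/pre /= Zj lin_fdelta; split.
    apply: onf_fdelta; rewrite okZ // /ldeg /= cardsU1 blw_notin // eqxx andbT.
    by apply: blwU => //; apply/blwP => i'; rewrite inE => /eqP->.
  by rewrite /= Dv'_max // subrK.
move=> _ Ym; have [h1 h2] := lc_homotopy LC lt_i Ym isT; rewrite {1 2}/pre /= (negPf nZj); split.
  by apply: (onfW _ h1) => m /andP[/okYZ-> ->].
rewrite Dv'Y; last by apply: (onfW _ h1) => m /andP[].
rewrite [X in lin (pre i) X](_ : _ = Dv (A, j)); last by rewrite /Dv' /= (negPf nZj).
by rewrite preY //; apply: (onfW _ (lc_complex LC Ym).1) => m /andP[].
Qed.

(** Apply the differential to the recursion at the largest index: by the homotopy identity for
    [pre i] everything cancels except the image of the square at the smaller set. At the empty set,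
    [xv j] has degree at most zero, where the old differential vanishes. *)
Lemma Dv'_complex : is_complex ldeg (layer_ok YZ) Dv'.
Proof.
move=> [A j] ok; split; first exact: Dv'_on.
have := okYZ_case ok; have [Zj|nZj] /= := boolP (j \in Z); rewrite ?Zj ?(negPf nZj); last first.
  move=> Ym; rewrite [X in lin _ X](_ : _ = Dv (A, j)); last by rewrite /Dv' /= (negPf nZj).
  have [h1 h2] := lc_complex LC Ym; rewrite Dv'Y //.
  by apply: (onfW _ h1) => m /andP[].
pattern A; apply: set_ind_max => [_|i I bI nI IH bq].
  rewrite /Dv' /= Zj kapv0 add0r cards0 expr0 scale1r sigI0 Dv'Y; last first.
    by apply: (onfW _ (xv_on Zj)) => m /andP[].
  apply: (lin0_on (Q := fun m => layer_ok Y m && (ldeg m == 0%N))).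
    move=> m /andP[Ym /eqP dm]; apply/ffunP => m'; rewrite [RHS]ffunE.
    by apply: ((onfP _ _).1 (lc_complex LC Ym).1); rewrite dm andbF.
  apply: (onfW _ (xv_on Zj)) => m /andP[-> /eqP e]; rewrite -leqn0 -ltnS e sdZ //.
have lt_i : (i < q)%N by apply: (blwP _ _ bq); rewrite setU11.
have bqI : blw q I by apply/blwP => i' Ii'; apply: (blwP _ _ bq); rewrite inE Ii' orbT.
have okI : layer_ok YZ (I, j) by rewrite okZ.
have QI : preQ i (I, j) by rewrite /preQ /= bI orbT.
have onI : onf (layer_ok YZ) (Dv' (I, j)) by apply: (onfW _ (Dv'_on okI)) => m /andP[].
rewrite Dv'_max // linB linZ lin_fdelta -(homotopy_lin (pre_homotopy lt_i) onI (preQ_stable okI QI)).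
by rewrite IH // lin0 addr0 subrr.
Qed.

(** The long exact sequence of the cone, on elements: the new component of a cycle is a Koszul
    cycle, in fact a Koszul boundary, and subtracting the boundary of a preimage leaves a cycle of
    the old complex. *)
Lemma Dv'_acyclic : acyclic ldeg (layer_ok YZ) Dv'.
Proof.
move=> x hx Dx0 x_pos; have cD' := Dv'_complex.
pose inZ (m : Idx) := m.2 \in Z.
pose xZ := res inZ x; pose xY := res (predC inZ) x.
have def_x : x = xZ + xY by exact: res_split.
have hxZ : onf (fun m => (m.2 \in Z) && blw q m.1) xZ.
  move=> m nz; have Zm := @onf_res _ _ inZ x m nz.
  by have := okYZ_case (@onf_res2 _ _ inZ _ x hx m nz); rewrite (Zm : m.2 \in Z).
have YofYZ (y : L) : onf (layer_ok YZ) y -> onf (predC inZ) y -> onf (layer_ok Y) y.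
  move=> h h' m nz; have := h' m nz; rewrite /= /inZ => /negPf nZm.
  by have := okYZ_case (h m nz); rewrite nZm.
have hxY : onf (layer_ok Y) xY by apply: YofYZ; [exact: onf_res2 | exact: onf_res].
have resD y : onf (fun m => (m.2 \in Z) && blw q m.1) y -> res inZ (lin Dv' y) = lin (@kapv S c f J) y.
  move=> hy; rewrite res_lin; apply: eq_lin hy => -[A j] /andP[Zj bA].
  rewrite /Dv' Zj linearD /= res_id; last by apply: (onfW _ (kapv_on bA Zj)) => m /and4P[].
  rewrite (res_out (Q' := layer_ok Y)) ?addr0 //.
    by move=> m /okY.
  exact/onfZ/sigI_onY.
have resY y : onf (layer_ok Y) y -> res inZ (lin Dv' y) = 0.
  move=> hy; rewrite Dv'Y //; apply: (res_out (Q' := layer_ok Y)) => [m /okY //|].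
  exact: onf_D_Om (lc_complex LC) _ hy.
have kZ0 : lin (@kapv S c f J) xZ = 0.
  rewrite -resD //; have := congr1 (res inZ) Dx0.
  by rewrite {1}def_x linD linearD /= (resY xY) // addr0 linear0.
(* For [d0 = 0] these coordinates sit in degree 0 and vanish by assumption. For [d0 = 1] the degree
   0 part of [lin Dv' x = 0] exhibits them as coefficients of a boundary of the old complex, and
   [xv_inj] applies. *)
have idZ j : ideal_gen (first_elts f q) (xZ (set0, j)).
  have [Zj|nZj] := boolP (j \in Z); last first.
    rewrite ((onfP _ _).1 hxZ) ?(negPf nZj) //; exact: (@setmul0 _ S^o).
  have xZE l : xZ (set0, l) = if l \in Z then x (set0, l) else 0 by rewrite ffunE.
  have [d00|d01] : d0 = 0%N \/ d0 = 1%N.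
  - by case: d0 d0_le1 => [|[]] //; [left | right].
  - rewrite xZE Zj x_pos; first exact: (@setmul0 _ S^o).
    by rewrite /ldeg cards0 sdZ.
  apply: (@xv_inj d01 (fun l => xZ (set0, l)) _ (- res (fun m => ldeg m == 1%N) xY)) => //.
  - by move=> l /negPf nl; rewrite xZE nl.
  - by apply/onfN/onf_res2.
  have := D_res cD' 0 hx; rewrite Dx0 linear0 {1}def_x linearD linD /= => /eqP.
  rewrite addr_eq0 [lin Dv' (res _ xY)]Dv'Y; last exact: onf_res2.
  rewrite linN => /eqP <-.
  have -> : res (fun m => ldeg m == 1%N) xZ = \sum_l xZ (set0, l) *: fdelta S (set0, l).
    apply/ffunP => -[A l]; rewrite sum_ffunE ffunE (bigD1 l) //= big1 => [|l' /negPf nl]; last first.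
      by rewrite !ffunE xpair_eqE [l == _]eq_sym nl andbF scaler0.
    rewrite [in RHS]ffunE [fdelta _ _ _]ffunE xpair_eqE eqxx andbT addr0 /ldeg /=.
    have [->|nA] := eqVneq A set0.
      rewrite cards0 add0n -[RHS]/(_ * 1) mulr1; case: eqP => // ne.
      by rewrite xZE; case: ifP => // Zl; rewrite sdZ in ne.
    rewrite scaler0; case: eqP => // e; apply/eqP/negPn/negP => nz; have /andP[/= Zl _] := hxZ _ nz.
    by move: e; rewrite sdZ // d01 addn1 => -[/eqP]; rewrite cards_eq0 (negPf nA).
  rewrite [RHS]lin_sum; apply: eq_bigr => l _; rewrite linZ lin_fdelta.
  have [Zl|nZl] := boolP (l \in Z); last by rewrite xZE (negPf nZl) !scale0r.
  by rewrite /Dv' /= Zl kapv0 add0r cards0 scale1r sigI0.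
have [y hy def_xZ] := koszul_exact f_regular le_qc hxZ kZ0 idZ.
(* Dropping the degrees up to one does not change the Koszul boundary, as [xZ] vanishes in degree 0.
   In return the full boundary of [y2] has no part in degree 0, as exactness of the old complex
   requires. *)
pose y2 := res (fun m => (1 < ldeg m)%N) y.
have hy2 : onf (fun m => (m.2 \in Z) && blw q m.1) y2 by exact: onf_res2.
have onY2 : onf (layer_ok YZ) y2.
  by apply: (onfW _ hy2) => -[A j] /= /andP[Zj bA]; rewrite okZ.
have ky2 : lin (@kapv S c f J) y2 = xZ.
  have e : lin (@kapv S c f J) (y - y2) = xZ - lin (@kapv S c f J) y2 by rewrite linB -def_xZ.
  have lo : onf (fun m => ldeg m == 0%N) (lin (@kapv S c f J) (y - y2)).
    apply: (onf_lin (Q := fun m : Idx => [&& m.2 \in Z, blw q m.1 & (ldeg m <= 1)%N])).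
      move=> [A j] /and3P[Zj bA le1]; apply: (onfW _ (kapv_on bA Zj)) => m /and4P[_ _ _ /eqP e'].
      by rewrite /ldeg /= -e' ltnS leqn0 in le1.
    rewrite /y2 {1}(res_split (fun m => (1 < ldeg m)%N) y) addrAC subrr add0r.
    move=> m nz; have := @onf_res _ _ _ y m nz; rewrite /= -leqNgt => ->.
    by have /andP[-> ->] := @onf_res2 _ _ _ _ y hy m nz.
  apply/eqP; rewrite eq_sym -subr_eq0 -e; apply/eqP/ffunP => m; rewrite [RHS]ffunE.
  have [dm|dm] := eqVneq (ldeg m) 0%N; last exact: ((onfP _ _).1 lo).
  rewrite e !ffunE /= x_pos // if_same sub0r; apply/eqP; rewrite oppr_eq0; apply/eqP.
  apply: ((onfP (fun m => (0 < ldeg m)%N) _).1); last by rewrite dm.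
  apply: (onf_lin (Q := fun m : Idx => [&& m.2 \in Z, blw q m.1 & (1 < ldeg m)%N])).
    move=> [A j] /and3P[Zj bA le1]; apply: (onfW _ (kapv_on bA Zj)) => m' /and4P[_ _ _ /eqP e'].
    by rewrite /ldeg /= -e' ltnS in le1.
  move=> m' nz; have := @onf_res _ _ _ y m' nz; rewrite /= => ->.
  by have /andP[-> ->] := hy2 m' nz.
have onD2 := onf_D_Om cD' onY2.
have [z hz def_z] : exists2 z, onf (layer_ok Y) z & x - lin Dv' y2 = lin Dv z.
  have hw : onf (layer_ok Y) (x - lin Dv' y2).
    apply: YofYZ; first by apply: onfD => //; apply: onfN.
    apply/onfP => m; rewrite negbK => Zm; transitivity (res inZ (x - lin Dv' y2) m).
      by rewrite [RHS]ffunE Zm.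
    by rewrite linearB /= resD // ky2 subrr ffunE.
  apply: (lc_acyclic LC hw) => [|m dm].
    by rewrite -Dv'Y // linB Dx0 (DD cD' onY2) subr0.
  rewrite !ffunE x_pos // sub0r; apply/eqP; rewrite oppr_eq0; apply/eqP.
  apply: ((onfP _ _).1 (onf_D cD' onY2 (@onf_res _ _ (fun m => (1 < ldeg m)%N) y))).
  rewrite negb_and; apply/orP; right; rewrite negb_exists; apply/forallP => m'.
  by rewrite dm negb_and -leqNgt; case: (ldeg m') => [|[|]].
exists (y2 + z).
  by apply: onfD => //; apply: (onfW _ hz) => m /okYZ.
by rewrite linD [lin Dv' z]Dv'Y // -def_z addrC subrK.
Qed.

Lemma add_layer : exists sv', lcomplex q YZ Dv' sv'.
Proof.
have [sv' Hsv] : exists sv' : 'I_c -> Idx -> L, forall i : 'I_c, (i < q)%N ->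
    (forall m, preQ i m -> sv' i m = pre i m) /\
    homotopy_on ldeg (layer_ok YZ) Dv' predT (f i) (sv' i).
  apply: (@fin_all_exists _ _ (fun (i : 'I_c) s => (i < q)%N ->
    (forall m, preQ i m -> s m = pre i m) /\
    homotopy_on ldeg (layer_ok YZ) Dv' predT (f i) s)) => i.
  have [lt_i|_] := ltnP i q; last by exists (fun=> 0).
  have [||s [h1 h2]] := extend_homotopy Dv'_complex Dv'_acyclic (pre_homotopy lt_i).
  - by move=> m; apply: preQ_stable.
  - move=> [A j] _; rewrite /preQ /ldeg negb_or /= => /andP[_ nb] /eqP.
    rewrite addn_eq0 cards_eq0 => /andP[/eqP A0 _]; move: nb; rewrite A0.
    by case/negP; apply/blwP => i'; rewrite inE.
  by exists s.
exists sv'; split.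
- exact: Dv'_complex.
- exact: Dv'_acyclic.
- by move=> i lt_i; case: (Hsv i lt_i).
- move=> i m lt_i ok lt_w bi; rewrite (Hsv i lt_i).1 /preQ ?bi ?orbT // /pre.
  by have := okYZ_case ok; case: ifP => // _ Ym; apply: (lc_ins LC).
(* New vectors have weight [q > i], so the filtration condition concerns old vectors only. *)
- move=> i [A j] lt_i ok le_w; have nZ : j \notin Z.
    by apply: contraTN lt_i => /wtZ e; rewrite -leqNgt -e.
  rewrite (Hsv i lt_i).1 /preQ /= ?nZ // /pre /= (negPf nZ).
  by apply: (lc_fil LC) => //; have := okYZ_case ok; rewrite (negPf nZ).
- move=> [A j] m' ok; have := okYZ_case ok; rewrite /Dv' /=; case: ifP => [Zj bA|_ Ym]; last exact: (lc_min LC).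
  rewrite ffunE; apply: max_idealD.
    rewrite /kapv sum_ffunE; elim/big_ind: _ => [||i _]; [exact: max_ideal0 | exact: max_idealD|].
    by rewrite ffunE [_ *: _]mulrC mulrA; apply: max_idealM.
  rewrite ffunE; apply: max_idealM; move: m'; pattern A; apply: set_ind_max => [m'|i I bI _ IH m'].
    by rewrite sigI0; apply: xv_min.
  by rewrite sigI_max //; apply: max_ideal_lin.
move=> j; rewrite inE /Dv' /=; case: ifP => [Zj _|_]; last by rewrite orbF => /(lc_val LC).
by rewrite kapv0 add0r cards0 scale1r sigI0.
Qed.

End AddLayer.

(** No weight exceeds [q], so for the index [q] the insertion rule is vacuous and the filtration
    condition automatic: any homotopy will do. *)
Lemma add_homotopy (q : 'I_c) (Y : pred J) Dv sv : lcomplex q Y Dv sv ->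
  (forall j, j \in Y -> (wt j <= q)%N) ->
  (forall m, layer_ok Y m -> ldeg m = 0%N ->
     exists2 y, onf (layer_ok Y) y & f q *: fdelta S m = lin Dv y) ->
  exists sv', lcomplex q.+1 Y Dv sv'.
Proof.
move=> LC le_w h0.
have hom0 : homotopy_on ldeg (layer_ok Y) Dv pred0 (f q) (fun=> 0) by [].
have [||s [_ hs]] := extend_homotopy (lc_complex LC) (lc_acyclic LC) hom0.
- by [].
- by move=> m ok _; apply: h0.
pose sv' (i : 'I_c) := if i == q then s else sv i.
have lt_i (i : 'I_c) : (i < q.+1)%N -> i != q -> (i < q)%N.
  by rewrite ltnS leq_eqVlt => /predU1P[/val_inj->|//]; rewrite eqxx.
exists sv'; split; try by case: LC.
- move=> i lt; rewrite /sv'; case: eqVneq => [->//|/(lt_i i lt)]; exact: (lc_homotopy LC).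
- move=> i m lt ok; rewrite /sv'; case: eqVneq => [->|/(lt_i i lt) lt' *]; last exact: (lc_ins LC).
  by rewrite ltnNge le_w //; case/andP: ok.
move=> i m lt ok; rewrite /sv'; case: eqVneq => [-> _|/(lt_i i lt) lt' *]; last exact: (lc_fil LC).
by apply: (onfW _ (hs m ok isT).1) => m' /andP[/andP[/le_w]].
Qed.

Hypothesis sd_le1 : forall j, (sd j <= 1)%N.
Hypothesis xv_supp : forall j, onf (fun m : Idx =>
  [&& m.1 == set0, sd m.2 == 0%N, (wt m.2 <= wt j)%N & sd j == 1%N]) (xv j).
Hypothesis xv_minimal : forall j m, @max_ideal S (xv j m).

Definition in_base (p : nat) (m : Idx) := [&& m.1 == set0, sd m.2 == 0%N & (wt m.2 <= p)%N].

(** Axiom (a) in coordinates: [s] holds the coordinates of the value of [h_p] at the vector [l]. *)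
Hypothesis xv_htpy : forall (p : 'I_c) l, sd l = 0%N -> (wt l <= p)%N ->
  exists s : J -> S, (forall j, ~~ ((sd j == 1%N) && (wt j <= p)%N) -> s j = 0) /\
    setmul (first_elts f p) (onf (in_base p)) (f p *: fdelta S (set0, l) - \sum_j s j *: xv j).

(** Axiom (b) in coordinates, after cancelling [f p] by regularity. *)
Hypothesis xv_regular : forall (p : 'I_c) (s : J -> S),
  (forall j, ~~ ((sd j == 1%N) && (wt j <= p)%N) -> s j = 0) ->
  setmul (first_elts f p) (onf (in_base p)) (\sum_j s j *: xv j) ->
  forall j, wt j = p -> sd j = 1%N -> ideal_gen (first_elts f p) (s j).

Lemma xv0 j : sd j = 0%N -> xv j = 0.
Proof.
move=> sj; apply/ffunP => m; rewrite [RHS]ffunE; apply: ((onfP _ _).1 (@xv_supp j)).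
by rewrite sj !andbF.
Qed.

Lemma base_layer p (Y : pred J) m : (forall j, sd j = 0%N -> (wt j <= p)%N -> j \in Y) ->
  in_base p m -> layer_ok Y m.
Proof.
move=> hY /and3P[/eqP m0 /eqP s0 le_p]; rewrite /layer_ok hY // m0.
by apply/blwP => i; rewrite inE.
Qed.

(** Degree one has two kinds of basis vectors: those [e_i b_j] with [b_j] of degree 0, whose
    boundary is [f_i b_j] by the insertion rule, and the [b_j] of degree one, with boundary
    [xv j]. *)
Lemma lcomplex_deg1 (p : nat) (Y : pred J) Dv sv y : lcomplex p Y Dv sv ->
  (forall j, j \in Y -> (wt j <= p)%N) ->
  onf (fun m => layer_ok Y m && (ldeg m == 1%N)) y ->
  exists t : J -> S, (forall j, ~~ ((j \in Y) && (sd j == 1%N)) -> t j = 0) /\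
    setmul (first_elts f p) (onf (in_base p)) (lin Dv y - \sum_j t j *: xv j).
Proof.
move=> LC le_w hy; pattern y; apply: onf_ind hy.
- exists (fun=> 0); split=> //; rewrite lin0 big1 ?subrr; first exact: setmul0.
  by move=> j _; rewrite scale0r.
- move=> u w [t [t0 ht]] [t' [t0' ht']]; exists (fun j => t j + t' j); split.
    by move=> j nj; rewrite t0 // t0' // addr0.
  under eq_bigr do rewrite scalerDl.
  by rewrite linD big_split opprD addrACA; apply: setmulD.
- move=> a u [t [t0 ht]]; exists (fun j => a * t j); split.
    by move=> j nj; rewrite t0 // mulr0.
  under eq_bigr do rewrite -scalerA.
  rewrite linZ -scaler_sumr -scalerBr; case: ht => [n [b [z [hz ->]]]].
  rewrite scaler_sumr; apply: setmul_sum => i _; rewrite scalerA mulrC -scalerA.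
  by apply: setmul1; case: (hz i) => // _; apply: onfZ.
move=> [A j] /andP[ok /eqP]; have /andP[/= Yj bA] := ok; rewrite /ldeg /= lin_fdelta.
have := sd_le1 j; case sj : (sd j) => [|[|//]] _; last first.
  rewrite addn1 => -[/eqP]; rewrite cards_eq0 => /eqP ->; exists (fun l => (l == j)%:R); split.
    by move=> l; case: (l =P j) => // ->; rewrite Yj sj.
  rewrite (bigD1 j) //= eqxx scale1r big1 ?addr0; last by move=> l /negPf->; rewrite scale0r.
  by rewrite (lc_val LC) // subrr; apply: setmul0.
rewrite addn0 => /eqP/cards1P[i defA]; exists (fun=> 0); split=> //.
rewrite big1 ?subr0 => [|l _]; last by rewrite scale0r.
have lt_i : (i < wt j)%N by apply: (blwP _ _ bA); rewrite defA inE.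
have lt_ip : (i < p)%N by apply: leq_trans (le_w j Yj).
have ok0 : layer_ok Y (set0, j) by rewrite /layer_ok Yj; apply/blwP => i'; rewrite inE.
have b0 : blw i (set0 : {set 'I_c}) by apply/blwP => i'; rewrite inE.
have [_] := lc_homotopy LC lt_ip ok0 isT.
rewrite (lc_ins LC) // lin_fdelta (lc_val LC) // xv0 // lin0 addr0 setU0 defA => ->.
apply: setmul1; first by exists i.
by apply: onf_fdelta; rewrite /in_base /= eqxx sj le_w.
Qed.

(** The order within a step matters: the attaching map of [B_1(p)] needs [B_0(p)] in place, and
    [f_p] kills the zeroth homology only after [B_1(p)] has been attached. *)
Lemma layered_complex_exists q : (q <= c)%N ->
  exists Dv sv, lcomplex q [pred j | (wt j < q)%N] Dv sv.
Proof.
elim: q => [_|q IHq lt_q].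
  exists (fun=> 0), (fun _ _ => 0); split=> // x hx _ _; exists 0; first exact: onf0.
  rewrite lin0; apply/ffunP => m; rewrite [RHS]ffunE; apply: ((onfP _ _).1 hx).
  by rewrite /layer_ok inE ltn0.
have le_q := ltnW lt_q; have [D0 [s0 LC0]] := IHq le_q; pose p := Ordinal lt_q.
pose Y0 : pred J := [pred j | (wt j < q)%N].
pose Z0 : pred J := [pred j | (wt j == p) && (sd j == 0%N)].
pose Z1 : pred J := [pred j | (wt j == p) && (sd j == 1%N)].
pose Y1 := YZ Y0 Z0.
have Y1E j : j \in Y1 = ((wt j < q) || (wt j == p) && (sd j == 0))%N by [].
have [s1 LC1] : exists s1, lcomplex q Y1 (Dv' Z0 D0 s0) s1.
  apply: (add_layer (d0 := 0%N) LC0) => // [j|j|j|j] /=.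
  - by rewrite inE => /andP[/eqP->].
  - rewrite !inE => lt; apply/negP => /andP[/eqP e _].
    by rewrite e ltnn in lt.
  - by rewrite inE => /andP[_ /eqP].
  by rewrite inE => /andP[_ /eqP/xv0 ->]; exact: onf0.
set D1 := Dv' _ _ _ in LC1.
have base1 j : sd j = 0%N -> (wt j <= q)%N -> j \in Y1.
  move=> sj; rewrite Y1E sj eqxx andbT leq_eqVlt => /predU1P[e|->//].
  by rewrite (_ : wt j = p) ?eqxx ?orbT //; apply: val_inj.
have [s2 LC2] : exists s2, lcomplex q (YZ Y1 Z1) (Dv' Z1 D1 s1) s2.
  apply: (add_layer (d0 := 1%N) LC1) => // [j|j|j|j|].
  - by rewrite inE => /andP[/eqP->].
  - rewrite Y1E !inE => h; apply/negP => /andP[/eqP e /eqP s]; move: h.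
    by rewrite e ltnn s eqxx.
  - by rewrite inE => /andP[_ /eqP].
  - rewrite inE => /andP[/eqP wj /eqP sj]; apply: (onfW _ (@xv_supp j)) => m /and4P[m0 s0' le_w _].
    rewrite (base_layer base1) ?sj; last by rewrite /in_base m0 s0' -[q]/(p : nat) -wj.
    by rewrite /ldeg (eqP m0) (eqP s0') cards0.
  (* Only the degree one part of [y] matters. Modulo smaller [f_i] its boundary is a combination of
     the [xv] of earlier layers with coefficients [t], so [xv_regular] applies to [s - t], which
     agrees with [s] on the new layer. *)
  move=> _ s hs y hy e j; rewrite inE => /andP[/eqP wj /eqP sj].
  have [t [ht hst]] : exists t : J -> S, (forall j, ~~ ((j \in Y1) && (sd j == 1%N)) -> t j = 0) /\
    setmul (first_elts f p) (onf (in_base p)) (lin D1 (res (fun m => ldeg m == 1%N) y) - \sum_j t j *: xv j).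
    apply: (lcomplex_deg1 (p := p) LC1) => [l|].
      by rewrite Y1E => /orP[/ltnW //|/andP[/eqP-> _]].
    by apply: onfI; [exact: onf_res2 | exact: onf_res].
  have e1 : lin D1 (res (fun m => ldeg m == 1%N) y) = \sum_l s l *: xv l.
    rewrite (D_res (lc_complex LC1)) // -e res_id //; apply: onf_sum => l _; apply: onfZ.
    apply: (onfW _ (@xv_supp l)) => m /and4P[/eqP m0 /eqP s0' _ _].
    by rewrite /ldeg m0 s0' cards0.
  have [tj] : t j = 0 by apply: ht; rewrite Y1E wj ltnn sj eqxx.
  rewrite -[s j]subr0 -tj; apply: (xv_regular (p := p) (s := fun l => s l - t l)) => //.
    move=> l nl; rewrite hs ?ht ?subrr //; apply: contra nl.
      by rewrite Y1E => /andP[/orP[/ltnW->|/andP[/eqP-> _]] ->]; rewrite //= leqnn.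
    by rewrite inE => /andP[/eqP-> ->]; rewrite leqnn.
  by under eq_bigr do rewrite scalerBl; rewrite sumrB -e1.
set D2 := Dv' _ _ _ in LC2.
have eY : YZ Y1 Z1 = [pred j | (wt j < q.+1)%N].
  apply: functional_extensionality => j.
  rewrite -[LHS]/((j \in Y1) || (j \in Z1)) -[RHS]/(wt j < q.+1)%N Y1E inE [in RHS]ltnS [in RHS]leq_eqVlt.
  rewrite -[wt j == q :> nat]/(wt j == p); have := sd_le1 j.
  by case: (sd j) => [|[|]] //= _; rewrite ?andbF ?andbT ?orbF orbC.
rewrite eY in LC2.
have [s3 LC3] : exists s3, lcomplex p.+1 [pred j | (wt j < q.+1)%N] D2 s3; last by exists D2, s3.
apply: (add_homotopy (q := p) LC2) => // -[A l] /andP[/= wl _] /eqP.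
rewrite /ldeg addn_eq0 cards_eq0 => /andP[/= /eqP-> /eqP sl].
have [s [hs hz]] := xv_htpy sl (wl : (wt l <= p)%N).
(* The two summands are boundaries for different reasons: each [xv j] by construction, and [z]
   because the homotopies already available turn [f_i]-multiples of degree 0 vectors into
   boundaries. *)
set z := _ - _ in hz; have -> : f p *: fdelta S (set0, l) = \sum_j s j *: xv j + z.
  by rewrite addrC subrK.
have ok0 j : (wt j <= q)%N -> layer_ok [pred j | (wt j < q.+1)%N] (set0, j).
  by move=> le_w; rewrite /layer_ok inE ltnS le_w; apply/blwP => i'; rewrite inE.
pose P x := exists2 y, onf (layer_ok [pred j | (wt j < q.+1)%N]) y & x = lin D2 y.
have PD x y : P x -> P y -> P (x + y).
  move=> [u hu ->] [w hw ->]; exists (u + w); first exact: onfD.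
  by rewrite linD.
have P0 : P 0 by exists 0; [exact: onf0 | rewrite lin0].
apply: (PD _ _).
  apply: (big_ind P P0 PD) => j _.
  have [/andP[_ le_w]|/hs->] := boolP ((sd j == 1%N) && (wt j <= p)%N); last by rewrite scale0r.
  exists (s j *: fdelta S (set0, j)); first exact/onfZ/onf_fdelta/ok0.
  by rewrite linZ lin_fdelta (lc_val LC2).
apply: (setmul_ind P0 PD _ hz) => a y [i [lt_i ->]] hy.
have base2 : onf (layer_ok [pred j | (wt j < q.+1)%N]) y.
  by apply: (onfW _ hy) => m; apply: base_layer => j _ /=.
exists (lin (s2 i) y).
  by apply: onf_lin base2 => m ok; apply: (onfW _ (lc_homotopy LC2 lt_i ok isT).1) => m' /andP[].
have D2y : lin D2 y = 0.
  apply: lin0_on hy => -[B j] /and3P[/= /eqP-> /eqP sj le_w].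
  by rewrite (lc_val LC2) ?xv0 // inE ltnS.
by rewrite -(homotopy_lin (lc_homotopy LC2 lt_i) base2) // D2y lin0 addr0.
Qed.

End LayeredComplex.

(** * Bases of higher matrix factorizations *)

Section SplitBasis.
Variables (S : comUnitRingType) (k : fieldType) (rho : {rmorphism S -> k}).
Hypothesis k_residue : is_residue_field rho.

Lemma max_idealE x : max_ideal x <-> rho x = 0.
Proof. by case: k_residue => _ h; split=> /h. Qed.

Lemma rho_surj y : exists x, rho x = y.
Proof. by case: k_residue. Qed.

Lemma max_ideal_is_ideal : is_ideal (@max_ideal S).
Proof.
split; first by apply/max_idealE; rewrite rmorph0.
by move=> a x y /max_idealE hx /max_idealE hy; apply/max_idealE; rewrite rmorphD rmorphM hx hy mulr0 addr0.
Qed.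

Lemma rho_unit x : rho x != 0 -> x \is a GRing.unit.
Proof. by apply: contraR => nx; apply/eqP/max_idealE. Qed.

Variables (c : nat) (A : filtered_free S c) (b : split_basis A).
Local Notation n := (sb_n b).
Local Notation comb a := (\sum_j a j *: sb_vec b j).
Local Notation inmA := (setmul (@max_ideal S) (fun _ : A => True)).

Lemma fil_submod p : (p <= c)%N -> is_submod (@fil S c A p).
Proof.
move=> /(@fil_free S c A p)[m [e [he _]]]; split.
  by apply/he; exists (fun=> 0); rewrite big1 // => i _; rewrite scale0r.
move=> a x y /he[u ->] /he[v ->]; apply/he; exists (fun i => a * u i + v i).
rewrite scaler_sumr -big_split; apply: eq_bigr => i _ /=.
by rewrite scalerA scalerDl.
Qed.

Lemma submod0 (V : lmodType S) (N : V -> Prop) : is_submod N -> N 0. Proof. by case. Qed.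
Lemma submodD (V : lmodType S) (N : V -> Prop) x y : is_submod N -> N x -> N y -> N (x + y).
Proof. by case=> _ h hx hy; rewrite -[x]scale1r; apply: h. Qed.
Lemma submodZ (V : lmodType S) (N : V -> Prop) a x : is_submod N -> N x -> N (a *: x).
Proof. by case=> h0 h hx; rewrite -[_ *: _]addr0; apply: h. Qed.
Lemma submod_sum (V : lmodType S) (N : V -> Prop) I (r : seq I) (P : pred I) F :
  is_submod N -> (forall i, P i -> N (F i)) -> N (\sum_(i <- r | P i) F i).
Proof.
by move=> h hF; elim/big_ind: _ => //; [exact: submod0 | move=> x y; exact: submodD].
Qed.

Lemma fil_mono p q x : (p <= q)%N -> (q <= c)%N -> @fil S c A p x -> @fil S c A q x.
Proof.
elim: q => [|q IH]; first by rewrite leqn0 => /eqP->.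
rewrite leq_eqVlt => /predU1P[->//|]; rewrite ltnS => le_pq lt_qc hx.
have [h _] := sb_split b (Ordinal lt_qc); apply/h; exists x, 0; rewrite addr0; split=> //.
  by apply: IH => //; apply: ltnW.
exact: submod0 (sb_submod b _).
Qed.

Lemma sb_fil q x : sb_B b q x -> @fil S c A q.+1 x.
Proof.
move=> hx; have [h _] := sb_split b q; apply/h; exists 0, x; rewrite add0r; split=> //.
by apply: submod0 (fil_submod _); apply: ltnW.
Qed.

Lemma fil_decomp p x : (p <= c)%N -> @fil S c A p x ->
  exists y : 'I_c -> A, [/\ forall q, sb_B b q (y q), forall q : 'I_c, (p <= q)%N -> y q = 0
    & x = \sum_q y q].
Proof.
elim: p x => [|p IH] x le_p hx.
  exists (fun=> 0); split=> // [q|]; first exact: submod0 (sb_submod b _).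
  by move/fil_0: hx => ->; rewrite big1.
pose i := Ordinal le_p; have [h _] := sb_split b i.
have /h[u [v [hu hv ->]]] := hx; have [y [By y0 ->]] := IH u (ltnW le_p) hu.
exists (fun q => if q == i then v else y q); split.
- by move=> q; case: eqP => [->|].
- move=> q lt_q; case: eqP => [e|_]; first by rewrite e ltnn in lt_q.
  by apply: y0; apply: ltnW.
rewrite (bigD1 i) //= y0 // add0r addrC [RHS](bigD1 i) //= eqxx; congr (_ + _).
by apply: eq_bigr => q /negPf->.
Qed.

Lemma fil_decomp_uniq p (y : 'I_c -> A) : (p <= c)%N -> (forall q, sb_B b q (y q)) ->
  (forall q : 'I_c, (p <= q)%N -> y q = 0) -> \sum_q y q = 0 -> forall q, y q = 0.
Proof.
elim: p y => [|p IH] y le_p By y0 sum0; first by move=> q; apply: y0.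
pose i := Ordinal le_p; have [_ h] := sb_split b i.
have yi : y i = 0.
  apply: h => //; have -> : y i = - \sum_(q | q != i) y q.
    by move/eqP: sum0; rewrite (bigD1 i) //= addr_eq0 => /eqP.
  have sub := fil_submod (ltnW le_p).
  rewrite -scaleN1r; apply: (submodZ _ sub); apply: submod_sum => // q nq.
  have [le|lt] := leqP p.+1 q; first by rewrite y0 //; apply: submod0.
  apply: fil_mono (sb_fil (By q)); last exact: ltnW.
  by rewrite ltn_neqAle -ltnS lt andbT; apply: contra_neq nq => e; apply: val_inj.
apply: (IH y (ltnW le_p) By) => // q le_q.
by have [->//|nq] := eqVneq q i; apply: y0; rewrite ltn_neqAle le_q andbT eq_sym; apply: contra_neq nq => e; apply: val_inj.
Qed.

Lemma comb_blocks (a : 'I_n -> S) : comb a = \sum_q \sum_(j | sb_w b j == q) a j *: sb_vec b j.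
Proof.
rewrite (exchange_big_dep xpredT) //=; apply: eq_bigr => j _.
by rewrite (big_pred1 (sb_w b j)) // => q; rewrite eq_sym.
Qed.

Lemma block_in (a : 'I_n -> S) q : sb_B b q (\sum_(j | sb_w b j == q) a j *: sb_vec b j).
Proof.
have sub := sb_submod b q; apply: submod_sum => // j /eqP <-.
by apply: submodZ; [exact: sb_submod | exact: sb_in].
Qed.

Lemma gen_mod_max x : exists a : 'I_n -> S, inmA (x - comb a).
Proof.
have [y [By _ ->]] := fil_decomp (leqnn c) (fil_top x).
have [a Ha] : exists a : 'I_c -> 'I_n -> S, forall q,
    setmul (@max_ideal S) (sb_B b q) (y q - \sum_(j | sb_w b j == q) a q j *: sb_vec b j).
  have h q : {a : 'I_n -> S | setmul (@max_ideal S) (sb_B b q) (y q - \sum_(j | sb_w b j == q) a j *: sb_vec b j)}.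
    by apply: constructive_indefinite_description; apply: sb_gen.
  by exists (fun q => sval (h q)) => q; apply: (svalP (h q)).
exists (fun j => a (sb_w b j) j); rewrite comb_blocks -sumrB; apply: setmul_sum => q _.
have -> : \sum_(j | sb_w b j == q) a (sb_w b j) j *: sb_vec b j =
    \sum_(j | sb_w b j == q) a q j *: sb_vec b j by apply: eq_bigr => j /eqP->.
exact: setmulW (Ha q).
Qed.

(** Independence is given block by block modulo the maximal ideal times the block; splitting the
    witnesses of membership along the blocks makes it global. *)
Lemma indep_mod_max (a : 'I_n -> S) : inmA (comb a) -> forall j, max_ideal (a j).
Proof.
case=> m [u [v [hu e]]] j; apply: (sb_indep (s := b) (p := sb_w b j)) => //.
have [y Hy] : exists y : 'I_m -> 'I_c -> A, forall t, (forall q, sb_B b q (y t q)) /\ v t = \sum_q y t q.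
  have h t : {y : 'I_c -> A | (forall q, sb_B b q (y q)) /\ v t = \sum_q y q}.
    apply: constructive_indefinite_description.
    by have [y [? _ ?]] := fil_decomp (leqnn c) (fil_top (v t)); exists y.
  by exists (fun t => sval (h t)) => t; apply: (svalP (h t)).
pose z q := \sum_(j | sb_w b j == q) a j *: sb_vec b j - \sum_t u t *: y t q.
have z0 : forall q, z q = 0.
  apply: (fil_decomp_uniq (leqnn c)) => [q|q|].
  - apply: submodD (sb_submod b q) (block_in a q) _; rewrite -scaleN1r.
    apply: submodZ; first exact: sb_submod.
    apply: submod_sum; first exact: sb_submod.
    by move=> t _; apply: submodZ; [exact: sb_submod | case: (Hy t)].
  - by rewrite leqNgt ltn_ord.
  rewrite sumrB -comb_blocks e exchange_big -sumrB big1 // => t _ /=.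
  by rewrite (Hy t).2 scaler_sumr subrr.
have /eqP := z0 (sb_w b j); rewrite subr_eq0 => /eqP ->.
by apply: setmul_sum => t _; apply: setmul1; [case: (hu t) | case: (Hy t)].
Qed.

(* The change of basis is invertible modulo the maximal ideal, hence
   invertible. *)
Lemma split_basis_is_basis :
  (forall x, exists a, x = comb a) /\ (forall a, comb a = 0 -> forall j, a j = 0).
Proof.
have [m [e [he e0]]] := @fil_free S c A c (leqnn c).
have ex x : exists u : 'rV[S]_m, x = \sum_i u 0 i *: e i.
  have /he[u ->] := fil_top x; exists (\row_i u i).
  by apply: eq_bigr => i _; rewrite mxE.
have uniq_e (u v : 'rV[S]_m) : \sum_i u 0 i *: e i = \sum_i v 0 i *: e i -> u = v.
  move=> /eqP; rewrite -subr_eq0 -sumrB => /eqP h; apply/rowP => i; apply/eqP.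
  rewrite -subr_eq0; apply/eqP/(e0 (fun i => u 0 i - v 0 i)); rewrite -[RHS]h.
  by apply: eq_bigr => i' _; rewrite scalerBl.
have inm (u : 'rV[S]_m) : inmA (\sum_i u 0 i *: e i) -> map_mx rho u = 0.
  case=> p [s [v [hv eu]]]; have [w Hw] : exists w : 'I_p -> 'rV[S]_m, forall t, v t = \sum_i w t 0 i *: e i.
    have h t : {w : 'rV[S]_m | v t = \sum_i w 0 i *: e i}.
      by apply: constructive_indefinite_description; apply: ex.
    by exists (fun t => sval (h t)) => t; apply: (svalP (h t)).
  have -> : u = \sum_t s t *: w t.
    apply: uniq_e; rewrite eu; under [LHS]eq_bigr do rewrite Hw scaler_sumr.
    rewrite exchange_big; apply: eq_bigr => i _ /=; rewrite summxE scaler_suml.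
    by apply: eq_bigr => t _; rewrite mxE scalerA.
  apply/rowP => i; rewrite !mxE summxE rmorph_sum big1 // => t _.
  by rewrite mxE rmorphM ((max_idealE _).1 (hv t).1) mul0r.
have in_inm (u : 'rV[S]_m) : map_mx rho u = 0 -> inmA (\sum_i u 0 i *: e i).
  move=> /rowP h; apply: setmul_sum => i _; apply: setmul1 => //.
  by apply/max_idealE; have := h i; rewrite !mxE.
have [p0 Hp] : exists p : 'I_n -> 'rV[S]_m, forall j, sb_vec b j = \sum_i p j 0 i *: e i.
  exact: (@fin_all_exists _ _ (fun j (p : 'rV[S]_m) => sb_vec b j = \sum_i p 0 i *: e i)
    (fun j => ex (sb_vec b j))).
have [q0 Hq] : exists q : 'I_m -> 'rV[S]_n, forall i, inmA (e i - comb (q i 0)).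
  apply: (@fin_all_exists _ _ (fun i (q : 'rV[S]_n) => inmA (e i - comb (q 0)))) => i.
  have [a ha] := gen_mod_max (e i); exists (\row_j a j).
  by under eq_bigr do rewrite mxE.
pose P : 'M[S]_(n, m) := \matrix_j p0 j; pose Q : 'M[S]_(m, n) := \matrix_i q0 i.
have combE (a : 'rV[S]_n) : comb (a 0) = \sum_i (a *m P) 0 i *: e i.
  under [LHS]eq_bigr do rewrite Hp scaler_sumr.
  rewrite exchange_big; apply: eq_bigr => i _ /=; rewrite !mxE scaler_suml.
  by apply: eq_bigr => j _; rewrite !mxE scalerA.
have deltaE i : e i = \sum_i' (delta_mx 0 i : 'rV[S]_m) 0 i' *: e i'.
  rewrite (bigD1 i) //= mxE !eqxx scale1r big1 ?addr0 // => i' /negPf ni.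
  by rewrite mxE ni andbF scale0r.
have QP1 : map_mx rho (Q *m P) = 1%:M.
  apply/row_matrixP => i; rewrite -map_row row_mul row1; apply/eqP; rewrite eq_sym -subr_eq0.
  have := Hq i; rewrite -[q0 i](rowK q0) combE {1}deltaE -sumrB => h.
  have := inm (delta_mx 0 i - row i Q *m P); rewrite map_mxB map_delta_mx => ->//.
  rewrite (eq_bigr (fun i' => (delta_mx 0 i : 'rV[S]_m) 0 i' *: e i' - (row i Q *m P) 0 i' *: e i')) //.
  by move=> i' _; rewrite -scalerBl; congr (_ *: _); rewrite [LHS]mxE; congr (_ + _); rewrite mxE.
have freeP (y : 'rV[k]_n) : y *m map_mx rho P = 0 -> y = 0.
  have [a def_y] : exists a : 'rV[S]_n, y = map_mx rho a.
    have [a Ha] : exists a : 'I_n -> S, forall j, rho (a j) = y 0 j.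
      by apply: (@fin_all_exists _ _ (fun j a => rho a = y 0 j)) => j; apply: rho_surj.
    by exists (\row_j a j); apply/rowP => j; rewrite !mxE.
  rewrite def_y -map_mxM => /in_inm; rewrite -combE => /indep_mod_max h.
  by apply/rowP => j; rewrite !mxE; apply/max_idealE.
(* Modulo the maximal ideal [(P *m Q - 1) *m P] vanishes because [Q *m P] is the identity, and
   [freeP] cancels [P]; the two ranks are never compared. *)
have PQ1 : map_mx rho (P *m Q) = 1%:M.
  apply/row_matrixP => j; apply/eqP; rewrite -subr_eq0 -linearB; apply/eqP/freeP.
  by rewrite -row_mul mulmxBl mul1mx -map_mxM -mulmxA map_mxM QP1 mulmx1 subrr row0.
have unit_of r (B : 'M[S]_r) : map_mx rho B = 1%:M -> B \in unitmx.
  by move=> h; rewrite unitmxE; apply: rho_unit; rewrite -det_map_mx h det1 oner_neq0.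
split=> [x|a a0 j].
  have [u ->] := ex x; pose a := u *m invmx (Q *m P) *m Q.
  by exists (a 0); rewrite combE /a -!mulmxA mulVmx ?unit_of // mulmx1.
have : \row_j a j = 0.
  have aP : (\row_j a j) *m P = 0.
    apply: uniq_e; rewrite -combE [RHS]big1 => [|i _]; last by rewrite mxE scale0r.
    by apply: etrans a0; apply: eq_bigr => j' _; rewrite mxE.
  by rewrite -[LHS]mulmx1 -(mulmxV (unit_of _ _ PQ1)) !mulmxA aP !mul0mx.
by move/rowP/(_ j); rewrite !mxE.
Qed.

Lemma sb_coords : exists co : A -> 'I_n -> S, [/\ forall x, x = comb (co x),
    forall a j, co (comb a) j = a j,
    forall a x y j, co (a *: x + y) j = a * co x j + co y j &
    forall p x j, (p <= c)%N -> @fil S c A p x -> (p <= sb_w b j)%N -> co x j = 0].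
Proof.
have [ex un] := split_basis_is_basis.
pose co x := sval (constructive_indefinite_description _ (ex x)).
have coE x : x = comb (co x) := svalP (constructive_indefinite_description _ (ex x)).
have uniq_co a a' : comb a = comb a' -> a =1 a'.
  move=> /eqP; rewrite -subr_eq0 -sumrB => /eqP h j; apply/eqP.
  rewrite -subr_eq0; apply/eqP/(un (fun j => a j - a' j)); rewrite -[RHS]h.
  by apply: eq_bigr => i _; rewrite scalerBl.
exists co; split=> //.
- by move=> a; apply: uniq_co; rewrite -coE.
- move=> a x y; apply: uniq_co; rewrite -coE {1}(coE x) {1}(coE y) scaler_sumr -big_split.
  by apply: eq_bigr => j _; rewrite scalerDl scalerA.
move=> p x j le_p /(fil_decomp le_p)[y [By y0 def_x]] le_j.
pose z q := \sum_(j | sb_w b j == q) co x j *: sb_vec b j - y q.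
have z0 : forall q, z q = 0.
  apply: (fil_decomp_uniq (leqnn c)) => [q|q|].
  - apply: submodD (sb_submod b q) (block_in _ q) _; rewrite -scaleN1r.
    by apply: submodZ; first exact: sb_submod.
  - by rewrite leqNgt ltn_ord.
  by rewrite sumrB -comb_blocks -coE -def_x subrr.
have /eqP := z0 (sb_w b j); rewrite /z y0 // subr0 => /eqP h.
apply: etrans (un (fun l => if sb_w b l == sb_w b j then co x l else 0) _ j).
  by rewrite eqxx.
rewrite -[RHS]h [RHS]big_mkcond; apply: eq_bigr => l _.
by case: ifP => // _; rewrite scale0r.
Qed.

End SplitBasis.

(** * The layered data of a higher matrix factorization *)

Section Coordinates.
Variables (S : comUnitRingType) (k : fieldType) (rho : {rmorphism S -> k}).
Hypothesis k_residue : is_residue_field rho.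
Variables (c : nat) (f : 'I_c -> S) (f_regular : regular_seq f).
Variables (X : hmf f) (X_minimal : hmf_minimal X).
Variables (b0 : split_basis (hmf_A0 X)) (b1 : split_basis (hmf_A1 X)).
Local Notation n0 := (sb_n b0).
Local Notation n1 := (sb_n b1).
Local Notation J := ('I_n0 + 'I_n1)%type.
Local Notation Idx := ({set 'I_c} * J)%type.
Local Notation L := {ffun Idx -> S^o}.
Local Notation d := (hmf_d X).

Variables (co0 : hmf_A0 X -> 'I_n0 -> S) (co1 : hmf_A1 X -> 'I_n1 -> S).
Hypothesis co0E : forall x, x = \sum_j co0 x j *: sb_vec b0 j.
Hypothesis co0_comb : forall a j, co0 (\sum_j a j *: sb_vec b0 j) j = a j.
Hypothesis co0_lin : forall a x y j, co0 (a *: x + y) j = a * co0 x j + co0 y j.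
Hypothesis co0_fil : forall p x j, (p <= c)%N -> fil p x -> (p <= sb_w b0 j)%N -> co0 x j = 0.
Hypothesis co1E : forall x, x = \sum_j co1 x j *: sb_vec b1 j.
Hypothesis co1_comb : forall a j, co1 (\sum_j a j *: sb_vec b1 j) j = a j.
Hypothesis co1_lin : forall a x y j, co1 (a *: x + y) j = a * co1 x j + co1 y j.
Hypothesis co1_fil : forall p x j, (p <= c)%N -> fil p x -> (p <= sb_w b1 j)%N -> co1 x j = 0.

Definition cwt (j : J) : 'I_c := match j with inl l => sb_w b0 l | inr l => sb_w b1 l end.
Definition csd (j : J) : nat := match j with inl _ => 0%N | inr _ => 1%N end.

(** The coordinates of [d] on a basis vector of [A_1], thus of [b_p] and [psi_p] at once. *)
Definition cxv (j : J) : L :=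
  match j with
  | inl _ => 0
  | inr l => \sum_i co0 (d (sb_vec b1 l)) i *: fdelta S (set0, inl i)
  end.

(** Identifies the degree 0 part of the layered complex with [A_0] and kills all other basis
    vectors. *)
Definition qv (m : Idx) : hmf_A0 X :=
  if m.1 == set0 then match m.2 with inl l => sb_vec b0 l | inr _ => 0 end else 0.

Local Notation q := (lin qv).
Local Notation base := (in_base cwt csd).

Lemma csd_le1 j : (csd j <= 1)%N. Proof. by case: j. Qed.

Lemma q_delta l : q (fdelta S (set0, inl l)) = sb_vec b0 l.
Proof. by rewrite lin_fdelta /qv eqxx. Qed.

Lemma q_xv l : q (cxv (inr l)) = d (sb_vec b1 l).
Proof.
rewrite /cxv lin_sum [RHS]co0E; apply: eq_bigr => i _.
by rewrite linZ q_delta.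
Qed.

Lemma base_expand p x : onf (base p) x -> x = \sum_l x (set0, inl l) *: fdelta S (set0, inl l).
Proof.
move=> hx; apply/ffunP => -[A [l|l]]; rewrite sum_ffunE.
  have [->|nA] := eqVneq A set0; last first.
    rewrite ((onfP _ _).1 hx) ?big1 //; last by rewrite /in_base /= negb_and nA.
    by move=> l' _; rewrite !ffunE xpair_eqE (negPf nA) scaler0.
  rewrite (bigD1 l) //= big1 => [|l' nl]; rewrite !ffunE.
    by rewrite eqxx addr0 [_ *: _]mulr1.
  by case: eqP => [[e]|_]; [rewrite e eqxx in nl | exact: mulr0].
rewrite ((onfP _ _).1 hx) ?big1 //; last by rewrite /in_base /= andbF.
by move=> l' _; rewrite !ffunE xpair_eqE andbF scaler0.
Qed.

Lemma q_inj p x y : onf (base p) x -> onf (base p) y -> q x = q y -> x = y.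
Proof.
move=> hx hy e; rewrite (base_expand hx) (base_expand hy); apply: eq_bigr => l _.
have qE z : onf (base p) z -> co0 (q z) l = z (set0, inl l).
  move=> hz; rewrite (base_expand hz) lin_sum.
  rewrite (eq_bigr (fun l => z (set0, inl l) *: sb_vec b0 l)) => [|i _]; last by rewrite linZ q_delta.
  by rewrite co0_comb -(base_expand hz).
by rewrite -(qE x hx) -(qE y hy) e.
Qed.

Lemma fil_lift p x : (p < c)%N -> fil p.+1 x -> exists2 z, onf (base p) z & q z = x.
Proof.
move=> lt_p hx; exists (\sum_l co0 x l *: fdelta S (set0, inl l)).
  apply: onf_sum => l _; have [le_l|lt_l] := leqP (sb_w b0 l) p.
    by apply/onfZ/onf_fdelta; rewrite /in_base /= eqxx le_l.
  by rewrite (co0_fil _ hx) // scale0r; apply: onf0.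
rewrite lin_sum [RHS]co0E; apply: eq_bigr => i _; by rewrite linZ q_delta.
Qed.

Lemma top_lift x : exists2 z, onf (base c) z & q z = x.
Proof.
exists (\sum_l co0 x l *: fdelta S (set0, inl l)).
  by apply: onf_sum => l _; apply/onfZ/onf_fdelta; rewrite /in_base /= eqxx ltnW.
rewrite lin_sum [RHS]co0E; apply: eq_bigr => i _; by rewrite linZ q_delta.
Qed.

Lemma setmul_lift (I : S -> Prop) (N : hmf_A0 X -> Prop) p y :
  (forall x, N x -> exists2 z, onf (base p) z & q z = x) -> setmul I N y ->
  exists2 z, setmul I (onf (base p)) z & q z = y.
Proof.
move=> lift h; apply: (@setmul_ind _ _ I N (fun y => exists2 z, setmul I (onf (base p)) z & q z = y) y) => //.
- by exists 0; [apply: setmul0 | rewrite lin0].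
- by move=> u v [z hz <-] [w hw <-]; exists (z + w); [apply: setmulD | rewrite linD].
by move=> a x Ia /lift[z hz <-]; exists (a *: z); [apply: setmul1 | rewrite linZ].
Qed.

Lemma setmul_base (I : S -> Prop) p x : setmul I (onf (base p)) x -> onf (base p) x.
Proof.
by apply: setmul_ind; [exact: onf0 | exact: onfD | move=> a y _; exact: onfZ].
Qed.

Lemma base_fil p x : (p < c)%N -> onf (base p) x -> fil p.+1 (q x).
Proof.
move=> lt_p; have sub := fil_submod (hmf_A0 X) lt_p.
apply: lin_ind => [|u v|a u|[A [l|l]] /and3P[//= /eqP-> _ le_l]].
- exact: submod0 sub.
- exact: submodD sub.
- exact: submodZ sub.
by rewrite /qv eqxx /=; apply: (fil_mono b0 _ _ (sb_fil (sb_in l))).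
Qed.

Lemma cxv_supp j : onf (fun m : Idx =>
  [&& m.1 == set0, csd m.2 == 0%N, (cwt m.2 <= cwt j)%N & csd j == 1%N]) (cxv j).
Proof.
case: j => l; first exact: onf0.
apply: onf_sum => i _; have [le_i|lt_i] := leqP (sb_w b0 i) (sb_w b1 l).
  by apply/onfZ/onf_fdelta; rewrite /= eqxx le_i.
rewrite (co0_fil _ _ lt_i) ?scale0r //; first exact: onf0.
by apply: hmf_d_fil => //; apply: sb_fil; apply: sb_in.
Qed.

Lemma co_max x l : setmul (@max_ideal S) (fun _ : hmf_A0 X => True) x -> max_ideal (co0 x l).
Proof.
have mI := max_ideal_is_ideal k_residue.
have co00 : co0 0 l = 0.
  by have := co0_comb (fun=> 0) l; rewrite big1 // => j _; rewrite scale0r.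
apply: (@setmul_ind _ _ _ _ (fun x => max_ideal (co0 x l))).
- by rewrite co00; apply: max_ideal0 mI.
- move=> u v hu hv; rewrite -[u]scale1r co0_lin mul1r.
  exact: (max_idealD mI).
- move=> a u ha _; rewrite -[a *: u]addr0 co0_lin co00 addr0 mulrC.
  exact: (max_idealM mI).
Qed.

Lemma cxv_minimal j m : @max_ideal S (cxv j m).
Proof.
have mI := max_ideal_is_ideal k_residue.
case: j => l; first by rewrite ffunE; apply: max_ideal0 mI.
rewrite sum_ffunE; elim/big_ind: _ => [||i _]; [exact: max_ideal0 mI | exact: (max_idealD mI) |].
rewrite ffunE [_ *: _]mulrC; apply: (max_idealM mI).
by apply: co_max; case: X_minimal.
Qed.

Lemma sum_inr (F : J -> L) : (forall l, F (inl l) = 0) -> \sum_j F j = \sum_l F (inr l).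
Proof.
by move=> h; rewrite big_sumType /= big1 ?add0r.
Qed.

Lemma q_sum_xv (s : J -> S) : q (\sum_j s j *: cxv j) = d (\sum_l s (inr l) *: sb_vec b1 l).
Proof.
rewrite sum_inr => [|l]; last by rewrite scaler0.
by rewrite lin_sum linear_sum; apply: eq_bigr => l _; rewrite linZ q_xv linearZ.
Qed.

Lemma cxv_htpy (p : 'I_c) j : csd j = 0%N -> (cwt j <= p)%N ->
  exists s : J -> S, (forall j, ~~ ((csd j == 1%N) && (cwt j <= p)%N) -> s j = 0) /\
    setmul (first_elts f p) (onf (base p)) (f p *: fdelta S (set0, j) - \sum_j s j *: cxv j).
Proof.
case: j => [l|//] _ /= le_l.
have fl : fil p.+1 (sb_vec b0 l) by apply: (fil_mono b0 _ _ (sb_fil (sb_in l))).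
have fh := hmf_h_fil fl.
pose s (j : J) := match j with inl _ => 0 | inr l' => co1 (hmf_h X p (sb_vec b0 l)) l' end.
have hs j : ~~ ((csd j == 1%N) && (cwt j <= p)%N) -> s j = 0.
  by case: j => [//|l'] /=; rewrite -ltnNge => lt_l; apply: co1_fil fh _.
exists s; split=> //.
have [z hz qz] := setmul_lift (fun x => @fil_lift p x (ltn_ord p)) (hmf_dh fl).
have -> : f p *: fdelta S (set0, inl l) - \sum_j s j *: cxv j = -1 *: z.
  apply: (@q_inj p).
  - apply: onfD; first by apply/onfZ/onf_fdelta; rewrite /in_base /= eqxx le_l.
    apply/onfN/onf_sum => j _; have [/andP[_ le_j]|/hs->] := boolP ((csd j == 1%N) && (cwt j <= p)%N).
      apply/onfZ; apply: (onfW _ (@cxv_supp j)) => m /and4P[m0 s0 le_w _].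
      by rewrite /in_base m0 s0 (leq_trans le_w).
    by rewrite scale0r; apply: onf0.
  - exact/onfZ/(setmul_base hz).
  by rewrite linB linZ q_delta q_sum_xv linZ qz -co1E scaleN1r opprB.
case: hz => [n [b [y [hy ->]]]]; rewrite scaler_sumr; apply: setmul_sum => i _.
rewrite scalerA mulrC -scalerA; apply: setmul1; case: (hy i) => // _.
exact: onfZ.
Qed.

Lemma hmf_hB (p : 'I_c) m (a : 'I_m -> S) y : (forall t, fil p.+1 (y t)) ->
  hmf_h X p (\sum_t a t *: y t) = \sum_t a t *: hmf_h X p (y t).
Proof.
move=> hy; have sub := fil_submod (hmf_A0 X) (ltn_ord p).
have h0 : hmf_h X p 0 = 0.
  have := @hmf_h_linear _ _ _ X p 1 0 0 (submod0 sub) (submod0 sub).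
  by rewrite !scale1r addr0 => /eqP; rewrite -subr_eq subrr eq_sym => /eqP.
suff: hmf_h X p (\sum_t a t *: y t) = \sum_t a t *: hmf_h X p (y t) /\ fil p.+1 (\sum_t a t *: y t) by case.
elim/big_ind2: _ => [|u u' v v' [e1 h1] [e2 h2]|t _]; first by split=> //; exact: submod0 sub.
  split; last exact: submodD sub _ _.
  by rewrite -[u']scale1r hmf_h_linear // scale1r e1 e2.
split; last exact: submodZ sub _.
by rewrite -[a t *: y t]addr0 hmf_h_linear ?h0 ?addr0 //; exact: submod0 sub.
Qed.

(** Let [x] have coordinates [s]. As [d x] is a combination with coefficients among the smaller
    [f_i], so is [h_p (d x)], and axiom (b) places [f_p x] in [A_1(p-1)] modulo these [f_i]. A
    coordinate belonging to [B_1(p)] does not see [A_1(p-1)], and regularity cancels [f_p]. *)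
Lemma cxv_regular (p : 'I_c) (s : J -> S) :
  (forall j, ~~ ((csd j == 1%N) && (cwt j <= p)%N) -> s j = 0) ->
  setmul (first_elts f p) (onf (base p)) (\sum_j s j *: cxv j) ->
  forall j, cwt j = p -> csd j = 1%N -> ideal_gen (first_elts f p) (s j).
Proof.
move=> hs hz [//|l] /= wl _; apply: (f_regular.1 p).
pose x := \sum_l s (inr l) *: sb_vec b1 l.
have fx : fil p.+1 x.
  apply: submod_sum (fil_submod (hmf_A1 X) (ltn_ord p)) _ => l' _.
  have sub := fil_submod (hmf_A1 X) (ltn_ord p).
  have [/= le_l|/= nl] := boolP (cwt (inr l') <= p)%N.
    by apply: submodZ sub _; apply: (fil_mono b1 _ _ (sb_fil (sb_in l'))).
  by rewrite hs ?(negPf nl) // scale0r; apply: submod0 sub.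
have hx : setmul (first_elts f p) (fil p.+1) (d x).
  by rewrite -q_sum_xv; apply: setmul_map hz => y; apply: base_fil.
have hhx : setmul (first_elts f p) (fil p.+1) (hmf_h X p (d x)).
  case: hx => m [a [y [hy ->]]]; rewrite hmf_hB => [|t]; last by case: (hy t).
  by apply: setmul_sum => t _; case: (hy t) => Ja fy; apply: setmul1 => //; apply: hmf_h_fil.
have coM u : setmul (first_elts f p) (fil p.+1) u -> ideal_gen (first_elts f p) (co1 u l).
  have co10 : co1 0 l = 0.
    by have := co1_comb (fun=> 0) l; rewrite big1 // => j _; rewrite scale0r.
  apply: (@setmul_ind _ _ _ _ (fun u => ideal_gen (first_elts f p) (co1 u l))).
  - by rewrite co10; apply: (@setmul0 _ S^o).
  - move=> v w hv hw; rewrite -[v]scale1r co1_lin mul1r; exact: (@setmulD _ S^o).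
  - move=> a v Ja _; rewrite -[a *: v]addr0 co1_lin co10 addr0 mulrC.
    by apply: (@setmul1 _ S^o).
have [y [z [fy hz' e]]] := hmf_hd fx.
have : f p *: x = hmf_h X p (d x) - (y + z) by rewrite -e opprB addrC subrK.
move/(congr1 (fun u => co1 u l)); rewrite -[f p *: x]addr0 -[_ - _]addrC -scaleN1r !co1_lin.
have -> : co1 x l = s (inr l) by apply: co1_comb.
have -> : co1 0 l = 0 by have := co1_comb (fun=> 0) l; rewrite big1 // => j _; rewrite scale0r.
rewrite addr0 -[y]scale1r co1_lin mul1r (co1_fil _ fy) ?wl // ?add0r => [->|]; last exact: ltnW.
apply: (@setmulD _ S^o); last exact: coM.
by apply: (@submod_genZ _ S^o); apply: coM.
Qed.

End Coordinates.

(** * Comparison with an arbitrary resolution *)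

Section Comparison.
Variable S : comUnitRingType.

Lemma linear_exists (V W : lmodType S) (h : V -> W) : linear h ->
  exists g : {linear V -> W}, forall x, g x = h x.
Proof.
move=> lin_h; pose m := GRing.isLinear.Build S V W *:%R h lin_h.
pose g : {linear V -> W} := HB.pack h m.
by exists g.
Qed.

Lemma free_lift (P Q Z : lmodType S) (g : {linear P -> Z}) (h : {linear Q -> Z}) :
  fg_free (fun _ : P => True) -> (forall x, exists y, h y = g x) ->
  exists s : {linear P -> Q}, forall x, h (s x) = g x.
Proof.
case=> n [b [hb b0]] hgh.
have co x : {a : 'I_n -> S | x = \sum_i a i *: b i}.
  by apply: constructive_indefinite_description; apply/hb.
have y i : {y | h y = g (b i)} by apply: constructive_indefinite_description.
pose t x := \sum_i sval (co x) i *: sval (y i).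
have lin_t : linear t.
  move=> a u v; rewrite /t scaler_sumr -big_split; apply: eq_bigr => i _ /=.
  rewrite scalerA -scalerDl; congr (_ *: _); apply/eqP; rewrite -subr_eq0; apply/eqP.
  apply: (b0 (fun i => sval (co (a *: u + v)) i - (a * sval (co u) i + sval (co v) i))).
  under eq_bigr do rewrite scalerBl scalerDl -scalerA.
  rewrite sumrB big_split -scaler_sumr /= -!(svalP (co _)).
  exact: subrr.
have [s sE] := linear_exists lin_t; exists s => x.
rewrite sE {2}(svalP (co x)) !linear_sum; apply: eq_bigr => i _.
by rewrite !linearZ /= (svalP (y i)).
Qed.

Variables (P Q : nat -> lmodType S).
Variables (dP : forall n, {linear P n.+1 -> P n}) (dQ : forall n, {linear Q n.+1 -> Q n}).
Hypothesis P_free : forall n, fg_free (fun _ : P n => True).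
Hypothesis Q_exact : forall n (x : Q n.+1), dQ n x = 0 -> exists y, x = dQ n.+1 y.

Lemma chain_lift (g0 : {linear P 0 -> Q 0}) :
  (forall n x, dP n (dP n.+1 x) = 0) -> (forall x, exists y, g0 (dP 0 x) = dQ 0 y) ->
  exists g : forall n, {linear P n -> Q n},
    g 0%N = g0 /\ forall n x, dQ n (g n.+1 x) = g n (dP n x).
Proof.
move=> dd h0; pose X n := {linear P n -> Q n}.
pose I n (g : X n) := forall x, exists y, g (dP n x) = dQ n y.
pose R n (g : X n) (g' : X n.+1) := forall x, dQ n (g' x) = g (dP n x).
have [n g hg|g [e _ hg]] := @dependent_choice_nat X I R g0 h0.
  have [g' hg'] := @free_lift _ _ _ (g \o dP n) (dQ n) (P_free n.+1) (fun x =>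
    let: ex_intro y e := hg x in ex_intro _ y (esym e)).
  exists g'; split=> // x; apply: Q_exact; rewrite hg' /= dd linear0 //.
by exists g.
Qed.

(** The scalar [e] covers chain maps, with [e = 1], and maps anticommuting with the differentials,
    with [e = -1], such as the difference of two systems of homotopies. *)
Lemma chain_homotopy (e : S) (g : forall n, {linear P n -> Q n}) : e * e = 1 ->
  (forall n x, dP n (dP n.+1 x) = 0) ->
  (forall n x, dQ n (g n.+1 x) = e *: g n (dP n x)) -> (forall x, exists y, g 0 x = dQ 0 y) ->
  exists s : forall n, {linear P n -> Q n.+1}, (forall x, g 0 x = dQ 0 (s 0 x)) /\
    forall n x, g n.+1 x = dQ n.+1 (s n.+1 x) + e *: s n (dP n x).
Proof.
move=> ee dd hg h0; pose X n := {linear P n -> Q n.+1}.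
pose D n (s : X n) : {linear P n.+1 -> Q n.+1} := g n.+1 \- (e \*: (s \o dP n)).
have [s0 hs0] : exists s : X 0%N, forall x, dQ 0 (s x) = g 0 x.
  by apply: free_lift => // x; have [y ->] := h0 x; exists y.
pose I n (s : X n) := forall x, dQ n (s (dP n x)) = g n (dP n x).
pose R n (s : X n) (s' : X n.+1) := forall x, dQ n.+1 (s' x) = D n s x.
have I0 : I 0%N s0 by move=> x; apply: hs0.
have [n s hs|s [es _ hs]] := @dependent_choice_nat X I R s0 I0.
  have [x|s' hs'] := @free_lift _ _ _ (D n s) (dQ n.+1) (P_free n.+1).
    have [|y ey] := Q_exact (x := D n s x).
      by rewrite /D /= linearB /= linearZ /= hg hs subrr.
    by exists y.
  exists s'; split=> // x; rewrite hs' /D /= dd linear0 scaler0 subr0 //.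
exists s; split=> [x|n x]; first by rewrite es hs0.
by rewrite hs /D /= subrK.
Qed.

End Comparison.

Section AugmentedComparison.
Variables (S : comUnitRingType) (M : lmodType S) (P Q : nat -> lmodType S).
Variables (dP : forall n, {linear P n.+1 -> P n}) (dQ : forall n, {linear Q n.+1 -> Q n}).
Variables (aP : {linear P 0 -> M}) (aQ : {linear Q 0 -> M}).
Hypothesis P_free : forall n, fg_free (fun _ : P n => True).
Hypothesis dP_dP : forall n x, dP n (dP n.+1 x) = 0.
Hypothesis aP_dP : forall x, aP (dP 0 x) = 0.
Hypothesis Q_exact : forall n (x : Q n.+1), dQ n x = 0 -> exists y, x = dQ n.+1 y.
Hypothesis Q_exact0 : forall x, aQ x = 0 -> exists y, x = dQ 0 y.
Hypothesis Q_surj : forall m, exists x, aQ x = m.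

Lemma augmented_lift : exists g : forall n, {linear P n -> Q n},
  (forall x, aQ (g 0%N x) = aP x) /\ forall n x, dQ n (g n.+1 x) = g n (dP n x).
Proof.
have [g0 hg0] := free_lift (h := aQ) (P_free 0) (fun x => Q_surj (aP x)).
have [x|g [e hg]] := chain_lift (g0 := g0) P_free Q_exact dP_dP.
  by apply: Q_exact0; rewrite hg0 aP_dP.
by exists g; rewrite e.
Qed.

Lemma augmented_homotopy (g : forall n, {linear P n -> Q n}) :
  (forall n x, dQ n (g n.+1 x) = g n (dP n x)) -> (forall x, aQ (g 0%N x) = 0) ->
  exists s : forall n, {linear P n -> Q n.+1}, (forall x, g 0 x = dQ 0 (s 0 x)) /\
    forall n x, g n.+1 x = dQ n.+1 (s n.+1 x) + s n (dP n x).
Proof.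
move=> hg h0.
have hg1 n x : dQ n (g n.+1 x) = 1 *: g n (dP n x) by rewrite scale1r.
have h1 x : exists y, g 0%N x = dQ 0 y by apply: Q_exact0.
have [s [s0 sS]] := chain_homotopy P_free Q_exact (mulr1 1) dP_dP hg1 h1.
by exists s; split=> // n x; rewrite sS scale1r.
Qed.

End AugmentedComparison.

(** * The layered complex as a sequence of free modules *)

Section GradedPieces.
Variables (S : comUnitRingType) (c : nat) (f : 'I_c -> S) (J : finType).
Variables (wt : J -> 'I_c) (sd : J -> nat).
Local Notation Idx := ({set 'I_c} * J)%type.
Local Notation L := {ffun Idx -> S^o}.
Local Notation ok := (layer_ok wt [pred j | (wt j < c)%N]).
Local Notation deg := (ldeg sd).
Variables (xv : J -> L) (Dv : Idx -> L) (sv : 'I_c -> Idx -> L).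
Hypothesis LC : lcomplex f wt sd xv c [pred j | (wt j < c)%N] Dv sv.

(** The layered complex was built as one module with inhomogeneous elements, while a resolution is a
    sequence of modules; its terms are cut out by restricting the index type. *)
Definition gidx n := {m : Idx | ok m && (deg m == n)}.
Definition gpiece n : lmodType S := {ffun gidx n -> S^o}.

Lemma okE m : ok m = blw (wt m.2) m.1.
Proof. by rewrite /layer_ok inE ltn_ord. Qed.

Definition gemb n : {linear gpiece n -> L} := lin (fun m : gidx n => fdelta S (val m)).
Definition gres_fun n (x : L) : gpiece n := [ffun m : gidx n => x (val m)].

Lemma gres_linear n : linear (gres_fun n).
Proof. by move=> a x y; apply/ffunP => m; rewrite !ffunE. Qed.

HB.instance Definition _ n := GRing.isLinear.Build S L (gpiece n) *:%R (gres_fun n) (gres_linear n).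
Definition gres n : {linear L -> gpiece n} := gres_fun n.

Definition homog n := onf (S := S) (fun m : Idx => ok m && (deg m == n)).

Lemma gemb_homog n x : homog n (gemb n x).
Proof. by apply: onf_sum => m _; apply/onfZ/onf_fdelta/(valP m). Qed.

Arguments gemb_homog {n} x m _.

Lemma gembE n (x : gpiece n) (m : gidx n) : gemb n x (val m) = x m.
Proof.
rewrite /gemb /= /lin sum_ffunE (bigD1 m) //= big1 => [|i /negPf ni].
  by rewrite !ffunE eqxx addr0 [_ *: _]mulr1.
by rewrite !ffunE (inj_eq val_inj) eq_sym ni [_ *: _]mulr0.
Qed.

Lemma gresK n x : gres n (gemb n x) = x.
Proof. by apply/ffunP => m; rewrite ffunE gembE. Qed.

Lemma gembK n x : homog n x -> gemb n (gres n x) = x.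
Proof.
rewrite /homog => hx; apply/ffunP => m; have [h|h] := boolP (ok m && (deg m == n)).
  by rewrite -[m]/(val (exist _ m h : gidx n)) gembE ffunE.
by rewrite ((onfP _ _).1 hx) // ((onfP _ _).1 (gemb_homog _)).
Qed.

Lemma gemb_inj n : injective (gemb n).
Proof. exact: can_inj (@gresK n). Qed.

Lemma gpiece_free n : fg_free (fun _ : gpiece n => True).
Proof.
exists #|{: gidx n}|, (fun i => fdelta S (enum_val i)); split=> [x|a a0 i].
  split=> // _; exists (fun i => x (enum_val i)).
  rewrite {1}[x]fdelta_sum (reindex (@enum_val _ {: gidx n})) //.
  exact/onW_bij/enum_val_bij.
have := congr1 (fun x : gpiece n => x (enum_val i)) a0.
rewrite sum_ffunE (bigD1 i) //= big1 => [|l nl].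
  by rewrite !ffunE eqxx addr0 [_ *: _]mulr1.
by rewrite !ffunE (inj_eq enum_val_inj) eq_sym (negPf nl) [_ *: _]mulr0.
Qed.

Definition gd n : {linear gpiece n.+1 -> gpiece n} := gres n \o lin Dv \o gemb n.+1.
Definition gsigma (i : 'I_c) n : {linear gpiece n -> gpiece n.+1} :=
  gres n.+1 \o lin (sv i) \o gemb n.

Lemma homog_ok n x : homog n x -> onf ok x.
Proof. by move=> hx; apply: (onfW _ hx) => m /andP[]. Qed.

Lemma homog_D n x : homog n.+1 x -> homog n (lin Dv x).
Proof.
apply: onf_lin => m /andP[ok_m /eqP dm].
by apply: (onfW _ (lc_complex LC ok_m).1) => m' /andP[-> ]; rewrite dm eqSS.
Qed.

Lemma homog_D0 x : homog 0 x -> lin Dv x = 0.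
Proof.
apply: lin0_on => m /andP[ok_m /eqP dm]; apply/ffunP => m'; rewrite [RHS]ffunE.
by apply: ((onfP _ _).1 (lc_complex LC ok_m).1); rewrite dm andbF.
Qed.

Lemma homog_sigma i n x : homog n x -> homog n.+1 (lin (sv i) x).
Proof.
apply: onf_lin => m /andP[ok_m /eqP <-].
exact: (lc_homotopy LC (ltn_ord i) ok_m isT).1.
Qed.

Lemma gemb_d n x : gemb n (gd n x) = lin Dv (gemb n.+1 x).
Proof. by rewrite gembK //; apply/homog_D/gemb_homog. Qed.

Lemma gemb_sigma i n x : gemb n.+1 (gsigma i n x) = lin (sv i) (gemb n x).
Proof. by rewrite gembK //; apply/homog_sigma/gemb_homog. Qed.

Lemma gd_gd n x : gd n (gd n.+1 x) = 0.
Proof.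
apply: (@gemb_inj n); rewrite !gemb_d linear0 (DD (lc_complex LC)) //.
exact: homog_ok (gemb_homog _).
Qed.

Lemma homog_boundary n y : onf ok y -> homog n (lin Dv y) ->
  exists z : gpiece n.+1, lin Dv y = gemb n (gd n z).
Proof.
move=> hy hD; exists (gres n.+1 (res (fun m => deg m == n.+1) y)).
rewrite gemb_d gembK; last by apply: onfI; [exact: onf_res2 | exact: onf_res].
rewrite (D_res (lc_complex LC)) // res_id //.
by apply: (onfW _ hD) => m /andP[].
Qed.

Lemma gd_exact n (x : gpiece n.+1) : gd n x = 0 -> exists y, x = gd n.+1 y.
Proof.
move=> x0; have hx := gemb_homog x.
have [|m dm|y hy def_x] := lc_acyclic LC (homog_ok hx).
- by rewrite -gemb_d x0 linear0.
- by apply: ((onfP _ _).1 hx); rewrite dm andbF.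
have [|z hz] := @homog_boundary n.+1 y hy; first by rewrite -def_x.
by exists z; apply: (@gemb_inj n.+1); rewrite -hz.
Qed.

Lemma gsigma0 i (x : gpiece 0) : gd 0 (gsigma i 0 x) = f i *: x.
Proof.
apply: (@gemb_inj 0); rewrite gemb_d gemb_sigma linearZ /=.
rewrite -(homotopy_lin (lc_homotopy LC (ltn_ord i)) (homog_ok (gemb_homog x))) //.
by rewrite (homog_D0 (gemb_homog x)) lin0 addr0.
Qed.

Lemma gsigmaS i n (x : gpiece n.+1) :
  gd n.+1 (gsigma i n.+1 x) + gsigma i n (gd n x) = f i *: x.
Proof.
apply: (@gemb_inj n.+1); rewrite linearD linearZ /= gemb_d !gemb_sigma gemb_d.
by rewrite -(homotopy_lin (lc_homotopy LC (ltn_ord i)) (homog_ok (gemb_homog x))).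
Qed.

End GradedPieces.

(** * Tor in terms of the layered resolution *)

Section TorComparison.
Variables (S : comUnitRingType) (k : fieldType) (rho : {rmorphism S -> k}).
Hypothesis k_residue : is_residue_field rho.
Variables (c : nat) (f : 'I_c -> S).
Variables (X : hmf f) (b0 : split_basis (hmf_A0 X)) (b1 : split_basis (hmf_A1 X)).
Variables (M : lmodType S) (mu : {linear hmf_A0 X -> M}).
Hypothesis M_mod : is_hmf_module mu.
Variable F : free_resolution M.
Variable sigma : 'I_c -> forall n, {linear F n -> F n.+1}.
Hypothesis sigma_homotopy : are_homotopies f sigma.
Variables (T : lmodType (extalg k c)) (cl : forall n, F n -> T).
Hypothesis T_Tor : is_Tor rho sigma cl.
Variables (alpha0 : {linear hmf_A0 X -> F 0%N}) (alpha1 : {linear hmf_A1 X -> F 1%N}).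
Hypothesis alpha0_lift : forall x, fr_aug F (alpha0 x) = mu x.
Hypothesis alpha1_lift : forall x, fr_d F 0%N (alpha1 x) = alpha0 (hmf_d X x).

Local Notation n0 := (sb_n b0).
Local Notation n1 := (sb_n b1).
Local Notation J := ('I_n0 + 'I_n1)%type.
Local Notation Idx := ({set 'I_c} * J)%type.
Local Notation L := {ffun Idx -> S^o}.
Local Notation d := (hmf_d X).
Local Notation inm := (setmul (@max_ideal S) (fun _ => True)).

Lemma setmul_max (V : lmodType S) (a : S) (x : V) : max_ideal a -> inm (a *: x).
Proof. by move=> ha; apply: setmul1. Qed.

Lemma setmul_all (I : S -> Prop) (V W : lmodType S) (h : {linear V -> W}) x :
  setmul I (fun _ => True) x -> setmul I (fun _ => True) (h x).
Proof. exact: setmul_map. Qed.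

Lemma setmulN (V : lmodType S) (x : V) : inm x -> inm (- x).
Proof.
move=> hx; rewrite -scaleN1r; apply: setmulZ hx => a.
by apply: (max_idealM (max_ideal_is_ideal k_residue)).
Qed.

Lemma boundary_cycle n (y : F n.+1) : Defs.cycle (fr_d F n y).
Proof.
case: n y => [//|n] y /=; have -> : fr_d F n (fr_d F n.+1 y) = 0 by apply/fr_exactS; exists y.
exact: setmul0.
Qed.

Lemma cycle_inm n (x : F n) : inm x -> Defs.cycle x.
Proof. by case: n x => [//|n] x; apply: setmul_all. Qed.

Lemma cycleL n a (x y : F n) : Defs.cycle x -> Defs.cycle y -> Defs.cycle (a *: x + y).
Proof.
case: n x y => [//|n] x y hx hy /=; rewrite linearD linearZ /=; apply: setmulD => //.
by apply: setmulZ hx => e; apply: (max_idealM (max_ideal_is_ideal k_residue)).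
Qed.

Lemma cycle0 n : Defs.cycle (0 : F n).
Proof. by apply: cycle_inm; apply: setmul0. Qed.

Lemma cl0 n : cl (0 : F n) = 0.
Proof.
apply/(tor_ker T_Tor); first exact: cycle0.
by exists 0; rewrite linear0 subr0; apply: setmul0.
Qed.

Lemma cl_eq n (x y z : F n) (w : F n.+1) : Defs.cycle y -> inm z -> x = y + fr_d F n w + z ->
  cl x = cl y.
Proof.
move=> cy mz ->; pose u := fr_d F n w + z.
have cu : Defs.cycle u by rewrite /u -[fr_d F n w]scale1r; apply: cycleL (boundary_cycle _) (cycle_inm mz).
have u0 : cl u = 0.
  by apply/(tor_ker T_Tor) => //; exists w; rewrite /u addrAC subrr add0r.
rewrite -addrA -[y]scale1r (tor_linear T_Tor) // u0 addr0.
by rewrite rmorph1 !scale1r.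
Qed.

Lemma fr_dd n (x : F n.+2) : fr_d F n (fr_d F n.+1 x) = 0.
Proof. by apply/fr_exactS; exists x. Qed.

Lemma fr_aug_d x : fr_aug F (fr_d F 0%N x) = 0.
Proof. by apply/fr_exact0; exists x. Qed.

Variables (co0 : hmf_A0 X -> 'I_n0 -> S) (co1 : hmf_A1 X -> 'I_n1 -> S).
Hypothesis co0E : forall x, x = \sum_j co0 x j *: sb_vec b0 j.
Hypothesis co0_comb : forall a j, co0 (\sum_j a j *: sb_vec b0 j) j = a j.
Hypothesis co0_fil : forall p x j, (p <= c)%N -> fil p x -> (p <= sb_w b0 j)%N -> co0 x j = 0.
Hypothesis co1E : forall x, x = \sum_j co1 x j *: sb_vec b1 j.

Local Notation wt := (@cwt _ _ _ X b0 b1).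
Local Notation sd := (@csd _ _ _ X b0 b1).
Local Notation xv := (@cxv _ _ _ X b0 b1 co0).
Local Notation q := (lin (@qv _ _ _ X b0 b1)).
Local Notation Yall := [pred j : J | (wt j < c)%N].
Local Notation ok := (layer_ok wt Yall).

Variables (Dv : Idx -> L) (sv : 'I_c -> Idx -> L).
Hypothesis LC : lcomplex f wt sd xv c Yall Dv sv.

Local Notation G := (@gpiece S c J wt sd).
Local Notation gd := (gd wt sd Dv).
Local Notation gsig := (gsigma wt sd sv).

Definition gaug : {linear G 0 -> M} := mu \o q \o @gemb S c J wt sd 0.

Lemma base_homog (x : L) : onf (in_base wt sd c) x <-> homog wt sd 0 x.
Proof.
split; apply: onfW => m.
  move=> /and3P[/eqP m0 s0 _]; rewrite okE /ldeg m0 cards0 s0 andbT.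
  by apply/blwP => i; rewrite inE.
by rewrite /ldeg addn_eq0 cards_eq0 /in_base => /and3P[_ -> ->]; rewrite ltnW.
Qed.

Lemma gaug_surj m : exists x, gaug x = m.
Proof.
have [x <-] := M_mod.1 m; have [z /base_homog hz <-] := top_lift b1 co0E x.
by exists (@gres S c J wt sd 0 z); rewrite /gaug /= gembK.
Qed.

(** Boundaries in degree 0 are generated by the image of [d] and the multiples of the [f_i], which
    is the presentation of [M]; [lcomplex_deg1] gives one inclusion and the homotopies the other. *)
Lemma gaug_exact x : gaug x = 0 <-> exists y, x = gd 0 y.
Proof.
have hx := @gemb_homog S c J wt sd 0 x; split=> [|[y ->]]; last first.
  have [t [_ ht]] : exists t : J -> S, (forall j, ~~ ((j \in Yall) && (sd j == 1%N)) -> t j = 0) /\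
    setmul (first_elts f c) (onf (in_base wt sd c)) (lin Dv (@gemb S c J wt sd 1 y) - \sum_j t j *: xv j).
    apply: (lcomplex_deg1 (@csd_le1 _ _ _ _ _ _) (cxv_supp co0_fil) LC) => [j _|].
      exact: ltnW.
    exact: gemb_homog.
  rewrite /gaug /= (gemb_d LC); apply/M_mod.2.
  exists (\sum_l t (inr l) *: sb_vec b1 l), (q (lin Dv (@gemb S c J wt sd 1 y) - \sum_j t j *: xv j)).
  split; first exact: setmul_map ht.
  by rewrite linB (q_sum_xv co0E) addrC subrK.
move/M_mod.2 => [y [z [hz e]]].
pose s (j : J) := match j with inl _ => 0 | inr l => co1 y l end.
have qs : q (\sum_j s j *: xv j) = d y by rewrite (q_sum_xv co0E) -co1E.
have [z' hz' qz] := setmul_lift (p := c) (fun x _ => top_lift b1 co0E x) hz.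
have hs : homog wt sd 0 (\sum_j s j *: xv j).
  apply: onf_sum => -[l|l] _; rewrite /s; first by rewrite scale0r; apply: onf0.
  apply: onfZ; apply/base_homog; apply: (onfW _ (cxv_supp co0_fil (j := inr l))) => m /and4P[m0 s0 _ _].
  by rewrite /in_base m0 s0 ltnW.
have def_x : @gemb S c J wt sd 0 x = \sum_j s j *: xv j + z'.
  apply: (q_inj co0_comb (p := c)); first exact/base_homog.
    by apply: onfD; [apply/base_homog | apply: setmul_base hz'].
  by rewrite linD qs qz -e.
have ok0 j : ok (set0, j) by rewrite okE; apply/blwP => i'; rewrite inE.
pose P u := exists2 w, onf ok w & u = lin Dv w.
have P0 : P 0 by exists 0; [exact: onf0 | rewrite lin0].
have PD u v : P u -> P v -> P (u + v).
  move=> [w hw ->] [w' hw' ->]; exists (w + w'); first exact: onfD.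
  by rewrite linD.
have [w hw e'] : P (@gemb S c J wt sd 0 x).
  rewrite def_x; apply: (PD _ _).
    apply: (big_ind P P0 PD) => j _; exists (s j *: fdelta S (set0, j)).
      exact/onfZ/onf_fdelta.
    by rewrite linZ lin_fdelta (lc_val LC) // inE.
  apply: (setmul_ind P0 PD _ hz') => a u [i [_ ->]] /base_homog hu.
  exists (lin (sv i) u); first exact: homog_ok (homog_sigma LC (i := i) hu).
  rewrite -(homotopy_lin (lc_homotopy LC (ltn_ord i)) (homog_ok hu)) //.
  by rewrite (homog_D0 LC hu) lin0 addr0.
have [|z2 hz2] := homog_boundary LC (n := 0) hw; first by rewrite -e'.
by exists z2; apply: (@gemb_inj _ _ _ wt sd 0); rewrite e'.
Qed.

Lemma inm_coords n (x : G n) : inm x <-> forall m, @max_ideal S (x m).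
Proof.
have mI := max_ideal_is_ideal k_residue; split=> [hx m|hx].
  apply: (@setmul_ind _ _ _ _ (fun x : G n => @max_ideal S (x m)) x _ _ _ hx).
  - by rewrite ffunE; apply: max_ideal0 mI.
  - by move=> u v hu hv; rewrite ffunE; apply: (max_idealD mI).
  by move=> a u ha _; rewrite ffunE [_ *: _]mulrC; apply: (max_idealM mI).
by rewrite [x]fdelta_sum; apply: setmul_sum => m _; apply: setmul_max; apply: hx.
Qed.

Lemma gd_inm n y : inm (gd n y).
Proof.
have mI := max_ideal_is_ideal k_residue.
apply/inm_coords => m; rewrite ffunE.
have := homog_ok (@gemb_homog S c J wt sd n.+1 y); set x := @gemb S c J wt sd n.+1 y => hx.
change (@max_ideal S (lin Dv x (val m))); pattern x; apply: onf_ind hx.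
- by rewrite lin0 ffunE; apply: max_ideal0 mI.
- by move=> u v hu hv; rewrite linD ffunE; apply: (max_idealD mI).
- by move=> a u hu; rewrite linZ ffunE; apply: (max_idealM mI).
by move=> m' ok_m; rewrite lin_fdelta; apply: (lc_min LC).
Qed.

Lemma gaug_gd x : gaug (gd 0 x) = 0.
Proof. by apply/gaug_exact; exists x. Qed.

Lemma G_free n : fg_free (fun _ : G n => True).
Proof. exact: gpiece_free. Qed.

Lemma G_dd n x : gd n (gd n.+1 x) = 0.
Proof. by apply: gd_gd; apply: LC. Qed.

Lemma G_exact n (x : G n.+1) : gd n x = 0 -> exists y, x = gd n.+1 y.
Proof. by apply: gd_exact; apply: LC. Qed.

Lemma G_exact0 x : gaug x = 0 -> exists y, x = gd 0 y.
Proof. by move/gaug_exact. Qed.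

Lemma F_exact n (x : F n.+1) : fr_d F n x = 0 -> exists y, x = fr_d F n.+1 y.
Proof. by move/fr_exactS. Qed.

Lemma F_exact0 x : fr_aug F x = 0 -> exists y, x = fr_d F 0 y.
Proof. by move/fr_exact0. Qed.

(** Comparison maps in both directions are inverse up to homotopy. The differential of [G] vanishes
    modulo the maximal ideal, so Tor is [G] modulo that ideal. *)
Lemma comparison : exists phi : forall n, {linear G n -> F n},
  [/\ forall x, fr_aug F (phi 0%N x) = gaug x,
      forall n x, fr_d F n (phi n.+1 x) = phi n (gd n x),
      forall n x, cl (phi n x) = 0 -> inm x,
      forall n (z : F n), Defs.cycle z -> exists x, cl z = cl (phi n x) &
      forall i n x, egen k i *: cl (phi n x) = cl (phi n.+1 (gsig i n x))].
Proof.
have [phi [phi0 phiS]] := augmented_lift G_free G_dd gaug_gd F_exact F_exact0 (@fr_surj _ _ F).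
have [psi [psi0 psiS]] := augmented_lift (@fr_free _ _ F) fr_dd fr_aug_d G_exact G_exact0 gaug_surj.
pose g n : {linear G n -> G n} := (psi n \o phi n) \- idfun.
have gE n x : g n x = psi n (phi n x) - x by [].
have [s [s0 sS]] : exists s : forall n, {linear G n -> G n.+1}, (forall x, g 0%N x = gd 0 (s 0%N x)) /\
    forall n x, g n.+1 x = gd n.+1 (s n.+1 x) + s n (gd n x).
  apply: (augmented_homotopy (aQ := gaug) G_free G_dd G_exact G_exact0) => [n x|x].
    by rewrite !gE linearB psiS phiS.
  by rewrite gE linearB psi0 phi0 subrr.
pose h n : {linear F n -> F n} := (phi n \o psi n) \- idfun.
have hE n x : h n x = phi n (psi n x) - x by [].
have [t [t0 tS]] : exists t : forall n, {linear F n -> F n.+1}, (forall x, h 0%N x = fr_d F 0 (t 0%N x)) /\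
    forall n x, h n.+1 x = fr_d F n.+1 (t n.+1 x) + t n (fr_d F n x).
  apply: (augmented_homotopy (aQ := fr_aug F) (@fr_free _ _ F) fr_dd F_exact F_exact0) => [n x|x].
    by rewrite !hE linearB phiS psiS.
  by rewrite hE linearB phi0 psi0 subrr.
have phi_cycle n x : Defs.cycle (phi n x).
  by case: n x => [//|n] x /=; rewrite phiS; apply: setmul_all; apply: gd_inm.
exists phi; split=> //.
- move=> n x /(tor_ker T_Tor (phi_cycle n x))[y hy].
  have {}hy : inm (psi n (phi n x)).
    have := setmul_all (psi n) hy; rewrite linearB -psiS => h1.
    by rewrite -[psi n _](subrK (gd n (psi n.+1 y))); apply: setmulD h1 (gd_inm _).
  have gx : inm (g n x).
    case: n {y} x hy => [|n] x hy; first by rewrite s0; apply: gd_inm.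
    rewrite sS; apply: setmulD; first exact: gd_inm.
    by apply: setmul_all; apply: gd_inm.
  have -> : x = psi n (phi n x) - g n x by rewrite gE opprB addrC subrK.
  by apply: setmulD => //; apply: setmulN.
- move=> n z cz; exists (psi n z).
  case: n z cz => [|n] z cz.
    apply: (@cl_eq _ _ _ 0 (- t 0%N z)) => //; first exact: setmul0.
    by rewrite addr0 linearN -t0 hE opprB addrC subrK.
  apply: (@cl_eq _ _ _ (- t n (fr_d F n z)) (- t n.+1 z)) => //.
    by apply/setmulN/setmul_all.
  by rewrite linearN -addrA -opprD -tS hE opprB addrC subrK.
move=> i n x; rewrite (tor_act T_Tor) //.
(* Both systems of homotopies satisfy the same identity, so their difference [e] anticommutes with
   the differentials. It is null-homotopic and induces zero on Tor. *)
pose e n : {linear G n -> F n.+1} := (phi n.+1 \o gsig i n) \- (sigma i n \o phi n).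
have eE m y : e m y = phi m.+1 (gsig i m y) - sigma i m (phi m y) by [].
have [sig0 sigS] := sigma_homotopy i.
have [u [u0 uS]] : exists u : forall n, {linear G n -> F n.+2}, (forall x, e 0%N x = fr_d F 1 (u 0%N x)) /\
    forall n x, e n.+1 x = fr_d F n.+2 (u n.+1 x) + -1 *: u n (gd n x).
  apply: (@chain_homotopy S G (fun n => F n.+1) gd (fun n => fr_d F n.+1) G_free (fun n => @F_exact n.+1) (-1) e) => [|m y|m y|y].
  - by rewrite mulrNN mulr1.
  - exact: G_dd.
  - rewrite !eE linearB phiS.
    have -> : gd m.+1 (gsig i m.+1 y) = f i *: y - gsig i m (gd m y).
      by rewrite -(gsigmaS LC) addrK.
    have -> : fr_d F m.+1 (sigma i m.+1 (phi m.+1 y)) = f i *: phi m.+1 y - sigma i m (fr_d F m (phi m.+1 y)).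
      by rewrite -sigS addrK.
    rewrite [phi m.+1 (_ - _)]linearB [phi m.+1 (_ *: _)]linearZ phiS scaleN1r !opprB.
    by rewrite addrC addrA subrK.
  by apply: F_exact; rewrite eE linearB phiS (gsigma0 LC) [phi 0%N _]linearZ sig0 subrr.
case: n x => [|n] x.
  apply: (@cl_eq _ _ _ 0 (- u 0%N x)) => //; first exact: setmul0.
  by rewrite addr0 linearN -u0 eE opprB addrC subrK.
apply: (@cl_eq _ _ _ (u n (gd n x)) (- u n.+1 x)) => //.
  by apply/setmul_all/gd_inm.
have -> : fr_d F n.+2 (- u n.+1 x) = - (e n.+1 x + u n (gd n x)).
  by rewrite linearN uS scaleN1r subrK.
by rewrite opprD addrA subrK eE opprB addrC subrK.
Qed.

Hypothesis co0_lin : forall a x y j, co0 (a *: x + y) j = a * co0 x j + co0 y j.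
Hypothesis f_max : forall i, max_ideal (f i).
Hypothesis X_minimal : hmf_minimal X.
Local Notation E := (extalg k c).

Definition tor_a0 (j : 'I_n0) : T := cl (alpha0 (sb_vec b0 j)).
Definition tor_a1 (j : 'I_n1) : T := cl (alpha1 (sb_vec b1 j)).

Lemma clD n (x y : F n) : Defs.cycle x -> Defs.cycle y -> cl (x + y) = cl x + cl y.
Proof.
by move=> hx hy; rewrite -[x in LHS]scale1r (tor_linear T_Tor) // rmorph1 !scale1r.
Qed.

Lemma clZ n a (x : F n) : Defs.cycle x -> cl (a *: x) = (rho a)%:A *: cl x.
Proof.
by move=> hx; rewrite -[a *: x]addr0 (tor_linear T_Tor) ?cl0 ?addr0 //; apply: cycle0.
Qed.

Lemma clN n (x : F n) : Defs.cycle x -> cl (- x) = - cl x.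
Proof. by move=> hx; rewrite -scaleN1r clZ // rmorphN1 scaleN1r scaleN1r. Qed.

Lemma cycle_sum n I (r : seq I) (P : pred I) (x : I -> F n) :
  (forall i, P i -> Defs.cycle (x i)) -> Defs.cycle (\sum_(i <- r | P i) x i).
Proof.
move=> h; elim/big_ind: _ => // [|y z hy hz]; first exact: cycle0.
by rewrite -[y]scale1r; apply: cycleL.
Qed.

Lemma cl_sum n I (r : seq I) (x : I -> F n) : (forall i, Defs.cycle (x i)) ->
  cl (\sum_(i <- r) x i) = \sum_(i <- r) cl (x i).
Proof.
move=> h; elim: r => [|i r IH]; first by rewrite !big_nil cl0.
by rewrite !big_cons clD ?IH //; apply: cycle_sum.
Qed.

(** By axiom (a), [alpha1 (hmf_h X r x)] corrected by the [sigma (i t)] of the error terms has the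
    same boundary as [sigma r] of [alpha0 x]. Minimality of [h] kills the first term in Tor, leaving
    only products with smaller [e_i]. *)
Lemma tor_a0_triangular : triangular (sb_w b0) tor_a0.
Proof.
move=> r j le_j; set x := sb_vec b0 j.
have fx : fil r.+1 x by apply: (fil_mono b0 _ _ (sb_fil (sb_in j))).
have [m [s [y [hy e]]]] := hmf_dh fx.
have [i Hi] : exists i : 'I_m -> 'I_c, forall t, (i t < r)%N /\ s t = f (i t).
  by apply: (@fin_all_exists _ _ (fun t (i : 'I_c) => (i < r)%N /\ s t = f i)) => t; case: (hy t).
pose w := sigma r 0%N (alpha0 x) - (alpha1 (hmf_h X r x) - \sum_t sigma (i t) 0%N (alpha0 (y t))).
have /F_exact[v def_w] : fr_d F 0 w = 0.
  rewrite /w !linearB /= alpha1_lift (sigma_homotopy r).1 linear_sum /=.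
  have -> : \sum_t fr_d F 0 (sigma (i t) 0%N (alpha0 (y t))) = alpha0 (d (hmf_h X r x) - f r *: x).
    rewrite e linear_sum; apply: eq_bigr => t _.
    by rewrite (sigma_homotopy (i t)).1 linearZ (Hi t).2.
  by rewrite linearB linearZ opprK addKr subrr.
have cy0 (z : F 0%N) : Defs.cycle z by [].
have csig t : Defs.cycle (sigma (i t) 0%N (alpha0 (y t))).
  rewrite /= (sigma_homotopy (i t)).1; apply: setmul_max.
  by rewrite -(Hi t).2 (Hi t).2; exact: f_max.
have e1 : egen k r *: tor_a0 j = - \sum_t egen k (i t) *: cl (alpha0 (y t)).
  rewrite (tor_act T_Tor) //.
  rewrite (@cl_eq _ _ (- \sum_t sigma (i t) 0%N (alpha0 (y t))) (alpha1 (hmf_h X r x)) v).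
  - rewrite clN ?cl_sum //; last exact: cycle_sum.
    by congr (- _); apply: eq_bigr => t _; rewrite (tor_act T_Tor).
  - by rewrite -scaleN1r -[_ *: _]addr0; apply: cycleL; [exact: cycle_sum | exact: cycle0].
  - by apply: setmul_all; apply: X_minimal.2.
  by rewrite -def_w /w opprB addrCA addKr subrK.
exists (- \sum_t \sum_l (rho (co0 (y t) l))%:A *: mono k ([set i t], l)); split.
  apply/onrowN/onrow_sum => t _; apply: onrow_sum => l _.
  have [le_l|lt_l] := leqP (sb_w b0 l) r.
    apply/onrowZ/onrow_mono; rewrite cards1 le_l andbT /=.
    by apply/blwP => i'; rewrite inE => /eqP->; case: (Hi t).
  rewrite (co0_fil _ (hy t).2) // rmorph0 scale0r scale0r; exact: onrow0.
rewrite e1 [RHS]linearN; congr (- _); rewrite [RHS]linear_sum; apply: eq_bigr => t _.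
rewrite [RHS]linear_sum {1}(co0E (y t)) linear_sum cl_sum // scaler_sumr; apply: eq_bigr => l _.
rewrite linearZ clZ // [RHS]linearZ scalerA extalg_comm -scalerA; congr (_ *: _).
by rewrite [RHS]linearZ; congr (_ *: _); apply/esym; apply: eval_delta.
Qed.


Variable phi : forall n, {linear G n -> F n}.
Hypothesis phi_aug : forall x, fr_aug F (phi 0%N x) = gaug x.
Hypothesis phi_d : forall n x, fr_d F n (phi n.+1 x) = phi n (gd n x).
Hypothesis phi_inj : forall n x, cl (phi n x) = 0 -> inm x.
Hypothesis phi_surj : forall n (z : F n), Defs.cycle z -> exists x, cl z = cl (phi n x).
Hypothesis phi_act : forall i n x, egen k i *: cl (phi n x) = cl (phi n.+1 (gsig i n x)).

Definition tor_class n (x : L) : T := cl (phi n (@gres S c J wt sd n x)).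

Definition tor_a (j : J) : T := match j with inl l => tor_a0 l | inr l => tor_a1 l end.

Lemma phi_cycle n x : Defs.cycle (phi n x).
Proof. by case: n x => [//|n] x /=; rewrite phi_d; apply: setmul_all; apply: gd_inm. Qed.

Lemma tor_classD n x y : tor_class n (x + y) = tor_class n x + tor_class n y.
Proof. by rewrite /tor_class !linearD clD //; apply: phi_cycle. Qed.

Lemma tor_classZ n a x : tor_class n (a *: x) = (rho a)%:A *: tor_class n x.
Proof. by rewrite /tor_class !linearZ clZ //; apply: phi_cycle. Qed.

Lemma tor_class0 n : tor_class n 0 = 0.
Proof. by rewrite /tor_class !linear0 cl0. Qed.

Lemma tor_class_act i n x : homog wt sd n x ->
  egen k i *: tor_class n x = tor_class n.+1 (lin (sv i) x).
Proof.
move=> hx; rewrite phi_act /tor_class; congr (cl (phi n.+1 _)).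
by apply: (@gemb_inj _ _ _ wt sd n.+1); rewrite (gemb_sigma LC) !gembK //; apply: (homog_sigma LC).
Qed.

Lemma homog_delta0 j : homog wt sd (sd j) (fdelta S (set0, j)).
Proof.
apply: onf_fdelta; rewrite okE /ldeg cards0 eqxx andbT.
by apply/blwP => i; rewrite inE.
Qed.

Lemma phi0_alpha0 l : exists w, phi 0%N (@gres S c J wt sd 0 (fdelta S (set0, inl l))) =
  alpha0 (sb_vec b0 l) + fr_d F 0 w.
Proof.
set x := @gres _ _ _ _ _ _ _; have /F_exact0[w def_w] : fr_aug F (phi 0%N x - alpha0 (sb_vec b0 l)) = 0.
  rewrite linearB phi_aug alpha0_lift /gaug /= gembK; last exact: (@homog_delta0 (inl l)).
  by rewrite q_delta subrr.
by exists w; rewrite -def_w addrC subrK.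
Qed.

Lemma tor_class0l l : tor_class 0 (fdelta S (set0, inl l)) = tor_a0 l.
Proof.
have [w e] := phi0_alpha0 l; apply: (@cl_eq _ _ _ 0 w) => //; first exact: setmul0.
by rewrite addr0.
Qed.

Lemma alpha1_cycle l : Defs.cycle (alpha1 (sb_vec b1 l)).
Proof. by rewrite /= alpha1_lift; apply: setmul_all; apply: X_minimal.1. Qed.

(* The two lifts of the identity of M differ by a homotopy, which contributes
   only terms in the maximal ideal because d is minimal. *)
Lemma tor_class0r l : tor_class 1 (fdelta S (set0, inr l)) = tor_a1 l.
Proof.
have [w Hw] : exists w : 'I_n0 -> F 1%N, forall i,
    phi 0%N (@gres S c J wt sd 0 (fdelta S (set0, inl i))) = alpha0 (sb_vec b0 i) + fr_d F 0 (w i).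
  exact: (@fin_all_exists _ _ (fun i w => phi 0%N (@gres S c J wt sd 0 (fdelta S (set0, inl i))) =
    alpha0 (sb_vec b0 i) + fr_d F 0 w) phi0_alpha0).
set x := @gres S c J wt sd 1 (fdelta S (set0, inr l)).
pose a i := co0 (d (sb_vec b1 l)) i.
have dx : gd 0 x = \sum_i a i *: @gres S c J wt sd 0 (fdelta S (set0, inl i)).
  have -> : gd 0 x = @gres S c J wt sd 0 (xv (inr l)).
    apply: (@gemb_inj _ _ _ wt sd 0); rewrite (gemb_d LC) !gembK; last exact: (@homog_delta0 (inr l)).
      by rewrite lin_fdelta (lc_val LC) // inE.
    apply/base_homog; apply: (onfW _ (cxv_supp co0_fil (j := inr l))) => m /and4P[m0 s0 _ _].
    by rewrite /in_base m0 s0 ltnW.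
  by rewrite /cxv linear_sum; apply: eq_bigr => i _; rewrite linearZ.
have /F_exact[v def_v] : fr_d F 0 (phi 1%N x - alpha1 (sb_vec b1 l) - \sum_i a i *: w i) = 0.
  rewrite !linearB phi_d alpha1_lift dx linear_sum [in X in _ - _ - X]linear_sum.
  rewrite {1}(co0E (d _)) [alpha0 _]linear_sum -!sumrB big1 // => i _.
  have e1 : phi 0%N (a i *: @gres S c J wt sd 0 (fdelta S (set0, inl i))) =
    a i *: (alpha0 (sb_vec b0 i) + fr_d F 0 (w i)) by rewrite -Hw; exact: linearZ.
  have e2 : alpha0 (co0 (d (sb_vec b1 l)) i *: sb_vec b0 i) = a i *: alpha0 (sb_vec b0 i).
    exact: linearZ.
  have e3 : fr_d F 0 (a i *: w i) = a i *: fr_d F 0 (w i) by exact: linearZ.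
  by rewrite e1 e2 e3 -!scalerBr -addrA -opprD subrr scaler0.
apply: (@cl_eq _ _ _ (\sum_i a i *: w i) v).
- exact: alpha1_cycle.
- apply: setmul_sum => i _; apply: setmul_max.
  exact: (co_max k_residue co0_comb co0_lin _ (X_minimal.1 _)).
by rewrite -def_v -addrA subrK addrC subrK.
Qed.

(* The homotopies are applied in increasing order of the indices, whereas the
   last factor of [emon k A] acts first. *)
Definition tsign (A : {set 'I_c}) : k := (-1) ^+ 'C(#|A|, 2).

(** Here the insertion rule [lc_ins] pays off: Koszul vectors are iterated homotopies of [b_j], and
    homotopies act on Tor as the [e_i]. *)
Lemma tor_class_delta n A j : blw (wt j) A -> n = (#|A| + sd j)%N ->
  tor_class n (fdelta S (A, j)) = (tsign A)%:A *: (emon k A *: tor_a j).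
Proof.
move: n; pattern A; apply: set_ind_max => [n _|i I bI nI IH n bA] def_n.
  rewrite /tsign cards0 bin0n expr0 !scale1r def_n cards0.
  by case: j {def_n} => l; [exact: tor_class0l | exact: tor_class0r].
have bAI : blw (wt j) I by apply/blwP => i' Ii'; apply: (blwP _ _ bA); rewrite inE Ii' orbT.
rewrite cardsU1 nI in def_n; rewrite def_n -addnA add1n.
have lt_i : (i < wt j)%N by apply: (blwP _ _ bA); rewrite setU11.
have okI : ok (I, j) by rewrite okE.
have -> : fdelta S (i |: I, j) = lin (sv i) (fdelta S (I, j)).
  by rewrite lin_fdelta (lc_ins LC).
rewrite -tor_class_act ?IH //; last by apply: onf_fdelta; rewrite okI /ldeg eqxx.
rewrite !scalerA; congr (_ *: _); rewrite extalg_comm -mulrA !mulr_algl emonM scalerA.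
congr (_ *: _); rewrite /tsign cardsU1 nI add1n binS bin1 exprD; congr (_ * _).
rewrite /ext_sign disjoints1 nI /ext_inv big_set1; congr (_ ^+ _).
by rewrite -sum1_card; apply: eq_bigr => i' /(blwP _ _ bI)->.
Qed.

Lemma tsign_sqr A : tsign A * tsign A = 1.
Proof. by rewrite /tsign -exprD addnn -mul2n exprM sqrrN !expr1n. Qed.

Definition row0 (x : L) : 'rV[E]_n0 := \row_l [ffun A => rho (x (A, inl l)) * tsign A].
Definition row1 (x : L) : 'rV[E]_n1 := \row_l [ffun A => rho (x (A, inr l)) * tsign A].

Lemma eval_expand n (a : 'I_n -> T) (u : 'rV[E]_n) :
  eval a u = \sum_l \sum_A (ecoef (u 0 l) A)%:A *: (emon k A *: a l).
Proof.
apply: eq_bigr => l _; rewrite {1}[u 0 l]extalg_sum scaler_suml.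
by apply: eq_bigr => A _; rewrite scalerA.
Qed.

Lemma tor_class_rows n x : homog wt sd n x ->
  tor_class n x = eval tor_a0 (row0 x) + eval tor_a1 (row1 x).
Proof.
move=> hx; rewrite {1}[x]fdelta_sum (big_morph _ (tor_classD n) (tor_class0 n)).
pose t A j := (rho (x (A, j)) * tsign A)%:A *: (emon k A *: tor_a j).
rewrite (eq_bigr (fun m => t m.1 m.2)) => [|[A j] _]; last first.
  rewrite /t tor_classZ; have [->|nz] := eqVneq (x (A, j)) 0.
    by rewrite rmorph0 mul0r !scale0r.
  have /andP[okA /eqP dA] := hx _ nz; rewrite okE in okA.
  rewrite (@tor_class_delta n A j) // scalerA; congr (_ *: _).
  by rewrite mulr_algl scalerA.
rewrite -(pair_bigA _ t) /= {}/t.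
rewrite exchange_big big_sumType !eval_expand /=; congr (_ + _); apply: eq_bigr => l _.
  by apply: eq_bigr => A _; rewrite /row0 mxE /ecoef ffunE.
by apply: eq_bigr => A _; rewrite /row1 mxE /ecoef ffunE.
Qed.

Lemma row0_on n Q x : homog wt sd n x -> onf Q x ->
  onrow (fun A l => [&& Q (A, inl l), blw (sb_w b0 l) A & n == #|A|]) (row0 x).
Proof.
move=> hx hQ A l; rewrite mxE /ecoef ffunE => nz.
have {}nz : x (A, inl l) != 0 by apply: contraNneq nz => ->; rewrite rmorph0 mul0r.
by rewrite hQ //; have /andP[] := hx _ nz; rewrite okE /ldeg addn0 eq_sym => -> ->.
Qed.

Lemma row1_on n Q x : homog wt sd n x -> onf Q x ->
  onrow (fun A l => [&& Q (A, inr l), blw (sb_w b1 l) A & n == #|A| + 1]%N) (row1 x).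
Proof.
move=> hx hQ A l; rewrite mxE /ecoef ffunE => nz.
have {}nz : x (A, inr l) != 0 by apply: contraNneq nz => ->; rewrite rmorph0 mul0r.
by rewrite hQ //; have /andP[] := hx _ nz; rewrite okE /ldeg eq_sym => -> ->.
Qed.

Lemma tor_span n t : tor_deg cl n t -> exists u0 u1,
  [/\ layered (sb_w b0) u0, layered (sb_w b1) u1, homogeneous (fun=> 0%N) n u0,
      homogeneous (fun=> 1%N) n u1 & t = eval tor_a0 u0 + eval tor_a1 u1].
Proof.
case=> z cz ->; have [x ->] := phi_surj cz;
have hy : homog wt sd n (@gemb S c J wt sd n x) := @gemb_homog _ _ _ _ _ _ x.
have hT : onf predT (@gemb S c J wt sd n x) by [].
exists (row0 (@gemb S c J wt sd n x)), (row1 (@gemb S c J wt sd n x)); split.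
- by apply/layeredP; apply: onrowW (row0_on hy hT) => A l /and3P[].
- by apply/layeredP; apply: onrowW (row1_on hy hT) => A l /and3P[].
- by apply/homogeneousP; apply: onrowW (row0_on hy hT) => A l /and3P[_ _]; rewrite addn0.
- by apply/homogeneousP; apply: onrowW (row1_on hy hT) => A l /and3P[].
by rewrite -(tor_class_rows hy) /tor_class gresK.
Qed.

(** [lc_fil] keeps the weights at most [r], and basis vectors have their indices below their weight,
    hence below [r]. Total degree two leaves quadratic terms over [A_0] and linear terms over
    [A_1]. *)
Lemma tor_a1_relation (r : 'I_c) j : (sb_w b1 j <= r)%N -> exists u0 u1,
  [/\ onrow (fun A l => (#|A| == 2%N) && blw r A) u0,
      onrow (fun A l => [&& #|A| == 1%N, blw r A & (sb_w b1 l <= r)%N]) u1 &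
      egen k r *: tor_a1 j = eval tor_a0 u0 + eval tor_a1 u1].
Proof.
move=> le_j; have okj : ok (set0, inr j) by rewrite okE; apply/blwP => i; rewrite inE.
pose x := lin (sv r) (fdelta S (set0, inr j)).
have hx : homog wt sd 2 x by apply: (homog_sigma LC); exact: (@homog_delta0 (inr j)).
have hQ : onf (fun m : Idx => (wt m.2 <= r)%N) x by rewrite /x lin_fdelta; apply: (lc_fil LC).
exists (row0 x), (row1 x); split.
- apply: onrowW (row0_on hx hQ) => A l /and3P[/= le_l bA /eqP<-].
  by rewrite eqxx (blwW le_l).
- apply: onrowW (row1_on hx hQ) => A l /and3P[/= le_l bA e].
  by move: e; rewrite addn1 eqSS eq_sym => ->; rewrite le_l andbT (blwW le_l).
rewrite -(tor_class_rows hx) -tor_class0r.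
by apply: (@tor_class_act r 1%N); exact: (@homog_delta0 (inr j)).
Qed.

(** Layered coefficients are, up to sign, residues of the coordinates of an element [x] of the
    layered complex. Each homogeneous part of [x] has class zero, so by [phi_inj] all its
    coordinates lie in the maximal ideal. *)
Lemma tor_free u0 u1 : layered (sb_w b0) u0 -> layered (sb_w b1) u1 ->
  eval tor_a0 u0 + eval tor_a1 u1 = 0 -> u0 = 0 /\ u1 = 0.
Proof.
move=> lu0 lu1 sum0; pose lift y := sval (constructive_indefinite_description _ (rho_surj k_residue y)).
have liftE y : rho (lift y) = y := svalP (constructive_indefinite_description _ (rho_surj k_residue y)).
pose co (m : Idx) := match m.2 with inl l => ecoef (u0 0 l) m.1 | inr l => ecoef (u1 0 l) m.1 end.
have co_ok m : co m != 0 -> ok m.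
  by case: m => A [l|l]; rewrite okE /co /= => nz; apply/blwP; [apply: lu0 | apply: lu1].
pose x : L := [ffun m => if ok m then lift (co m * tsign m.1) else 0].
have rx m : rho (x m) = co m * tsign m.1.
  rewrite ffunE; case: ifPn => [_|nok]; first exact: liftE.
  by rewrite rmorph0; have [->|/co_ok] := eqVneq (co m) 0; rewrite ?mul0r // (negPf nok).
pose xn n := res (fun m => ldeg sd m == n) x.
have hxn n : homog wt sd n (xn n).
  apply: onfI; last exact: onf_res.
  by apply: onf_res2 => m; rewrite ffunE; case: ifP => //; rewrite eqxx.
pose K := (c + 1).+1.
have ltK (m : Idx) : (ldeg sd m < K)%N.
  rewrite ltnS leq_add //; last exact: csd_le1.
  by apply: leq_trans (max_card _) _; rewrite card_ord.
have sum_x : \sum_(n < K) xn n = x.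
  apply/ffunP => m; rewrite sum_ffunE (bigD1 (Ordinal (ltK m))) //= big1 => [|n nn].
    by rewrite ffunE eqxx addr0.
  by rewrite ffunE; case: eqP => // e; case/eqP: nn; apply: val_inj.
have row0D : {morph row0 : x y / x + y}.
  by move=> y z; apply: row_ext => l A; rewrite !mxE /ecoef !ffunE rmorphD mulrDl.
have row1D : {morph row1 : x y / x + y}.
  by move=> y z; apply: row_ext => l A; rewrite !mxE /ecoef !ffunE rmorphD mulrDl.
have row00 : row0 0 = 0 by apply: row_ext => l A; rewrite !mxE /ecoef !ffunE rmorph0 mul0r.
have row10 : row1 0 = 0 by apply: row_ext => l A; rewrite !mxE /ecoef !ffunE rmorph0 mul0r.
have e0 : row0 x = u0.
  by apply: row_ext => l A; rewrite mxE {1}/ecoef [LHS]ffunE rx -mulrA tsign_sqr mulr1.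
have e1 : row1 x = u1.
  by apply: row_ext => l A; rewrite mxE {1}/ecoef [LHS]ffunE rx -mulrA tsign_sqr mulr1.
have cl_sum0 : \sum_(n < K) cl (phi n (@gres S c J wt sd n (xn n))) = 0.
  rewrite -[RHS]sum0 -e0 -e1 -sum_x (big_morph _ row0D row00) (big_morph _ row1D row10).
  rewrite !linear_sum -big_split; apply: eq_bigr => n _.
  exact: tor_class_rows.
have x0 m : co m = 0.
  have := @tor_direct _ _ _ _ _ _ _ _ _ T_Tor K (fun n => phi n (@gres S c J wt sd n (xn n)))
    (fun n => phi_cycle _) cl_sum0 _ (ltK m).
  move/phi_inj/inm_coords; have [okm|/negPf nok _] := boolP (ok m); last first.
    by apply/eqP/negPn/negP => /co_ok; rewrite nok.
  have h : ok m && (ldeg sd m == ldeg sd m) by rewrite okm eqxx.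
  move/(_ (exist _ m h)); rewrite !ffunE /= eqxx okm => /(max_idealE k_residue).
  rewrite liftE => /eqP; rewrite mulf_eq0 => /orP[/eqP //|].
  by rewrite signr_eq0.
split; apply: row_ext => l A; rewrite mxE ecoef0.
  exact: (x0 (A, inl l)).
exact: (x0 (A, inr l)).
Qed.

End TorComparison.

(** * The structure of Tor *)

Section FinalAlgebra.
Variables (k : fieldType) (c : nat).
Local Notation E := (extalg k c).

Lemma triangular_normal_form (N : lmodType E) n (w : 'I_n -> 'I_c) (a : 'I_n -> N) u :
  triangular w a -> exists v, layered w v /\ eval a v = eval a u.
Proof.
move=> Ta; have [U onU aU] := triangular_choice Ta.
have [n' [R [J [RJ_ge RJ_surj _]]]] := syz_index w.
exact: (normal_form onU RJ_ge RJ_surj aU).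
Qed.

Lemma extsub_mul p (x y : E) : extsub p x -> extsub p y -> extsub p (x * y).
Proof.
move=> hx hy C nz; have [A [B [nA nB <-]]] : exists A B, [/\ ecoef x A != 0, ecoef y B != 0 & A :|: B = C].
  have [/existsP[A /existsP[B /and3P[? ? /eqP ?]]]|] := boolP [exists A, [exists B, [&& ecoef x A != 0, ecoef y B != 0 & A :|: B == C]]].
    by exists A, B.
  rewrite negb_exists => /forallP h; case/eqP: nz; apply: ecoef_mul0 => A B nA nB.
  by have := h A; rewrite negb_exists => /forallP/(_ B); rewrite nA nB.
by move=> i /setUP[/(hx A nA)|/(hy B nB)].
Qed.

Lemma triangular_decomposition (N : lmodType E) (P : N -> Prop) n (w : 'I_n -> 'I_c) (a : 'I_n -> N) :
  triangular w a -> layered_free w a -> (forall x, P x <-> exists u, x = eval a u) ->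
  layered_decomposition P w a.
Proof.
move=> Ta Fa Pa; split.
- by move=> u _; apply/Pa; exists u.
- move=> x /Pa[u ->]; have [v [lv e]] := triangular_normal_form u Ta.
  by exists v; rewrite e.
- move=> u v lu lv e; apply/eqP; rewrite -subr_eq0; apply/eqP/Fa.
    by apply/layeredP; apply: onrowD; [|apply: onrowN]; apply/layeredP.
  by rewrite linearB /= e subrr.
move=> p x u hx lu hu; split; last by rewrite linearZ.
move=> j; rewrite mxE; have [e|/hu->] := eqVneq (w j) p.
  by apply: extsub_mul; [rewrite e | apply: lu].
by rewrite mulr0 => A; rewrite ecoef0 eqxx.
Qed.

Lemma submod_gen_leading n (r : 'I_c) (u : 'rV[E]_n) :
  onrow (fun A _ => [exists i in A, (i < r)%N]) u ->
  submod_gen (fun y : 'rV[E]_n => exists (i : 'I_c) l, (i < r)%N /\ y = egen k i *: delta_mx 0 l) u.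
Proof.
move=> hu; pattern u; apply: onrow_ind hu.
- exact: setmul0.
- by move=> *; apply: setmulD.
- by move=> *; apply: submod_genZ.
move=> A l /existsP[i /andP[Ai lt_i]].
have dA : [disjoint A :\ i & [set i]] by rewrite disjoint_sym disjoints1 !inE eqxx.
rewrite -(setD1K Ai) setUC /mono emon_mul //= -!scalerA.
by do 2!apply: submod_genZ; apply: submod_gen1; exists i, l.
Qed.

Lemma onrow_row_mx m n (Q : {set 'I_c} -> 'I_(m + n) -> bool) (u : 'rV[E]_m) (v : 'rV[E]_n) :
  onrow (fun A l => Q A (lshift n l)) u -> onrow (fun A l => Q A (rshift m l)) v ->
  onrow Q (row_mx u v).
Proof.
move=> hu hv A l; rewrite mxE -{2}[l]splitK; case: (split l) => i; [exact: hu | exact: hv].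
Qed.

Lemma leading_relation_exists (N : lmodType E) m n (dg : 'I_(m + n) -> nat) (g : 'I_m -> N) (h : 'I_n -> N)
    r j (u : 'rV[E]_m) (v : 'rV[E]_n) :
  egen k r *: split_case g h j = eval g u + eval h v ->
  onrow (fun A l => [exists i in A, (i < r)%N] && ((dg j).+1 == #|A| + dg l)%N) (row_mx u v) ->
  leading_relation dg (split_case g h) r j (egen k r *: delta_mx 0 j - row_mx u v).
Proof.
move=> e onb; split.
- by rewrite linearB linearZ /= eval_delta e eval_split_case row_mxKl row_mxKr subrr.
- exists (dg j).+1; apply/homogeneousP; apply: onrowD.
    by apply: (@onrow_mono k c _ _ [set r] j); rewrite cards1.
  by apply/onrowN; apply: onrowW onb => A l /andP[].
exists (row_mx u v) => //; apply: submod_gen_leading.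
by apply: onrowW onb => A l /andP[].
Qed.

(** The kernel has homogeneous generators. If classes sum to zero, their lifts sum to some
    [eval a u]; subtracting its homogeneous components gives one element in each degree with sum
    zero, and independence upstairs applies. *)
Lemma quotient_graded (N N'' : lmodType E) (quo : {linear N -> N''}) (deg : nat -> N -> Prop)
    n (a : 'I_n -> N) d :
  is_graded deg -> (forall j, deg d (a j)) -> (forall x, quo x = 0 <-> exists u, x = eval a u) ->
  is_graded (fun m y => exists2 x, deg m x & y = quo x).
Proof.
move=> degP da quo0; have [d0 dL dM dI] := degP; split.
- by move=> m; exists 0; rewrite ?linear0.
- by move=> m b _ _ [x hx ->] [y hy ->]; exists (b%:A *: x + y); [exact: dL | rewrite linearP].
- by move=> m A _ [x hx ->]; exists (emon k A *: x); [exact: dM | rewrite linearZ].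
move=> m y hy sum0; have hx i : {x | deg i x /\ y i = quo x}.
  by apply: constructive_indefinite_description; have [x] := hy i; exists x.
pose x i := sval (hx i); have dx i : deg i (x i) by case: (svalP (hx i)).
have yx i : y i = quo (x i) by case: (svalP (hx i)).
have /quo0[u def_u] : quo (\sum_(i < m) x i) = 0.
  by rewrite linear_sum -[RHS]sum0; apply: eq_bigr => i _.
have [K hK] := hcomp_sum (fun=> d) u.
pose z i := (if (i < m)%N then x i else 0) - eval a (hcomp (fun=> d) i u).
have dz i : deg i (z i).
  rewrite /z addrC -scaleN1r -[-1](scaleN1r (1 : E)); apply: dL.
    by apply: (eval_deg degP da); apply: hcomp_homogeneous.
  by case: ifP.
have sumz : \sum_(i < maxn m K) z i = 0.
  have e : \sum_(i < maxn m K) eval a (hcomp (fun=> d) i u) = eval a u.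
    by rewrite [u in RHS](hK _ (leq_maxr m K)) [RHS]linear_sum.
  rewrite sumrB e -def_u.
  rewrite -(big_mkord predT (fun i => if (i < m)%N then x i else 0)).
  rewrite (big_cat_nat (n := m)) ?leq_maxl //= [X in _ + X - _]big1_seq => [|i]; last first.
    by rewrite mem_index_iota => /andP[_ /andP[le_i _]]; rewrite ltnNge le_i.
  rewrite addr0 big_mkord; apply/eqP; rewrite subr_eq0; apply/eqP.
  by apply: eq_bigr => i _; rewrite ltn_ord.
move=> i lt_i; rewrite yx; apply/quo0; exists (hcomp (fun=> d) i u).
have lt_i' : (i < maxn m K)%N by rewrite leq_max lt_i.
by have /eqP := dI _ z dz sumz i lt_i'; rewrite /z lt_i subr_eq0 => /eqP.
Qed.

End FinalAlgebra.

Section TorStructure.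
Variables (S : comUnitRingType) (k : fieldType) (rho : {rmorphism S -> k}).
Hypothesis k_residue : is_residue_field rho.
Variables (c : nat) (f : 'I_c -> S).
Hypotheses (f_max : forall i, max_ideal (f i)) (f_regular : regular_seq f).
Variables (X : hmf f) (X_minimal : hmf_minimal X).
Variables (b0 : split_basis (hmf_A0 X)) (b1 : split_basis (hmf_A1 X)).
Variables (M : lmodType S) (mu : {linear hmf_A0 X -> M}) (M_mod : is_hmf_module mu).
Variable F : free_resolution M.
Variable sigma : 'I_c -> forall n, {linear F n -> F n.+1}.
Hypothesis sigma_homotopy : are_homotopies f sigma.
Variables (T : lmodType (extalg k c)) (cl : forall n, F n -> T).
Hypothesis T_Tor : is_Tor rho sigma cl.
Variables (alpha0 : {linear hmf_A0 X -> F 0%N}) (alpha1 : {linear hmf_A1 X -> F 1%N}).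
Hypothesis alpha0_lift : forall x, fr_aug F (alpha0 x) = mu x.
Hypothesis alpha1_lift : forall x, fr_d F 0%N (alpha1 x) = alpha0 (hmf_d X x).

Local Notation a0 := (@tor_a0 S k c f X b0 M F T cl alpha0).
Local Notation a1 := (@tor_a1 S k c f X b1 M F T cl alpha1).

(** The interface between the layered complex and the algebra over [E]. Freeness is joint in both
    families because relations over [A_1] may involve [A_0]. *)
Lemma tor_structure : [/\ triangular (sb_w b0) a0,
  forall u0 u1, layered (sb_w b0) u0 -> layered (sb_w b1) u1 ->
    eval a0 u0 + eval a1 u1 = 0 -> u0 = 0 /\ u1 = 0,
  forall n t, tor_deg cl n t -> exists u0 u1,
    [/\ layered (sb_w b0) u0, layered (sb_w b1) u1, homogeneous (fun=> 0%N) n u0,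
      homogeneous (fun=> 1%N) n u1 & t = eval a0 u0 + eval a1 u1] &
  forall (r : 'I_c) j, (sb_w b1 j <= r)%N -> exists u0 u1,
    [/\ onrow (fun A l => (#|A| == 2%N) && blw r A) u0,
      onrow (fun A l => [&& #|A| == 1%N, blw r A & (sb_w b1 l <= r)%N]) u1 &
      egen k r *: a1 j = eval a0 u0 + eval a1 u1]].
Proof.
have [co0 [co0E co0_comb co0_lin co0_fil]] := sb_coords k_residue b0.
have [co1 [co1E co1_comb co1_lin co1_fil]] := sb_coords k_residue b1.
have mI := max_ideal_is_ideal k_residue.
have [Dv [sv LC]] := layered_complex_exists f_regular f_max mI
  (@csd_le1 _ _ _ _ b0 b1) (cxv_supp co0_fil) (cxv_minimal k_residue X_minimal co0_comb co0_lin)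
  (cxv_htpy co0E co0_comb co0_fil co1E co1_fil)
  (cxv_regular f_regular co0E co1_comb co1_lin co1_fil) (leqnn c).
have [phi [phi_aug phi_d phi_inj phi_surj phi_act]] :=
  comparison k_residue M_mod sigma_homotopy T_Tor co0E co0_comb co0_fil co1E LC.
split.
- exact: (tor_a0_triangular k_residue sigma_homotopy T_Tor alpha1_lift co0E co0_fil f_max X_minimal).
- exact: (tor_free k_residue T_Tor alpha0_lift alpha1_lift co0E co0_comb co0_fil LC co0_lin X_minimal phi_aug phi_d phi_inj phi_act).
- exact: (tor_span k_residue T_Tor alpha0_lift alpha1_lift co0E co0_comb co0_fil LC co0_lin X_minimal phi_aug phi_d phi_surj phi_act).
exact: (tor_a1_relation k_residue T_Tor alpha0_lift alpha1_lift co0E co0_comb co0_fil LC co0_lin X_minimal phi_aug phi_d phi_act).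
Qed.

Lemma cycle_sigma i n (z : F n) : Defs.cycle z -> Defs.cycle (sigma i n z).
Proof.
have [s0 sS] := sigma_homotopy i.
case: n z => [|n] z /= cz; first by rewrite s0; apply: setmul_max.
rewrite -[fr_d _ _ _](addrK (sigma i n (fr_d F n z))) sS; apply: setmulD.
  exact: setmul_max.
by apply: (setmulN k_residue); apply: setmul_all.
Qed.

Lemma tor_graded : is_graded (tor_deg cl).
Proof.
have dL n (b : k) x y : tor_deg cl n x -> tor_deg cl n y -> tor_deg cl n (b%:A *: x + y).
  move=> [z cz ->] [w cw ->]; have [s <-] := rho_surj k_residue b.
  exists (s *: z + w); first exact: (cycleL k_residue).
  by rewrite (tor_linear T_Tor).
have d0 n : tor_deg cl n 0.
  by exists 0; [exact: cycle0 | rewrite (cl0 T_Tor)].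
split=> //.
- move=> n A x dx; pattern A; apply: set_ind_max => [|i I bI nI IH].
    by rewrite cards0 emon0 scale1r.
  have dI : [disjoint [set i] & I] by rewrite disjoints1.
  rewrite (emon_mul k dI) cardsU1 nI -!scalerA -[X in tor_deg _ _ X]addr0; apply: dL => //.
  have [z cz ->] := IH; exists (sigma i _ z); first exact: cycle_sigma.
  exact: (tor_act T_Tor).
move=> m x dx sum0 n lt_n.
have hz i : {z : F i | Defs.cycle z /\ x i = cl z}.
  by apply: constructive_indefinite_description; have [z] := dx i; exists z.
have := @tor_direct _ _ _ _ _ _ _ _ _ T_Tor m (fun i => sval (hz i)) (fun i => (svalP (hz i)).1) _ n lt_n.
rewrite -(svalP (hz n)).2; apply; rewrite -[RHS]sum0; apply: eq_bigr => i _.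
by rewrite -(svalP (hz i)).2.
Qed.

End TorStructure.

Theorem theorem4p6
  (S : comUnitRingType) (S_regular : regular_local S)
  (k : fieldType) (rho : {rmorphism S -> k}) (k_residue : is_residue_field rho)
  (c : nat) (f : 'I_c -> S)
  (f_max : forall i, max_ideal (f i)) (f_regular : regular_seq f)
  (X : hmf f) (X_minimal : hmf_minimal X)
  (* splittings, and bases of the k (x) B_s(p) *)
  (b0 : split_basis (hmf_A0 X)) (b1 : split_basis (hmf_A1 X))
  (M : lmodType S) (mu : {linear hmf_A0 X -> M}) (M_mod : is_hmf_module mu)
  (* T = Tor^S(M,k), computed from any free resolution and any homotopies *)
  (F : free_resolution M)
  (sigma : 'I_c -> forall n, {linear F n -> F n.+1})
  (sigma_homotopy : are_homotopies f sigma)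
  (T : lmodType (extalg k c)) (cl : forall n, F n -> T)
  (T_Tor : is_Tor rho sigma cl)
  (* the maps k (x) A_0 -> T_0 and k (x) A_1 -> T_1 are induced by any lifting
     of the identity of M to A_1 -> A_0; for F = L the layered resolution one
     can take the inclusions of A_0 = L_0 and A_1 in L_1 *)
  (alpha0 : {linear hmf_A0 X -> F 0%N}) (alpha1 : {linear hmf_A1 X -> F 1%N})
  (alpha0_lift : forall x, fr_aug F (alpha0 x) = mu x)
  (alpha1_lift : forall x, fr_d F 0%N (alpha1 x) = alpha0 (hmf_d X x))
  (* T'' = T / T', where T' = E T_0 *)
  (T'' : lmodType (extalg k c)) (quo : {linear T -> T''})
  (quo_surj : forall y, exists x, quo x = y)
  (quo_ker : forall x, quo x = 0 <-> submod_gen (tor_deg cl 0%N) x) :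
  let T' : T -> Prop := submod_gen (tor_deg cl 0%N) in
  let a0 (j : 'I_(sb_n b0)) : T := cl 0%N (alpha0 (sb_vec b0 j)) in
  let a1 (j : 'I_(sb_n b1)) : T := cl 1%N (alpha1 (sb_vec b1 j)) in
  let T''_deg (n : nat) (y : T'') : Prop :=
    exists2 x, tor_deg cl n x & y = quo x in
  let res' (G : gcomplex k c) (g : 'I_(gc_rk G 0%N) -> T) : Prop :=
    graded_resolution (tor_deg cl) T' g in
  let res'' (G : gcomplex k c) (g : 'I_(gc_rk G 0%N) -> T'') : Prop :=
    graded_resolution T''_deg (fun _ => True) g in
  let a : 'I_(sb_n b0 + sb_n b1) -> T := split_case a0 a1 in
  let dg : 'I_(sb_n b0 + sb_n b1) -> nat :=
    split_case (fun _ => 0%N) (fun _ => 1%N) in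
  [/\ (* (i) *)
      layered_decomposition T' (sb_w b0) a0 /\
      layered_decomposition (fun _ => True) (sb_w b1) (quo \o a1),
      (* (ii) *)
      [/\ (forall j, tor_deg cl 0%N (a0 j)) /\
          (forall x, T' x <-> exists u, x = eval a0 u),
          (forall j, T''_deg 1%N (quo (a1 j))) /\
          (forall y, exists u, y = eval (quo \o a1) u),
          exists G g, @res' G g /\ linear_complex 0 G
        & exists G g, @res'' G g /\ linear_complex 1 G],
      (* (iii) *)
      forall G' g' G'' g'',
        @res' G' g' -> minimal_complex G' ->
        @res'' G'' g'' -> minimal_complex G'' ->
        exists tau (g : 'I_(gc_rk G'' 0%N) -> T),
          [/\ shifted_map tau,
              forall j, quo (g j) = g'' j,
              @graded_resolution _ _ T (tor_deg cl) (fun _ => True)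
                (mapping_cone tau) (split_case g' g)
            & minimal_complex (mapping_cone tau)]
    & (* (iv) *)
      [/\ forall (r : 'I_c) j, (sb_w b0 j <= r)%N ->
            exists u, leading_relation dg a r (lshift (sb_n b1) j) u,
          forall (r : 'I_c) j, (sb_w b1 j <= r)%N ->
            exists u, leading_relation dg a r (rshift (sb_n b0) j) u,
          forall rel : 'I_c -> 'I_(sb_n b0) ->
              'rV[extalg k c]_(sb_n b0 + sb_n b1),
            (forall (r : 'I_c) j, (sb_w b0 j <= r)%N ->
               leading_relation dg a r (lshift (sb_n b1) j) (rel r j)) ->
            (forall (r : 'I_c) j, (sb_w b0 j <= r)%N -> rsubmx (rel r j) = 0) /\
            forall lt, term_order lt -> refines_lex lt ->
              groebner_basis lt (fun u => eval a0 u = 0)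
                (fun u => exists (r : 'I_c) j,
                   (sb_w b0 j <= r)%N /\ u = lsubmx (rel r j))
        & forall rel : 'I_c -> 'I_(sb_n b1) ->
              'rV[extalg k c]_(sb_n b0 + sb_n b1),
            (forall (r : 'I_c) j, (sb_w b1 j <= r)%N ->
               leading_relation dg a r (rshift (sb_n b0) j) (rel r j)) ->
            forall lt, term_order lt -> refines_lex lt ->
              groebner_basis lt (fun u => eval (quo \o a1) u = 0)
                (fun u => exists (r : 'I_c) j,
                   (sb_w b1 j <= r)%N /\ u = rsubmx (rel r j))]].
Proof.
move=> T' a0 a1 T''_deg res' res'' a dg.
have [Ta0 free01 span01 rel1] := tor_structure k_residue f_max f_regular X_minimal b0 b1 M_mod
  sigma_homotopy T_Tor alpha0_lift alpha1_lift.
rewrite -[tor_a0 _ _]/a0 in Ta0 free01 span01 rel1.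
rewrite -[tor_a1 _ _]/a1 in free01 span01 rel1.
have grT := tor_graded k_residue f_max sigma_homotopy T_Tor.
have T'E x : T' x <-> exists u, x = eval a0 u.
  split=> [|[u ->]]; last first.
    by apply: setmul_sum => j _; apply: submod_genZ; apply: submod_gen1; exists (alpha0 (sb_vec b0 j)).
  apply: (@setmul_ind _ _ _ _ (fun x => exists u, x = eval a0 u)).
  - by exists 0; rewrite linear0.
  - by move=> _ _ [u ->] [v ->]; exists (u + v); rewrite linearD.
  move=> y _ _ /span01[u0 [u1 [_ _ _ h1 ->]]]; exists (y *: u0).
  (* A term over [A_1] has degree at least one, so none occurs in degree 0. *)
  rewrite (_ : u1 = 0) ?linear0 ?addr0 ?linearZ //.
  apply: row_ext => j A; rewrite mxE ecoef0; apply/eqP/negPn/negP => /h1.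
  by rewrite addn1.
have quoE x : quo x = 0 <-> exists u, x = eval a0 u by rewrite quo_ker -T'E.
have quo_a0 u : quo (eval a0 u) = 0 by apply/quoE; exists u.
have Fa0 : layered_free (sb_w b0) a0.
  move=> u lu u0; have [] // := free01 u 0 lu.
    by move=> j A; rewrite mxE ecoef0 eqxx.
  by rewrite u0 linear0 addr0.
(* The quadratic terms over [A_0] in [rel1] are killed by [quo]. *)
have Ta1 : triangular (sb_w b1) (quo \o a1).
  move=> r j /rel1[u0 [u1 [_ h1 e]]]; exists u1; split=> //=.
  by rewrite -linearZ e linearD quo_a0 add0r eval_map.
(* A layered relation modulo [T'] has the form [eval a1 u = eval a0 v]; only after [v] is brought to
   normal form does joint freeness apply. *)
have Fa1 : layered_free (sb_w b1) (quo \o a1).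
  move=> u lu; rewrite -eval_map => /quoE[v e].
  have [v' [lv' ev']] := triangular_normal_form v Ta0.
  have [] // := free01 (- v') u _ lu.
    by apply/layeredP/onrowN/layeredP.
  by rewrite linearN /= ev' -e addNr.
have spanT x : exists u0 u1, x = eval a0 u0 + eval a1 u1.
  have [m [z [cz ->]]] := tor_sum T_Tor x; elim/big_ind: _ => [|y y' [u0 [u1 ->]] [v0 [v1 ->]]|n _].
  - by exists 0, 0; rewrite !linear0 addr0.
  - by exists (u0 + v0), (u1 + v1); rewrite !linearD addrACA.
  have [|u0 [u1 [_ _ _ _ ->]]] := span01 n (cl n (z n)); first by exists (z n).
  by exists u0, u1.
have span1 y : exists u, y = eval (quo \o a1) u.
  have [x <-] := quo_surj y; have [u0 [u1 ->]] := spanT x.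
  by exists u1; rewrite linearD quo_a0 add0r eval_map.
have T''E y : True <-> exists u, y = eval (quo \o a1) u by split.
have da0 j : tor_deg cl 0%N (a0 j) by exists (alpha0 (sb_vec b0 j)).
have da1 j : tor_deg cl 1%N (a1 j).
  by exists (alpha1 (sb_vec b1 j)) => //; exact: (alpha1_cycle alpha1_lift X_minimal).
have dqa1 j : T''_deg 1%N (quo (a1 j)) by exists (a1 j).
have grT'' : is_graded T''_deg := quotient_graded grT da0 quoE.
have lin' : linear_system (tor_deg cl) T' 0 by exists (sb_n b0), (sb_w b0), a0.
have lin'' : linear_system T''_deg (fun _ => True) 1 by exists (sb_n b1), (sb_w b1), (quo \o a1).
have dg_l j : dg (lshift (sb_n b1) j) = 0%N by exact: split_case_l.
have dg_r j : dg (rshift (sb_n b0) j) = 1%N by exact: split_case_r.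
split.
- by split; apply: triangular_decomposition.
- by split=> //; [exact: linear_resolution_exists | exact: linear_resolution_exists].
- move=> G' g' G'' g'' rG' mG' rG'' mG''; apply: (horseshoe (d := 0%N) grT _ rG' mG' _ rG'' mG'').
  + exact: quo_ker.
  + exact: minimal_resolution_linear grT lin' rG' mG'.
  exact: minimal_resolution_linear grT'' lin'' rG'' mG''.
split.
- move=> r j /Ta0[u [hu e]]; eexists; apply: (leading_relation_exists (u := u) (v := 0)).
    by rewrite split_case_l e linear0 addr0.
  apply: onrow_row_mx; last exact: onrow0.
  apply: onrowW hu => A l /and3P[/cards1P[i ->] bA _].
  rewrite !dg_l cards1 addn0 eqxx andbT; apply/existsP; exists i.
  by rewrite inE eqxx /=; apply: (blwP _ _ bA); rewrite inE.
- move=> r j /rel1[u0 [u1 [h0 h1 e]]]; eexists; apply: (leading_relation_exists (u := u0) (v := u1)).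
    by rewrite split_case_r.
  apply: onrow_row_mx.
    apply: onrowW h0 => A l /andP[/eqP cA bA]; rewrite dg_l dg_r cA eqxx andbT.
    have /card_gt0P[i Ai] : (0 < #|A|)%N by rewrite cA.
    by apply/existsP; exists i; rewrite Ai; apply: (blwP _ _ bA).
  apply: onrowW h1 => A l /and3P[/cards1P[i ->] bA _].
  rewrite !dg_r cards1 eqxx andbT; apply/existsP; exists i.
  by rewrite inE eqxx /=; apply: (blwP _ _ bA); rewrite inE.
- move=> rel hrel.
  (* A relation led by a vector of [A_0] has degree one. A term over [A_1] would need a constant
     coefficient, but the monomials of [b] all contain some [e_i]. *)
  have shape (r : 'I_c) j : (sb_w b0 j <= r)%N -> rsubmx (rel r j) = 0 /\
      exists2 b, lsubmx (rel r j) = egen k r *: delta_mx 0 j - b &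
        onrow (fun A _ => [exists i : 'I_c, (A == [set i]) && (i < r)%N]) b.
    move=> /hrel/leading_relation_shape[b -> hb]; split.
      apply: row_ext => l A; rewrite !mxE ecoefD ecoefN ecoef0 eq_rlshift andbF mulr0 ecoef0 sub0r.
      apply/eqP; rewrite oppr_eq0; apply/negPn/negP => /hb; rewrite dg_l dg_r addn1 eqSS eq_sym cards_eq0.
      by case/andP=> /existsP[i /andP[Ai _]] /eqP A0; rewrite A0 inE in Ai.
    exists (lsubmx b).
      by apply/rowP => l; rewrite !mxE eq_lshift.
    move=> A l; rewrite mxE => /hb; rewrite !dg_l addn0 => /andP[/existsP[i /andP[Ai lt_i]]].
    rewrite eq_sym => /cards1P[i' defA]; apply/existsP; exists i'; rewrite defA eqxx /=.
    by move: Ai; rewrite defA inE => /eqP <-.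
  split=> [r j /shape[] //|lt tlt rlt]; apply: (groebner_layered (w := sb_w b0)) => // r j le_j.
    have [r0 _] := shape r j le_j; have [e _ _] := hrel r j le_j.
    by move: e; rewrite eval_split_case r0 linear0 addr0.
  by case: (shape r j le_j).
move=> rel hrel lt tlt rlt; apply: (groebner_layered (w := sb_w b1)) => // r j le_j.
  have [e _ _] := hrel r j le_j; rewrite -eval_map.
  by move/(congr1 quo): e; rewrite eval_split_case linearD quo_a0 add0r linear0.
have [b -> hb] := leading_relation_shape (hrel r j le_j); exists (rsubmx b).
  by apply/rowP => l; rewrite !mxE eq_rshift.
move=> A l; rewrite mxE => /hb; rewrite !dg_r addn1 eqSS => /andP[/existsP[i /andP[Ai lt_i]]].
rewrite eq_sym => /cards1P[i' defA]; apply/existsP; exists i'; rewrite defA eqxx /=.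
by move: Ai; rewrite defA inE => /eqP <-.
Qed.
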